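(* The closed fragment $\mathbf{IL}_0$ of $\mathbf{IL}$, i.e. the set of formulas containing no propositional variables that are theorems of $\mathbf{IL}$, is PSPACE-hard (with respect to polynomial-time many-one reductions).
   Context: $\mathbf{IL}$ is the logic in the language with a unary modality $\Box$ and a binary modality $\rhd$ (formulas built from propositional variables, $\bot$, $\to$, $\Box$, $\rhd$; $\Diamond\varphi$ abbreviates $\neg\Box\neg\varphi$, $\top$ abbreviates $\neg\bot$), with rules Modus Ponens and Necessitation, whose axioms are all propositional tautologies, all instances of $\Box(A\to B)\to(\Box A\to\Box B)$ and $\Box(\Box A\to A)\to\Box A$, and all instances of: (J1) $\Box(A\to B)\to A\rhd B$; (J2) $(A\rhd B)\wedge(B\rhd C)\to A\rhd C$; (J3) $(A\rhd C)\wedge(B\rhd C)\to (A\vee B)\rhd C$; (J4) $A\rhd B\to(\Diamond A\to\Diamond B)$; (J5) $\Diamond A\rhd A$. *)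

(* Defs.v *)
From Stdlib Require Import Arith List Bool.
Import ListNotations.

Inductive form : Type :=
| Var : nat -> form
| Bot : form
| Imp : form -> form -> form
| Box : form -> form
| Rhd : form -> form -> form.

Definition Neg (A : form) : form := Imp A Bot.
Definition Top : form := Neg Bot.
Definition Dia (A : form) : form := Neg (Box (Neg A)).
Definition Or (A B : form) : form := Imp (Neg A) B.
Definition And (A B : form) : form := Neg (Imp A (Neg B)).

Fixpoint peval (v : form -> bool) (A : form) : bool :=
  match A with
  | Var _ => v A
  | Bot => false
  | Imp B C => implb (peval v B) (peval v C)
  | Box _ => v A
  | Rhd _ _ => v A
  end.

Definition taut (A : form) : Prop := forall v, peval v A = true.

Inductive ILthm : form -> Prop :=
| IL_taut A : taut A -> ILthm A
| IL_K A B : ILthm (Imp (Box (Imp A B)) (Imp (Box A) (Box B)))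
| IL_L A : ILthm (Imp (Box (Imp (Box A) A)) (Box A))
| IL_J1 A B : ILthm (Imp (Box (Imp A B)) (Rhd A B))
| IL_J2 A B C : ILthm (Imp (And (Rhd A B) (Rhd B C)) (Rhd A C))
| IL_J3 A B C : ILthm (Imp (And (Rhd A C) (Rhd B C)) (Rhd (Or A B) C))
| IL_J4 A B : ILthm (Imp (Rhd A B) (Imp (Dia A) (Dia B)))
| IL_J5 A : ILthm (Rhd (Dia A) A)
| IL_MP A B : ILthm (Imp A B) -> ILthm A -> ILthm B
| IL_Nec A : ILthm A -> ILthm (Box A).

Fixpoint closed (A : form) : bool :=
  match A with
  | Var _ => false
  | Bot => true
  | Imp B C => closed B && closed C
  | Box B => closed B
  | Rhd B C => closed B && closed C
  end.

(* Standard prefix-free (Polish notation) binary encoding of formulas: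
   Bot = 000, Imp = 001, Box = 010, Rhd = 011, Var n = 1 1^n 0. *)
Fixpoint enc (A : form) : list bool :=
  match A with
  | Var n => true :: repeat true n ++ [false]
  | Bot => [false; false; false]
  | Imp B C => [false; false; true] ++ enc B ++ enc C
  | Box B => [false; true; false] ++ enc B
  | Rhd B C => [false; true; true] ++ enc B ++ enc C
  end.

Definition IL0 (w : list bool) : Prop :=
  exists A, closed A = true /\ enc A = w /\ ILthm A.

(* Deterministic single-tape Turing machines over the tape alphabet
   {0,1,blank} (blank = None), with finitely many states 0..nstates-1. *)
Inductive move := MLeft | MRight | MStay.

Record TM := mkTM {
  nstates : nat;
  start : nat;
  qacc : nat;
  qrej : nat;
  delta : nat -> option bool -> nat * option bool * move
}.

Definition TM_wf (M : TM) : Prop :=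
  start M < nstates M /\ qacc M < nstates M /\ qrej M < nstates M /\
  forall q s, q < nstates M -> fst (fst (delta M q s)) < nstates M.

(* Configuration: state, tape to the left of the head (nearest cell first),
   symbol under the head, tape to the right of the head. The lists only
   contain the cells visited so far (or occupied by the input). *)
Record config := mkConfig {
  cstate : nat;
  cleft : list (option bool);
  chead : option bool;
  cright : list (option bool)
}.

Definition init (M : TM) (w : list bool) : config :=
  match w with
  | [] => mkConfig (start M) [] None []
  | b :: w' => mkConfig (start M) [] (Some b) (map Some w')
  end.

Definition halting (M : TM) (q : nat) : bool :=
  Nat.eqb q (qacc M) || Nat.eqb q (qrej M).

Definition step (M : TM) (c : config) : config :=
  if halting M (cstate c) then c else
  match delta M (cstate c) (chead c) with
  | (q', s, MStay) => mkConfig q' (cleft c) s (cright c)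
  | (q', s, MLeft) =>
      match cleft c with
      | [] => mkConfig q' [] None (s :: cright c)
      | x :: l => mkConfig q' l x (s :: cright c)
      end
  | (q', s, MRight) =>
      match cright c with
      | [] => mkConfig q' (s :: cleft c) None []
      | x :: r => mkConfig q' (s :: cleft c) x r
      end
  end.

Definition run (M : TM) (n : nat) (w : list bool) : config :=
  Nat.iter n (step M) (init M w).

Definition cells (c : config) : nat := length (cleft c) + S (length (cright c)).

Fixpoint read_out (l : list (option bool)) : list bool :=
  match l with
  | Some b :: l' => b :: read_out l'
  | _ => []
  end.
Definition output (c : config) : list bool := read_out (chead c :: cright c).

Definition poly (c k n : nat) : nat := c * n ^ k + c.

Definition in_PSPACE (L : list bool -> Prop) : Prop :=
  exists (M : TM) (c k : nat), TM_wf M /\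
    forall w, exists n,
      halting M (cstate (run M n w)) = true /\
      (cstate (run M n w) = qacc M <-> L w) /\
      forall m, m <= n -> cells (run M m w) <= poly c k (length w).

Definition poly_time_computable (f : list bool -> list bool) : Prop :=
  exists (M : TM) (c k : nat), TM_wf M /\
    forall w, exists n, n <= poly c k (length w) /\
      halting M (cstate (run M n w)) = true /\
      output (run M n w) = f w.

Definition pm_reduces (L1 L2 : list bool -> Prop) : Prop :=
  exists f, poly_time_computable f /\ forall w, L1 w <-> L2 (f w).

Definition PSPACE_hard (L : list bool -> Prop) : Prop :=
  forall L', in_PSPACE L' -> pm_reduces L' L.

(* Main.v *)
(* The truth of [~Box^l Bot |> ~Box^(l+1) Bot] at a world [w] of rank above [l+1] says that from
   the worlds of rank [l] below [w] one can move by [S_w] to a higher rank. Over a linear chain of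
   ranks these statements are independent for different [l] and, since [S_w] depends on [w], also
   for different [w]: closed formulas of IL simulate modal logic with arbitrarily many variables.

   A node of rank [V+1+t] stores two configurations [c], [c'] of a polynomial space machine, and
   Horn formulas say that [c'] is reached from [c] in [2^t] steps: one child runs from [c] to a
   middle configuration, another one from there to [c']. If the machine accepts, then the
   acceptance of [c'] is derived at the root by induction on [t]; if not, then the Savitch tree
   of the actual computation is a Veltman countermodel. The formulas are printed by nested loops
   over counters of polynomial size, which a single tape machine runs with interleaved unary
   counters. *)

From Stdlib Require Import Arith List Bool ZArith Lia.
From Stdlib Require Import FunctionalExtensionality Classical ClassicalEpsilon.
Require Import Defs.
Import ListNotations.

(** * Structured tape programs *)

(** The two directions use the formulas differently. In the derivation [pvar l] is an opaque atom:
    the machine is deterministic, so the middle configuration is not guessed but derived, Horn rules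
    suffice, and K, Necessitation and the transitivity of [Box] carry the induction. Only the
    countermodel looks inside [pvar l]; there the worlds of rank at most [V] are shared by all
    nodes, and [S_w] alone codes the truth values at [w].

    A box speaks of all successors, not just of the children. Hence every rule carries [level]
    formulas that pin the rank, and variable 0 separates the two kinds of children. The root has
    [t = V], because the [V] variables suffice to bound the number of configurations by [2 ^ V].

    Polynomial time refers to one concrete kind of machine, hence the explicit compiler and its time
    bounds. *)

Inductive tprog : Type :=
| Act : (option bool -> option bool * move) -> tprog
| Seq : tprog -> tprog -> tprog
| Ifs : (option bool -> bool) -> tprog -> tprog -> tprog
| Whl : (option bool -> bool) -> tprog -> tprog.

Definition tape := Z -> option bool.

Definition upd (T : tape) (p : Z) (s : option bool) : tape :=
  fun z => if Z.eqb z p then s else T z.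

Definition shift (m : move) (z : Z) : Z :=
  match m with MLeft => z - 1 | MRight => z + 1 | MStay => z end%Z.

Inductive texec : tprog -> tape -> Z -> tape -> Z -> nat -> Prop :=
| X_act (f : option bool -> option bool * move) (T : tape) (z : Z) :
    texec (Act f) T z (upd T z (fst (f (T z)))) (shift (snd (f (T z))) z) 1
| X_seq p q T z T1 z1 T2 z2 n1 n2 :
    texec p T z T1 z1 n1 -> texec q T1 z1 T2 z2 n2 ->
    texec (Seq p q) T z T2 z2 (n1 + n2)
| X_if (P : option bool -> bool) p q (T : tape) z T' z' n :
    texec (if P (T z) then p else q) T z T' z' n ->
    texec (Ifs P p q) T z T' z' (S n)
| X_while_stop (P : option bool -> bool) p (T : tape) z :
    P (T z) = false -> texec (Whl P p) T z T z 1
| X_while_loop (P : option bool -> bool) p (T : tape) z T1 z1 T2 z2 n1 n2 :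
    P (T z) = true -> texec p T z T1 z1 n1 ->
    texec (Whl P p) T1 z1 T2 z2 n2 ->
    texec (Whl P p) T z T2 z2 (S (n1 + n2)).

Definition instr := option bool -> nat * option bool * move.

Fixpoint tsize (p : tprog) : nat :=
  match p with
  | Act _ => 1
  | Seq p q => tsize p + tsize q
  | Ifs _ p q => S (tsize p + tsize q)
  | Whl _ p => S (tsize p)
  end.

(** Instructions for the states from [base] on; control leaves to [next]. A test occupies a state of
    its own that neither writes nor moves. *)
Fixpoint tcode (p : tprog) (base next : nat) : list instr :=
  match p with
  | Act f => [fun s => (next, fst (f s), snd (f s))]
  | Seq p q => tcode p base (base + tsize p) ++ tcode q (base + tsize p) next
  | Ifs P p q =>
      (fun s => (if P s then S base else S base + tsize p, s, MStay))
      :: tcode p (S base) next ++ tcode q (S base + tsize p) next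
  | Whl P p =>
      (fun s => (if P s then S base else next, s, MStay)) :: tcode p (S base) base
  end.

Definition machine (p : tprog) : TM :=
  mkTM (tsize p + 2) 0 (tsize p) (S (tsize p))
       (fun q s => nth q (tcode p 0 (tsize p)) (fun s => (tsize p, s, MStay)) s).

Lemma tcode_length p base next : length (tcode p base next) = tsize p.
Proof.
  revert base next; induction p; intros; simpl; rewrite ?length_app; auto.
Qed.

Lemma tcode_target p base next i d s :
  i < tsize p ->
  let q := fst (fst (nth i (tcode p base next) d s)) in
  q = next \/ (base <= q < base + tsize p).
Proof.
  revert base next i; induction p as [f|p IHp q IHq|P p IHp q IHq|P p IHp];
    intros base next i Hi; simpl in *.
  - destruct i; [simpl; auto | lia].
  - destruct (Nat.lt_ge_cases i (tsize p)) as [H|H].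
    + rewrite app_nth1 by (rewrite tcode_length; lia).
      specialize (IHp base (base + tsize p) i H); cbv zeta in IHp.
      assert (0 < tsize q) by (clear; induction q; simpl; lia). lia.
    + rewrite app_nth2 by (rewrite tcode_length; lia). rewrite tcode_length.
      specialize (IHq (base + tsize p) next (i - tsize p)).
      cbv zeta in IHq. lia.
  - destruct i as [|i].
    + simpl. assert (0 < tsize p) by (clear; induction p; simpl; lia).
      assert (0 < tsize q) by (clear; induction q; simpl; lia).
      destruct (P s); lia.
    + destruct (Nat.lt_ge_cases i (tsize p)) as [H|H].
      * rewrite app_nth1 by (rewrite tcode_length; lia).
        specialize (IHp (S base) next i H); cbv zeta in IHp. lia.
      * rewrite app_nth2 by (rewrite tcode_length; lia). rewrite tcode_length.
        specialize (IHq (S base + tsize p) next (i - tsize p)).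
        cbv zeta in IHq. simpl in IHq. lia.
  - destruct i as [|i].
    + simpl. assert (0 < tsize p) by (clear; induction p; simpl; lia).
      destruct (P s); lia.
    + specialize (IHp (S base) base i); cbv zeta in IHp. lia.
Qed.

Lemma machine_wf p : TM_wf (machine p).
Proof.
  unfold TM_wf; simpl. repeat split; try lia.
  intros q s _. destruct (Nat.lt_ge_cases q (tsize p)) as [H|H].
  - pose proof (tcode_target p 0 (tsize p) q (fun s => (tsize p, s, MStay)) s H) as Ht.
    cbv zeta in Ht. lia.
  - rewrite nth_overflow by (rewrite tcode_length; lia). simpl; lia.
Qed.

(** The lists of a configuration end where no cell has been visited. Reading them with default
    [None] compares them with a two-way infinite tape and ignores trailing blanks. *)
Definition agrees (c : config) (T : tape) (z : Z) : Prop :=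
  chead c = T z /\
  (forall i, nth i (cleft c) None = T (z - 1 - Z.of_nat i)%Z) /\
  (forall i, nth i (cright c) None = T (z + 1 + Z.of_nat i)%Z).

Lemma step_agrees M c T z q' s m :
  halting M (cstate c) = false -> agrees c T z ->
  delta M (cstate c) (T z) = (q', s, m) ->
  cstate (step M c) = q' /\ agrees (step M c) (upd T z s) (shift m z).
Proof.
  intros Hh (Hc & Hl & Hr) Hd. unfold step. rewrite Hh, Hc, Hd.
  assert (Hup : forall y, (y <> z)%Z -> upd T z s y = T y).
  { intros y Hy. unfold upd. destruct (Z.eqb_spec y z); congruence. }
  assert (Hz : upd T z s z = s) by (unfold upd; rewrite Z.eqb_refl; auto).
  destruct c as [q l h r]; simpl in *.
  destruct m; simpl.
  - destruct l as [|x l]; simpl; (split; [auto|]); repeat split; simpl.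
    + rewrite Hup by lia. specialize (Hl 0); simpl in Hl. rewrite Hl; f_equal; lia.
    + intros i. rewrite Hup by lia. specialize (Hl (S i)); simpl in Hl.
      destruct i; rewrite Hl; f_equal; lia.
    + intros [|i].
      * rewrite <- Hz at 1. f_equal; lia.
      * rewrite Hup by lia. rewrite Hr. f_equal; lia.
    + rewrite Hup by lia. specialize (Hl 0); simpl in Hl. rewrite Hl; f_equal; lia.
    + intros i. rewrite Hup by lia. specialize (Hl (S i)); simpl in Hl.
      rewrite Hl; f_equal; lia.
    + intros [|i].
      * rewrite <- Hz at 1. f_equal; lia.
      * rewrite Hup by lia. rewrite Hr. f_equal; lia.
  - destruct r as [|x r]; simpl; (split; [auto|]); repeat split; simpl.
    + rewrite Hup by lia. specialize (Hr 0); simpl in Hr. rewrite Hr; f_equal; lia.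
    + intros [|i].
      * rewrite <- Hz at 1. f_equal; lia.
      * rewrite Hup by lia. rewrite Hl. f_equal; lia.
    + intros i. rewrite Hup by lia. specialize (Hr (S i)); simpl in Hr.
      destruct i; rewrite Hr; f_equal; lia.
    + rewrite Hup by lia. specialize (Hr 0); simpl in Hr. rewrite Hr; f_equal; lia.
    + intros [|i].
      * rewrite <- Hz at 1. f_equal; lia.
      * rewrite Hup by lia. rewrite Hl. f_equal; lia.
    + intros i. rewrite Hup by lia. specialize (Hr (S i)); simpl in Hr.
      rewrite Hr; f_equal; lia.
  - split; [auto|]. repeat split; simpl; auto; intros i; rewrite Hup by lia; auto.
Qed.

(** Says that [p] sits at address [base] inside an arbitrary machine, so that correctness goes by
    induction on subprograms of one fixed machine. *)
Definition has_code (M : TM) (p : tprog) (base next : nat) : Prop :=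
  forall i, i < tsize p ->
    halting M (base + i) = false /\
    forall s, delta M (base + i) s
              = nth i (tcode p base next) (fun s => (next, s, MStay)) s.

Lemma has_code_seq M p q base next :
  has_code M (Seq p q) base next ->
  has_code M p base (base + tsize p) /\ has_code M q (base + tsize p) next.
Proof.
  intros H. split; intros i Hi.
  - destruct (H i) as [H1 H2]; [simpl; lia|]. split; auto.
    intros s. rewrite H2. simpl. rewrite app_nth1 by (rewrite tcode_length; lia).
    (* The default of [nth] mentions the exit state, which differs for the subprogram; the index is
       in range. *)
    refine (f_equal (fun g : instr => g s) _). apply nth_indep. rewrite tcode_length; lia.
  - destruct (H (tsize p + i)) as [H1 H2]; [simpl; lia|].
    rewrite Nat.add_assoc in H1, H2. split; auto.
    intros s. rewrite H2. simpl. rewrite app_nth2 by (rewrite tcode_length; lia).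
    rewrite tcode_length. do 2 f_equal. lia.
Qed.

Lemma has_code_if M P p q base next :
  has_code M (Ifs P p q) base next ->
  halting M base = false /\
  (forall s, delta M base s = (if P s then S base else S base + tsize p, s, MStay)) /\
  has_code M p (S base) next /\ has_code M q (S base + tsize p) next.
Proof.
  intros H. destruct (H 0) as [H1 H2]; [simpl; lia|].
  rewrite Nat.add_0_r in H1, H2. split; [auto|]. split; [exact H2|].
  split; intros i Hi.
  - destruct (H (S i)) as [H3 H4]; [simpl; lia|].
    rewrite <- Nat.add_succ_comm in H3, H4. split; auto. intros s. rewrite H4.
    simpl. rewrite app_nth1 by (rewrite tcode_length; lia). auto.
  - destruct (H (S (tsize p + i))) as [H3 H4]; [simpl; lia|].
    replace (base + S (tsize p + i)) with (S base + tsize p + i) in H3, H4 by lia.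
    split; auto. intros s. rewrite H4. simpl.
    rewrite app_nth2 by (rewrite tcode_length; lia).
    rewrite tcode_length. do 2 f_equal. lia.
Qed.

Lemma has_code_while M P p base next :
  has_code M (Whl P p) base next ->
  halting M base = false /\
  (forall s, delta M base s = (if P s then S base else next, s, MStay)) /\
  has_code M p (S base) base.
Proof.
  intros H. destruct (H 0) as [H1 H2]; [simpl; lia|].
  rewrite Nat.add_0_r in H1, H2. split; [auto|]. split; [exact H2|].
  intros i Hi. destruct (H (S i)) as [H3 H4]; [simpl; lia|].
  rewrite <- Nat.add_succ_comm in H3, H4. split; auto. intros s. rewrite H4. simpl.
  refine (f_equal (fun g : instr => g s) _). apply nth_indep. rewrite tcode_length; lia.
Qed.

Lemma upd_same T z : upd T z (T z) = T.
Proof.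
  apply functional_extensionality; intros y. unfold upd.
  destruct (Z.eqb_spec y z); congruence.
Qed.

Lemma iter_plus {A} (f : A -> A) n m x :
  Nat.iter (n + m) f x = Nat.iter m f (Nat.iter n f x).
Proof. rewrite Nat.add_comm. induction m; simpl; congruence. Qed.

Lemma tcode_correct M p T z T' z' n :
  texec p T z T' z' n -> forall base next c,
  has_code M p base next -> cstate c = base -> agrees c T z ->
  cstate (Nat.iter n (step M) c) = next /\ agrees (Nat.iter n (step M) c) T' z'.
Proof.
  induction 1 as [f T z | p q T z T1 z1 T2 z2 n1 n2 H1 IH1 H2 IH2
                 | P p q T z T' z' n H IH | P p T z HP
                 | P p T z T1 z1 T2 z2 n1 n2 HP H1 IH1 H2 IH2];
    intros base next c Hcode Hq Ha.
  - destruct (Hcode 0) as [Hh Hd]; [simpl; lia|].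
    rewrite Nat.add_0_r in Hh, Hd. subst base.
    apply step_agrees; auto; apply Hd.
  - apply has_code_seq in Hcode as [Hp Hc]. rewrite iter_plus.
    destruct (IH1 _ _ _ Hp Hq Ha) as [Hq1 Ha1]. eapply IH2; eauto.
  - apply has_code_if in Hcode as (Hh & Hd & Hp & Hc). subst base.
    destruct (step_agrees M c T z _ _ _ Hh Ha (Hd (T z))) as [Hq1 Ha1].
    rewrite upd_same in Ha1. simpl in Ha1.
    change (S n) with (1 + n). rewrite iter_plus.
    destruct (P (T z)); eapply IH; eauto.
  - apply has_code_while in Hcode as (Hh & Hd & Hp). subst base.
    destruct (step_agrees M c T z _ _ _ Hh Ha (Hd (T z))) as [Hq1 Ha1].
    rewrite upd_same in Ha1. rewrite HP in Hq1. auto.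
  - pose proof Hcode as Hcode'.
    apply has_code_while in Hcode as (Hh & Hd & Hp). subst base.
    destruct (step_agrees M c T z _ _ _ Hh Ha (Hd (T z))) as [Hq1 Ha1].
    rewrite upd_same in Ha1. rewrite HP in Hq1. simpl in Ha1.
    change (S (n1 + n2)) with (1 + (n1 + n2)). rewrite iter_plus, iter_plus.
    destruct (IH1 _ _ _ Hp Hq1 Ha1) as [Hq2 Ha2]. eapply IH2; eauto.
Qed.

(** The first input bit is at position 2: cell 0 becomes the base cell of the counters and cell 1
    the blank that precedes the unread input even when [gap] is 0. *)
Definition input_tape (w : list bool) : tape :=
  fun z => if (z <=? 1)%Z then None else nth (Z.to_nat (z - 2)) (map Some w) None.

Lemma read_out_nth l o :
  (forall i, nth i l None = nth i (map Some o) None) -> read_out l = o.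
Proof.
  revert o; induction l as [|x l IH]; intros [|b o] H; simpl; auto.
  - specialize (H 0); simpl in H; discriminate.
  - specialize (H 0); simpl in H; subst; auto.
  - pose proof (H 0) as H0; simpl in H0; subst. f_equal. apply IH.
    intros i. apply (H (S i)).
Qed.

Lemma machine_computes p w T z n o :
  texec p (input_tape w) 2 T z n ->
  (forall i, T (z + Z.of_nat i)%Z = nth i (map Some o) None) ->
  halting (machine p) (cstate (run (machine p) n w)) = true /\
  output (run (machine p) n w) = o.
Proof.
  intros Hx Ho.
  assert (Hcode : has_code (machine p) p 0 (tsize p)).
  { intros i Hi. split; [|reflexivity]. unfold halting; simpl.
    destruct (Nat.eqb_spec i (tsize p)); [lia|].
    destruct (Nat.eqb_spec i (S (tsize p))); [lia|reflexivity]. }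
  assert (Ha : agrees (init (machine p) w) (input_tape w) 2).
  { unfold init, input_tape. destruct w as [|b w]; (split; [reflexivity|split]);
      cbn [cleft cright]; intros i.
    - destruct (Z.leb_spec (2 - 1 - Z.of_nat i) 1); [destruct i; auto | lia].
    - destruct (Z.leb_spec (2 + 1 + Z.of_nat i) 1); [lia|].
      destruct (Z.to_nat (2 + 1 + Z.of_nat i - 2)), i; auto.
    - destruct (Z.leb_spec (2 - 1 - Z.of_nat i) 1); [destruct i; auto | lia].
    - destruct (Z.leb_spec (2 + 1 + Z.of_nat i) 1); [lia|].
      replace (Z.to_nat (2 + 1 + Z.of_nat i - 2)) with (S i) by lia. reflexivity. }
  assert (Hs : cstate (init (machine p) w) = 0) by (destruct w; reflexivity).
  destruct (tcode_correct _ _ _ _ _ _ _ Hx _ _ _ Hcode Hs Ha) as [Hq (Hc & Hl & Hr)].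
  unfold run. split.
  - rewrite Hq. unfold halting; simpl. rewrite Nat.eqb_refl. reflexivity.
  - unfold output. apply read_out_nth. intros [|i].
    + simpl nth at 1. rewrite Hc, <- Ho. f_equal; lia.
    + change (nth (S i) (chead ?c :: cright ?c) None) with (nth i (cright c) None).
      simpl nth at 1. rewrite Hr, <- Ho. f_equal; lia.
Qed.

(** * Counter programs on a single tape *)

(** [gap] counts the input bits already consumed, whose cells have been blanked. *)
Record store := mkStore {
  ctr : nat -> nat;
  gap : nat;
  inp : list bool;
  out : list bool
}.

Definition set_ctr (f : nat -> nat) (j v : nat) : nat -> nat :=
  fun i => if i =? j then v else f i.

Inductive cmd : Type :=
| CSkip : cmd
| CInc : nat -> cmd
| CDec : nat -> cmd
| CEmit : bool -> cmd
| CSeq : cmd -> cmd -> cmd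
| CWhile : nat -> cmd -> cmd
| CRead : cmd -> cmd -> cmd.

Inductive cexec : cmd -> store -> store -> nat -> Prop :=
| E_skip s : cexec CSkip s s 1
| E_inc j (f : nat -> nat) g i o :
    cexec (CInc j) (mkStore f g i o) (mkStore (set_ctr f j (S (f j))) g i o) 1
| E_dec j (f : nat -> nat) g i o :
    0 < f j ->
    cexec (CDec j) (mkStore f g i o) (mkStore (set_ctr f j (f j - 1)) g i o) 1
| E_emit b f g i (o : list bool) :
    cexec (CEmit b) (mkStore f g i o) (mkStore f g i (o ++ [b])) 1
| E_seq c1 c2 s s1 s2 k1 k2 :
    cexec c1 s s1 k1 -> cexec c2 s1 s2 k2 -> cexec (CSeq c1 c2) s s2 (k1 + k2)
| E_while_stop j c (s : store) : ctr s j = 0 -> cexec (CWhile j c) s s 1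
| E_while_loop j c (s : store) s1 s2 k1 k2 :
    0 < ctr s j -> cexec c s s1 k1 -> cexec (CWhile j c) s1 s2 k2 ->
    cexec (CWhile j c) s s2 (1 + k1 + k2)
| E_read_stop c0 c1 f g o :
    cexec (CRead c0 c1) (mkStore f g [] o) (mkStore f g [] o) 1
| E_read_loop c0 c1 f g (b : bool) i o s1 s2 k1 k2 :
    cexec (if b then c1 else c0) (mkStore f (S g) i o) s1 k1 ->
    cexec (CRead c0 c1) s1 s2 k2 ->
    cexec (CRead c0 c1) (mkStore f g (b :: i) o) s2 (1 + k1 + k2).

(* The counters are unary and interleaved: cell [r * x + j] to the left of the base cell
   (position 0) belongs to counter [j]. The cells with [x = 0] hold [Some false], which stops
   the scans, and for [x > 0] the cell is marked iff [x <= ctr j]. *)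
Definition left_cell (r : nat) (f : nat -> nat) (p : nat) : option bool :=
  if p <? r then Some false else if p / r <=? f (p mod r) then Some true else None.

(* The marked cell after the input guarantees that a block of non-blank cells always lies
   between the consumed part of the input and the blank that separates it from the output. *)
Definition right_cells (s : store) : list (option bool) :=
  repeat None (S (gap s)) ++ map Some (inp s) ++ Some true :: None :: map Some (out s).

Definition tape_of (r : nat) (s : store) : tape :=
  fun z => if (z <=? 0)%Z then left_cell r (ctr s) (Z.to_nat (- z))
           else nth (Z.to_nat (z - 1)) (right_cells s) None.

Definition tx (p : tprog) (T : tape) (z : Z) (T' : tape) (z' : Z) (k : nat) : Prop :=
  exists n, n <= k /\ texec p T z T' z' n.

Lemma tx_weaken p T z T' z' k k' : tx p T z T' z' k -> k <= k' -> tx p T z T' z' k'.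
Proof. intros (n & Hn & H) Hk. exists n; split; [lia|auto]. Qed.

Lemma tx_seq p q T z T1 z1 T2 z2 k1 k2 k :
  tx p T z T1 z1 k1 -> tx q T1 z1 T2 z2 k2 -> k1 + k2 <= k -> tx (Seq p q) T z T2 z2 k.
Proof.
  intros (n1 & H1 & E1) (n2 & H2 & E2) Hk. exists (n1 + n2); split; [lia|].
  econstructor; eauto.
Qed.

Fixpoint moves (m : move) (n : nat) : tprog :=
  match n with
  | 0 => Act (fun s => (s, MStay))
  | S n => Seq (Act (fun s => (s, m))) (moves m n)
  end.

Definition write (s : option bool) : tprog := Act (fun _ => (s, MStay)).

Definition mleft (n : nat) := moves MLeft n.
Definition mright (n : nat) := moves MRight n.

Lemma tx_write s T z T' : upd T z s = T' -> tx (write s) T z T' z 1.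
Proof.
  intros <-. exists 1; split; auto. exact (X_act (fun _ => (s, MStay)) T z).
Qed.

Lemma texec_keep m T z : texec (Act (fun s => (s, m))) T z T (shift m z) 1.
Proof.
  pose proof (X_act (fun s => (s, m)) T z) as H. simpl in H.
  rewrite upd_same in H. exact H.
Qed.

Lemma tx_mleft n T z z' : (z' = z - Z.of_nat n)%Z -> tx (mleft n) T z T z' (S n).
Proof.
  revert z; induction n; intros z ->.
  - exists 1; split; auto. replace (z - Z.of_nat 0)%Z with (shift MStay z) by (simpl; lia).
    apply texec_keep.
  - eapply (tx_seq _ _ _ _ _ _ _ _ 1 (S n)); [|apply IHn|lia].
    + exists 1; split; auto. apply texec_keep.
    + simpl; lia.
Qed.

Lemma tx_mright n T z z' : (z' = z + Z.of_nat n)%Z -> tx (mright n) T z T z' (S n).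
Proof.
  revert z; induction n; intros z ->.
  - exists 1; split; auto. replace (z + Z.of_nat 0)%Z with (shift MStay z) by (simpl; lia).
    apply texec_keep.
  - eapply (tx_seq _ _ _ _ _ _ _ _ 1 (S n)); [|apply IHn|lia].
    + exists 1; split; auto. apply texec_keep.
    + simpl; lia.
Qed.

Lemma tx_while_stop P p T z : P (T z) = false -> tx (Whl P p) T z T z 1.
Proof. intros. exists 1; split; auto. constructor; auto. Qed.

Lemma tx_while_loop P p T z T1 z1 T2 z2 k1 k2 :
  P (T z) = true -> tx p T z T1 z1 k1 -> tx (Whl P p) T1 z1 T2 z2 k2 ->
  tx (Whl P p) T z T2 z2 (S (k1 + k2)).
Proof.
  intros HP (n1 & H1 & E1) (n2 & H2 & E2). exists (S (n1 + n2)); split; [lia|].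
  econstructor; eauto.
Qed.

(** A round costs one test and the [n + 1] steps of [mleft n]; the last [1] is the failing test. *)
Lemma tx_scan_left P n k T z z' :
  (z' = z - Z.of_nat n * Z.of_nat k)%Z ->
  (forall i, i < k -> P (T (z - Z.of_nat n * Z.of_nat i)%Z) = true) ->
  P (T z') = false ->
  tx (Whl P (mleft n)) T z T z' (k * (n + 2) + 1).
Proof.
  revert z; induction k; intros z Hz Hi Hs.
  - replace z' with z in * by lia. apply tx_while_stop; auto.
  - eapply tx_weaken; [eapply tx_while_loop|].
    + specialize (Hi 0); rewrite <- Hi by lia. do 2 f_equal; lia.
    + apply tx_mleft; reflexivity.
    + apply IHk; [lia| |auto].
      intros i Hk. specialize (Hi (S i)). rewrite <- Hi by lia. do 2 f_equal; lia.
    + lia.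
Qed.

Lemma tx_scan_right P n k T z z' :
  (z' = z + Z.of_nat n * Z.of_nat k)%Z ->
  (forall i, i < k -> P (T (z + Z.of_nat n * Z.of_nat i)%Z) = true) ->
  P (T z') = false ->
  tx (Whl P (mright n)) T z T z' (k * (n + 2) + 1).
Proof.
  revert z; induction k; intros z Hz Hi Hs.
  - replace z' with z in * by lia. apply tx_while_stop; auto.
  - eapply tx_weaken; [eapply tx_while_loop|].
    + specialize (Hi 0); rewrite <- Hi by lia. do 2 f_equal; lia.
    + apply tx_mright; reflexivity.
    + apply IHk; [lia| |auto].
      intros i Hk. specialize (Hi (S i)). rewrite <- Hi by lia. do 2 f_equal; lia.
    + lia.
Qed.

Lemma left_cell_track r f j x :
  j < r ->
  left_cell r f (j + r * x)
  = if x =? 0 then Some false else if x <=? f j then Some true else None.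
Proof.
  intros Hj. unfold left_cell.
  assert (Hd : (j + r * x) / r = x).
  { rewrite Nat.mul_comm, Nat.div_add, Nat.div_small by lia. lia. }
  assert (Hm : (j + r * x) mod r = j).
  { rewrite Nat.mul_comm, Nat.Div0.mod_add, Nat.mod_small by lia. lia. }
  rewrite Hd, Hm. destruct (Nat.ltb_spec (j + r * x) r); destruct (Nat.eqb_spec x 0); auto.
  - destruct x; [lia|nia].
  - subst; lia.
Qed.

Lemma tape_of_left r s z p :
  (z = - Z.of_nat p)%Z -> tape_of r s z = left_cell r (ctr s) p.
Proof.
  intros ->. unfold tape_of. destruct (Z.leb_spec (- Z.of_nat p) 0); [|lia]. f_equal; lia.
Qed.

Lemma tape_of_track r s z j x :
  j < r -> (z = - Z.of_nat (j + r * x))%Z ->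
  tape_of r s z = if x =? 0 then Some false else if x <=? ctr s j then Some true else None.
Proof. intros Hj Hz. rewrite (tape_of_left _ _ _ _ Hz). apply left_cell_track; auto. Qed.

Lemma tape_of_right r s z i :
  (z = Z.of_nat (S i))%Z -> tape_of r s z = nth i (right_cells s) None.
Proof.
  intros ->. unfold tape_of. destruct (Z.leb_spec (Z.of_nat (S i)) 0); [lia|].
  f_equal; lia.
Qed.

Lemma upd_left r f f' g i o q s z :
  (z = - Z.of_nat q)%Z ->
  (forall p, left_cell r f' p = if p =? q then s else left_cell r f p) ->
  upd (tape_of r (mkStore f g i o)) z s = tape_of r (mkStore f' g i o).
Proof.
  intros -> H. apply functional_extensionality; intros y. unfold upd, tape_of; simpl ctr.
  destruct (Z.leb_spec y 0).
  - rewrite H. destruct (Z.eqb_spec y (- Z.of_nat q)), (Nat.eqb_spec (Z.to_nat (- y)) q);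
      auto; lia.
  - destruct (Z.eqb_spec y (- Z.of_nat q)); [lia|reflexivity].
Qed.

Lemma upd_right r s s' q v z :
  (z = Z.of_nat (S q))%Z -> ctr s' = ctr s ->
  (forall i, nth i (right_cells s') None
             = if i =? q then v else nth i (right_cells s) None) ->
  upd (tape_of r s) z v = tape_of r s'.
Proof.
  intros -> Hc H. apply functional_extensionality; intros y. unfold upd, tape_of.
  rewrite Hc. destruct (Z.leb_spec y 0).
  - destruct (Z.eqb_spec y (Z.of_nat (S q))); [lia|reflexivity].
  - rewrite H. destruct (Z.eqb_spec y (Z.of_nat (S q))), (Nat.eqb_spec (Z.to_nat (y - 1)) q);
      auto; lia.
Qed.

(** A unary counter that changes by one changes a single cell of its track; [x] is that cell. *)
Lemma left_cell_set r f j x v s p :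
  j < r -> 0 < x ->
  (forall y, 0 < y -> y <> x -> (y <=? v) = (y <=? f j)) ->
  (if x <=? v then Some true else None) = s ->
  left_cell r (set_ctr f j v) p = if p =? j + r * x then s else left_cell r f p.
Proof.
  intros Hj Hx Hv Hs.
  assert (Hp : p = p mod r + r * (p / r)) by (pose proof (Nat.div_mod_eq p r); lia).
  assert (Hm : p mod r < r) by (apply Nat.mod_upper_bound; lia).
  rewrite Hp at 1 3. rewrite !left_cell_track by auto.
  unfold set_ctr. destruct (Nat.eqb_spec p (j + r * x)) as [E|E].
  - assert (p / r = x /\ p mod r = j) as [-> ->].
    { subst p. split.
      - rewrite Nat.mul_comm, Nat.div_add, Nat.div_small by lia. lia.
      - rewrite Nat.mul_comm, Nat.Div0.mod_add, Nat.mod_small by lia. lia. }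
    rewrite Nat.eqb_refl. destruct (Nat.eqb_spec x 0); [lia|auto].
  - destruct (Nat.eqb_spec (p mod r) j) as [Ej|Ej]; auto.
    destruct (Nat.eqb_spec (p / r) 0) as [E0|E0]; auto.
    rewrite Ej. rewrite Hv; auto; [lia|]. intros Ex. apply E. rewrite Hp, Ej, Ex. reflexivity.
Qed.

Definition is_some (s : option bool) := match s with Some _ => true | None => false end.
Definition is_none (s : option bool) := match s with Some _ => false | None => true end.
Definition is_true (s : option bool) := match s with Some b => b | None => false end.

Lemma right_gap s i : i <= gap s -> nth i (right_cells s) None = None.
Proof.
  intros H. unfold right_cells. rewrite app_nth1 by (rewrite repeat_length; lia).
  apply nth_repeat.
Qed.

Lemma right_after s i :
  nth (S (gap s) + i) (right_cells s) None
  = nth i (map Some (inp s) ++ Some true :: None :: map Some (out s)) None.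
Proof.
  unfold right_cells. rewrite app_nth2 by (rewrite repeat_length; lia).
  rewrite repeat_length. f_equal; lia.
Qed.

Lemma is_some_map (l : list bool) i : is_some (nth i (map Some l) None) = (i <? length l).
Proof.
  revert i; induction l as [|b l IH]; intros [|i]; try reflexivity. apply IH.
Qed.

Lemma right_inp s i :
  i <= length (inp s) -> is_some (nth (S (gap s) + i) (right_cells s) None) = true.
Proof.
  intros H. rewrite right_after. destruct (Nat.eq_dec i (length (inp s))) as [->|Hn].
  - rewrite app_nth2 by (rewrite length_map; lia). rewrite length_map, Nat.sub_diag. auto.
  - rewrite app_nth1 by (rewrite length_map; lia). rewrite is_some_map.
    apply Nat.ltb_lt; lia.
Qed.

Lemma right_out s i :
  nth (S (gap s) + (length (inp s) + 2) + i) (right_cells s) None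
  = nth i (map Some (out s)) None.
Proof.
  rewrite <- Nat.add_assoc, right_after. rewrite app_nth2 by (rewrite length_map; lia).
  rewrite length_map. replace (length (inp s) + 2 + i - length (inp s)) with (S (S i)) by lia.
  reflexivity.
Qed.

Lemma right_sep s : nth (S (gap s) + (length (inp s) + 1)) (right_cells s) None = None.
Proof.
  rewrite right_after, app_nth2 by (rewrite length_map; lia).
  rewrite length_map. replace (length (inp s) + 1 - length (inp s)) with 1 by lia. reflexivity.
Qed.

Definition bounded (B : nat) (s : store) : Prop :=
  (forall j, ctr s j <= B) /\ gap s + length (inp s) + length (out s) <= B.

(** The first scan stops at the blank digit just beyond the counter value; the second returns to the
    [Some false] at the foot of track [j], which lies [j] cells to the left of the base. *)
Definition inc_prog (r j : nat) : tprog :=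
  Seq (mleft (j + r)) (Seq (Whl is_true (mleft r)) (Seq (write (Some true))
    (Seq (mright r) (Seq (Whl is_true (mright r)) (mright j))))).

Lemma inc_correct r j f g i o B :
  j < r -> f j <= B ->
  tx (inc_prog r j) (tape_of r (mkStore f g i o)) 0
     (tape_of r (mkStore (set_ctr f j (S (f j))) g i o)) 0 (10 * (r + 1) * (B + 1)).
Proof.
  intros Hj HB. unfold inc_prog.
  set (s := mkStore f g i o). set (s' := mkStore (set_ctr f j (S (f j))) g i o).
  assert (Hs' : ctr s' j = S (f j)) by (simpl; unfold set_ctr; rewrite Nat.eqb_refl; auto).
  assert (Hrf : r * f j <= r * B) by (apply Nat.mul_le_mono_l; auto).
  assert (Hu : upd (tape_of r s) (- Z.of_nat (j + r * S (f j))) (Some true) = tape_of r s').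
  { eapply upd_left; [reflexivity|]. intros p.
    apply left_cell_set with (v := S (f j)); try lia.
    - intros y Hy Hn. destruct (Nat.leb_spec y (S (f j))), (Nat.leb_spec y (f j)); auto; lia.
    - rewrite Nat.leb_refl. reflexivity. }
  eapply tx_seq; [apply tx_mleft; reflexivity | eapply tx_seq;
    [eapply (tx_scan_left _ _ (f j) _ _ (- Z.of_nat (j + r * S (f j)))) | eapply tx_seq;
      [apply tx_write, Hu | eapply tx_seq; [apply tx_mright; reflexivity | eapply tx_seq;
         [eapply (tx_scan_right _ _ (f j) _ _ (- Z.of_nat j)) |
          apply tx_mright; lia | apply le_n] | apply le_n] | apply le_n] | apply le_n] | ].
  - lia.
  - intros x Hx. rewrite (tape_of_track r s _ j (S x)) by lia. simpl ctr.
    destruct (Nat.leb_spec (S x) (f j)); simpl; auto; lia.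
  - rewrite (tape_of_track r s _ j (S (f j))) by lia. simpl ctr.
    destruct (Nat.leb_spec (S (f j)) (f j)); simpl; auto; lia.
  - lia.
  - intros x Hx. rewrite (tape_of_track r s' _ j (f j - x)) by lia. rewrite Hs'.
    destruct (Nat.eqb_spec (f j - x) 0); [lia|].
    destruct (Nat.leb_spec (f j - x) (S (f j))); simpl; auto; lia.
  - rewrite (tape_of_track r s' _ j 0) by lia. reflexivity.
  - nia.
Qed.

(** After the last mark is erased the head stands on a blank, so one more stride is taken before the
    scan back. If the counter has become 0, that stride already reaches the foot. *)
Definition dec_prog (r j : nat) : tprog :=
  Seq (mleft (j + r)) (Seq (Whl is_true (mleft r)) (Seq (mright r) (Seq (write None)
    (Seq (mright r) (Seq (Whl is_true (mright r)) (mright j)))))).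

Lemma dec_correct r j f g i o B :
  j < r -> 0 < f j -> f j <= B ->
  tx (dec_prog r j) (tape_of r (mkStore f g i o)) 0
     (tape_of r (mkStore (set_ctr f j (f j - 1)) g i o)) 0 (10 * (r + 1) * (B + 1)).
Proof.
  intros Hj H0 HB. unfold dec_prog.
  set (s := mkStore f g i o). set (s' := mkStore (set_ctr f j (f j - 1)) g i o).
  assert (Hs' : ctr s' j = f j - 1) by (simpl; unfold set_ctr; rewrite Nat.eqb_refl; auto).
  assert (Hrf : r * f j <= r * B) by (apply Nat.mul_le_mono_l; auto).
  assert (Hu : upd (tape_of r s) (- Z.of_nat (j + r * f j)) None = tape_of r s').
  { eapply upd_left; [reflexivity|]. intros p.
    apply left_cell_set with (v := f j - 1); try lia.
    - intros y Hy Hn. destruct (Nat.leb_spec y (f j - 1)), (Nat.leb_spec y (f j)); auto; lia.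
    - destruct (Nat.leb_spec (f j) (f j - 1)); auto; lia. }
  eapply tx_seq; [apply tx_mleft; reflexivity | eapply tx_seq;
    [eapply (tx_scan_left _ _ (f j) _ _ (- Z.of_nat (j + r * S (f j)))) | eapply tx_seq;
      [apply (tx_mright _ _ _ (- Z.of_nat (j + r * f j))) | eapply tx_seq;
       [apply tx_write, Hu | eapply tx_seq; [apply tx_mright; reflexivity | eapply tx_seq;
         [eapply (tx_scan_right _ _ (f j - 1) _ _ (- Z.of_nat j)) |
          apply tx_mright; lia | apply le_n] | apply le_n] | apply le_n] | apply le_n]
     | apply le_n] | ].
  - lia.
  - intros x Hx. rewrite (tape_of_track r s _ j (S x)) by lia. simpl ctr.
    destruct (Nat.leb_spec (S x) (f j)); simpl; auto; lia.
  - rewrite (tape_of_track r s _ j (S (f j))) by lia. simpl ctr.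
    destruct (Nat.leb_spec (S (f j)) (f j)); simpl; auto; lia.
  - lia.
  - nia.
  - intros x Hx. rewrite (tape_of_track r s' _ j (f j - 1 - x)) by nia. rewrite Hs'.
    destruct (Nat.eqb_spec (f j - 1 - x) 0); [lia|].
    destruct (Nat.leb_spec (f j - 1 - x) (f j - 1)); simpl; auto; lia.
  - rewrite (tape_of_track r s' _ j 0) by lia. reflexivity.
  - nia.
Qed.

Definition goto_out : tprog :=
  Seq (mright 1) (Seq (Whl is_none (mright 1)) (Seq (Whl is_some (mright 1)) (mright 1))).

Lemma goto_out_correct r s B :
  bounded B s ->
  tx goto_out (tape_of r s) 0
     (tape_of r s) (Z.of_nat (S (S (gap s) + (length (inp s) + 2)))) (20 * (B + 1)).
Proof.
  intros [_ HB]. unfold goto_out.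
  eapply tx_seq; [apply tx_mright; reflexivity | eapply tx_seq;
    [apply (tx_scan_right _ _ (S (gap s)) _ _ (Z.of_nat (S (S (gap s) + 0))))
    | eapply tx_seq; [apply (tx_scan_right _ _ (S (length (inp s))) _ _
                        (Z.of_nat (S (S (gap s) + (length (inp s) + 1)))))
    | apply tx_mright; lia | apply le_n] | apply le_n] | ].
  - lia.
  - intros i Hi. rewrite (tape_of_right r s _ i), right_gap by lia. reflexivity.
  - rewrite (tape_of_right r s _ (S (gap s) + 0)) by lia.
    pose proof (right_inp s 0 ltac:(lia)) as H. destruct (nth _ _ _); [reflexivity|discriminate].
  - lia.
  - intros i Hi. rewrite (tape_of_right r s _ (S (gap s) + i)) by lia. apply right_inp; lia.
  - rewrite (tape_of_right r s _ (S (gap s) + (length (inp s) + 1))), right_sep by lia.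
    reflexivity.
  - lia.
Qed.

Definition emit_prog (b : bool) : tprog :=
  Seq goto_out (Seq (Whl is_some (mright 1)) (Seq (write (Some b))
    (Seq (Whl is_some (mleft 1)) (Seq (mleft 1)
      (Seq (Whl is_some (mleft 1)) (Whl is_none (mleft 1))))))).

Lemma nth_snoc {A} (l : list A) x d i :
  nth i (l ++ [x]) d = if i =? length l then x else nth i l d.
Proof.
  destruct (Nat.eqb_spec i (length l)) as [->|H].
  - rewrite app_nth2, Nat.sub_diag by lia. reflexivity.
  - destruct (Nat.lt_ge_cases i (length l)).
    + apply app_nth1; auto.
    + rewrite !nth_overflow; auto. rewrite length_app; simpl; lia.
Qed.

Lemma emit_correct r b f g i o B :
  0 < r -> bounded B (mkStore f g i o) ->
  tx (emit_prog b) (tape_of r (mkStore f g i o)) 0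
     (tape_of r (mkStore f g i (o ++ [b]))) 0 (50 * (B + 1)).
Proof.
  intros Hr HB. unfold emit_prog.
  set (s := mkStore f g i o). set (s' := mkStore f g i (o ++ [b])).
  pose proof HB as [_ HB']; simpl in HB'.
  set (e := S g + (length i + 2) + length o).
  assert (Hu : upd (tape_of r s) (Z.of_nat (S e)) (Some b) = tape_of r s').
  { eapply upd_right; [reflexivity|reflexivity|]. intros p.
    assert (E : right_cells s' = right_cells s ++ [Some b]).
    { unfold right_cells; simpl. rewrite map_app, <- !app_assoc. simpl. reflexivity. }
    rewrite E, nth_snoc. replace (length (right_cells s)) with e; [reflexivity|].
    unfold right_cells, e; simpl. rewrite !length_app, repeat_length, length_map. simpl.
    rewrite length_map. lia. }
  assert (Hout : forall x, x <= length o ->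
            is_some (tape_of r s' (Z.of_nat (S (S g + (length i + 2) + x)))) = true).
  { intros x Hx. rewrite (tape_of_right r s' _ (S g + (length i + 2) + x)) by lia.
    change (S g) with (S (gap s')). change i with (inp s'). rewrite right_out, is_some_map.
    simpl. rewrite length_app; simpl. apply Nat.ltb_lt; lia. }
  assert (Hsep : tape_of r s' (Z.of_nat (S (S g + (length i + 1)))) = None).
  { rewrite (tape_of_right r s' _ (S g + (length i + 1))) by lia.
    apply (right_sep s'). }
  eapply tx_seq; [apply (goto_out_correct r s B HB) | eapply tx_seq;
    [apply (tx_scan_right _ _ (length o) _ _ (Z.of_nat (S e))) | eapply tx_seq;
     [apply tx_write, Hu | eapply tx_seq;
      [apply (tx_scan_left _ _ (S (length o)) _ _ (Z.of_nat (S (S g + (length i + 1))))) |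
       eapply tx_seq; [apply tx_mleft; reflexivity | eapply tx_seq;
        [apply (tx_scan_left _ _ (S (length i)) _ _ (Z.of_nat (S g))) |
         apply (tx_scan_left _ _ (S g)) | apply le_n] | apply le_n] | apply le_n]
      | apply le_n] | apply le_n] | ].
  - unfold e; simpl gap; simpl inp; lia.
  - intros x Hx. change (gap s) with g; change (inp s) with i.
    rewrite (tape_of_right r s _ (S g + (length i + 2) + x)) by lia.
    change g with (gap s); change i with (inp s).
    rewrite right_out, is_some_map. apply Nat.ltb_lt; simpl; lia.
  - rewrite (tape_of_right r s _ (S g + (length i + 2) + length o)) by (unfold e; lia).
    change g with (gap s); change i with (inp s).
    rewrite right_out, nth_overflow by (rewrite length_map; simpl; lia). reflexivity.
  - unfold e; lia.
  - intros x Hx. rewrite <- (Hout (length o - x)) by lia. do 2 f_equal. unfold e; lia.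
  - rewrite Hsep. reflexivity.
  - lia.
  - intros x Hx. rewrite (tape_of_right r s' _ (S (gap s') + (length i - x)))
      by (change (gap s') with g; lia).
    apply right_inp; simpl; lia.
  - rewrite (tape_of_right r s' _ g), right_gap by (change (gap s') with g; lia). reflexivity.
  - lia.
  - intros x Hx. rewrite (tape_of_right r s' _ (g - x)), right_gap by (change (gap s') with g; lia).
    reflexivity.
  - rewrite (tape_of_left r s' _ 0) by lia. unfold left_cell.
    destruct (Nat.ltb_spec 0 r); [reflexivity|lia].
  - lia.
Qed.

(** The first digit of track [j] is marked iff the counter is positive, so it serves as the loop
    condition; the body runs from base cell to base cell. *)
Definition while_loop (r j : nat) (p : tprog) : tprog :=
  Whl is_true (Seq (mright (j + r)) (Seq p (mleft (j + r)))).

Definition find : tprog := Seq (mright 1) (Seq (Whl is_none (mright 1)) (mright 1)).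

Definition erase : tprog := Seq (write None) (Whl is_none (mleft 1)).

(* The test is made one cell to the right of the next input cell: that cell is blank iff the
   scan of [find] stopped at the end marker. *)
Definition read_loop (p0 p1 : tprog) : tprog :=
  Whl is_some
    (Seq (mleft 1) (Seq (Ifs is_true (Seq erase p1) (Seq erase p0)) find)).

(** When a read loop stops, the head is one cell beyond the end marker; [mleft 2] passes over the
    marker to the blanks in front of it, which lead back to the base. *)
Fixpoint ccode (r : nat) (c : cmd) : tprog :=
  match c with
  | CSkip => mleft 0
  | CInc j => inc_prog r j
  | CDec j => dec_prog r j
  | CEmit b => emit_prog b
  | CSeq c1 c2 => Seq (ccode r c1) (ccode r c2)
  | CWhile j c =>
      Seq (mleft (j + r)) (Seq (while_loop r j (ccode r c)) (mright (j + r)))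
  | CRead c0 c1 =>
      Seq find (Seq (read_loop (ccode r c0) (ccode r c1))
                    (Seq (mleft 2) (Whl is_none (mleft 1))))
  end.

Fixpoint regs_below (r : nat) (c : cmd) : Prop :=
  match c with
  | CInc j | CDec j => j < r
  | CSeq c1 c2 | CRead c1 c2 => regs_below r c1 /\ regs_below r c2
  | CWhile j c => j < r /\ regs_below r c
  | _ => True
  end.

Lemma tx_if (P : option bool -> bool) p q (T : tape) z T' z' k :
  tx (if P (T z) then p else q) T z T' z' k -> tx (Ifs P p q) T z T' z' (S k).
Proof. intros (n & Hn & H). exists (S n); split; [lia|]. constructor; auto. Qed.

Lemma find_correct r s B :
  bounded B s ->
  tx find (tape_of r s) 0 (tape_of r s) (Z.of_nat (S (S (S (gap s))))) (20 * (B + 1)).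
Proof.
  intros [_ HB]. unfold find.
  eapply tx_seq; [apply tx_mright; reflexivity | eapply tx_seq;
    [apply (tx_scan_right _ _ (S (gap s)) _ _ (Z.of_nat (S (S (gap s) + 0))))
    | apply tx_mright; lia | apply le_n] | ].
  - lia.
  - intros i Hi. rewrite (tape_of_right r s _ i), right_gap by lia. reflexivity.
  - rewrite (tape_of_right r s _ (S (gap s) + 0)) by lia.
    pose proof (right_inp s 0 ltac:(lia)) as H. destruct (nth _ _ _); [reflexivity|discriminate].
  - lia.
Qed.

Lemma back_correct r s z i :
  0 < r -> i <= S (gap s) -> (z = Z.of_nat i)%Z ->
  tx (Whl is_none (mleft 1)) (tape_of r s) z (tape_of r s) 0 (i * 3 + 1).
Proof.
  intros Hr Hi ->. apply tx_scan_left; [lia| |].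
  - intros x Hx. rewrite (tape_of_right r s _ (i - x - 1)), right_gap by lia. reflexivity.
  - rewrite (tape_of_left r s _ 0) by lia. unfold left_cell.
    destruct (Nat.ltb_spec 0 r); [reflexivity|lia].
Qed.

Lemma erase_correct r f g b i o :
  0 < r ->
  tx erase (tape_of r (mkStore f g (b :: i) o)) (Z.of_nat (S (S g)))
     (tape_of r (mkStore f (S g) i o)) 0 (3 * g + 8).
Proof.
  intros Hr. unfold erase. eapply tx_seq; [apply tx_write| |].
  - apply (upd_right r _ (mkStore f (S g) i o) (S g)); [lia|reflexivity|].
    intros x. destruct (Nat.eqb_spec x (S g)) as [->|Hx].
    + apply right_gap; simpl; lia.
    + destruct (Nat.le_gt_cases x g) as [Hg|Hg].
      * rewrite !right_gap; simpl; auto; lia.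
      * replace x with (S (S g) + (x - S (S g))) at 1 by lia.
        rewrite (right_after (mkStore f (S g) i o)).
        replace x with (S g + S (x - S (S g))) at 2 by lia.
        rewrite (right_after (mkStore f g (b :: i) o)). reflexivity.
  - apply (back_correct r (mkStore f (S g) i o) _ (S (S g))); simpl gap; auto; lia.
  - lia.
Qed.

(** Tape steps granted to one counter step when all sizes are less than [U]; the factor 100 covers
    the constants of all commands. *)
Definition rate (r U : nat) : nat := 100 * ((r + 1) * U).

(* Running times of the loops are stated from the position where the loop tests its condition;
   half of the budget of one operation is kept for entering and leaving that position. *)
Definition spec (r : nat) (c : cmd) (s s' : store) (k U : nat) : Prop :=
  match c with
  | CWhile j c0 =>
      exists N, 2 * N + rate r U <= 2 * (k * rate r U) /\
      tx (while_loop r j (ccode r c0)) (tape_of r s) (- Z.of_nat (j + r))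
         (tape_of r s') (- Z.of_nat (j + r)) N
  | CRead c0 c1 =>
      exists N, 2 * N + rate r U <= 2 * (k * rate r U) /\
      tx (read_loop (ccode r c0) (ccode r c1))
         (tape_of r s) (Z.of_nat (S (S (S (gap s)))))
         (tape_of r s') (Z.of_nat (S (S (S (gap s'))))) N
  | _ => tx (ccode r c) (tape_of r s) 0 (tape_of r s') 0 (k * rate r U)
  end.

(** The reserved half of the budget pays for the way to the loop test and back. *)
Lemma spec_full r c s s' k B :
  0 < r -> regs_below r c -> bounded B s -> bounded (B + k) s' ->
  spec r c s s' k (B + k + 1) ->
  tx (ccode r c) (tape_of r s) 0 (tape_of r s') 0 (k * rate r (B + k + 1)).
Proof.
  intros Hr Hc HB HB' Hs. destruct c; simpl in Hs; auto.
  - destruct Hs as (N & HN & Hx), Hc as [Hc _].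
    eapply tx_seq; [apply tx_mleft; reflexivity|
      eapply tx_seq; [exact Hx|apply tx_mright; lia|apply le_n]|].
    set (M := k * rate r (B + k + 1)) in *. unfold rate in HN. nia.
  - destruct Hs as (N & HN & Hx), HB' as [_ HB'].
    eapply tx_seq; [apply (find_correct r s B HB)|
      eapply tx_seq; [exact Hx|
       eapply tx_seq; [apply tx_mleft; reflexivity|
         apply (back_correct r s' _ (S (gap s'))); lia|apply le_n]|apply le_n]|].
    set (M := k * rate r (B + k + 1)) in *. unfold rate in HN. nia.
Qed.

Lemma rate_mono r U V : U <= V -> rate r U <= rate r V.
Proof. intros. unfold rate. nia. Qed.

Lemma mul_rate_mono r k U V : U <= V -> k * rate r U <= k * rate r V.
Proof. intros. apply Nat.mul_le_mono_l, rate_mono; auto. Qed.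

(** The loop rules of [cexec] have the rest of the loop as a premise, and that rest starts at the
    loop test rather than at the base; this dictates the form of [spec]. Each step enlarges a store
    by at most one, so [B + k] bounds every size. *)
Lemma spec_correct r c s s' k :
  0 < r -> cexec c s s' k -> regs_below r c ->
  forall B, bounded B s -> bounded (B + k) s' /\ spec r c s s' k (B + k + 1).
Proof.
  intros Hr He. induction He as
    [s | j f g i o | j f g i o H | b f g i o | c1 c2 s s1 s2 k1 k2 He1 IH1 He2 IH2
    | j c s H | j c s s1 s2 k1 k2 H He1 IH1 He2 IH2
    | c0 c1 f g o | c0 c1 f g b i o s1 s2 k1 k2 He1 IH1 He2 IH2]; intros Hreg B HB.
  - split; [destruct HB as [H1 H2]; split; [intros j; specialize (H1 j); lia|lia]|].
    simpl. eapply tx_weaken; [apply tx_mleft; lia|]. unfold rate; nia.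
  - split.
    + destruct HB as [H1 H2]; simpl in *. split; simpl; [|lia].
      intros x. unfold set_ctr. destruct (x =? j).
      * specialize (H1 j); lia.
      * specialize (H1 x); lia.
    + eapply tx_weaken; [apply (inc_correct r j f g i o B); auto; apply HB|].
      unfold rate; nia.
  - split.
    + destruct HB as [H1 H2]; simpl in *. split; simpl; [|lia].
      intros x. unfold set_ctr. destruct (x =? j).
      * specialize (H1 j); lia.
      * specialize (H1 x); lia.
    + eapply tx_weaken; [apply (dec_correct r j f g i o B); auto; apply HB|].
      unfold rate; nia.
  - split.
    + destruct HB as [H1 H2]; simpl in *. split; simpl; [intros x; specialize (H1 x); lia|].
      rewrite length_app; simpl; lia.
    + eapply tx_weaken; [apply (emit_correct r b f g i o B); auto|].
      unfold rate; nia.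
  - destruct Hreg as [Hr1 Hr2].
    destruct (IH1 Hr1 B HB) as [HB1 S1]. destruct (IH2 Hr2 _ HB1) as [HB2 S2].
    rewrite <- Nat.add_assoc in HB2. split; [auto|].
    apply spec_full in S1; auto. apply spec_full in S2; auto; [|rewrite <- Nat.add_assoc; auto].
    simpl. eapply tx_seq; [exact S1|exact S2|].
    pose proof (mul_rate_mono r k1 (B + k1 + 1) (B + (k1 + k2) + 1) ltac:(lia)).
    pose proof (mul_rate_mono r k2 (B + k1 + k2 + 1) (B + (k1 + k2) + 1) ltac:(lia)). lia.
  - split; [destruct HB as [H1 H2]; split; [intros x; specialize (H1 x); lia|lia]|].
    exists 1. split; [unfold rate; nia|].
    apply tx_while_stop. destruct Hreg as [Hj _].
    rewrite (tape_of_track r s _ j 1), H by lia. reflexivity.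
  - pose proof Hreg as [Hj Hr1].
    destruct (IH1 Hr1 B HB) as [HB1 S1]. destruct (IH2 Hreg _ HB1) as [HB2 S2].
    apply spec_full in S1; auto.
    split.
    { destruct HB2 as [H1 H2]. split; [intros x; specialize (H1 x); lia|lia]. }
    destruct S2 as (N & HN & S2).
    exists (S ((S (j + r) + (k1 * rate r (B + k1 + 1) + S (j + r))) + N)). split.
    + pose proof (mul_rate_mono r k1 (B + k1 + 1) (B + (1 + k1 + k2) + 1) ltac:(lia)).
      pose proof (mul_rate_mono r k2 (B + k1 + k2 + 1) (B + (1 + k1 + k2) + 1) ltac:(lia)).
      replace ((1 + k1 + k2) * rate r (B + (1 + k1 + k2) + 1)) with
        (rate r (B + (1 + k1 + k2) + 1) + k1 * rate r (B + (1 + k1 + k2) + 1)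
         + k2 * rate r (B + (1 + k1 + k2) + 1)) by ring.
      (* The induction hypothesis reserves its half for a size bound smaller by one; the difference
         [100 * (r + 1)] is charged to the unit that this round adds. *)
      assert (rate r (B + (1 + k1 + k2) + 1) = rate r (B + k1 + k2 + 1) + 100 * (r + 1))
        by (unfold rate; ring).
      assert (100 * (r + 1) <= rate r (B + k1 + k2 + 1)) by (unfold rate; nia). lia.
    + eapply tx_while_loop; [| |exact S2].
      * rewrite (tape_of_track r s _ j 1) by lia. simpl.
        destruct (ctr s j); [lia|reflexivity].
      * eapply tx_seq; [apply tx_mright|eapply tx_seq;
          [exact S1|apply tx_mleft; lia|apply le_n]|lia]; lia.
  - split; [destruct HB as [H1 H2]; split; [intros x; specialize (H1 x); lia|lia]|].
    exists 1. split; [unfold rate; nia|].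
    apply tx_while_stop. rewrite (tape_of_right r _ _ (S g + 1)) by (cbn [gap]; lia).
    rewrite (right_after (mkStore f g [] o)). reflexivity.
  - pose proof Hreg as [Hr0 Hr1].
    assert (Hrb : regs_below r (if b then c1 else c0)) by (destruct b; auto).
    pose proof HB as [Hc Hl]; simpl in Hl.
    assert (HB0 : bounded B (mkStore f (S g) i o)) by (split; [apply Hc|simpl; lia]).
    destruct (IH1 Hrb B HB0) as [HB1 S1]. destruct (IH2 Hreg _ HB1) as [HB2 S2].
    apply spec_full in S1; auto.
    split.
    { destruct HB2 as [H1 H2]. split; [intros x; specialize (H1 x); lia|lia]. }
    destruct S2 as (N & HN & S2).
    exists (S ((2 + (S ((3 * g + 8) + k1 * rate r (B + k1 + 1)) + 20 * (B + k1 + 1))) + N)).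
    split.
    + pose proof (mul_rate_mono r k1 (B + k1 + 1) (B + (1 + k1 + k2) + 1) ltac:(lia)).
      pose proof (mul_rate_mono r k2 (B + k1 + k2 + 1) (B + (1 + k1 + k2) + 1) ltac:(lia)).
      replace ((1 + k1 + k2) * rate r (B + (1 + k1 + k2) + 1)) with
        (rate r (B + (1 + k1 + k2) + 1) + k1 * rate r (B + (1 + k1 + k2) + 1)
         + k2 * rate r (B + (1 + k1 + k2) + 1)) by ring.
      assert (rate r (B + (1 + k1 + k2) + 1) = rate r (B + k1 + k2 + 1) + 100 * (r + 1))
        by (unfold rate; ring).
      assert (100 * (r + 1) + 100 * (B + k1) <= rate r (B + k1 + k2 + 1))
        by (unfold rate; nia). lia.
    + set (s := mkStore f g (b :: i) o).
      eapply tx_while_loop; [| |exact S2].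
      * rewrite (tape_of_right r _ _ (S g + 1)) by (change (gap s) with g; lia).
        apply (right_inp s); simpl; lia.
      * eapply tx_seq; [apply (tx_mleft _ _ _ (Z.of_nat (S (S g)))); change (gap s) with g; lia
          |eapply tx_seq; [apply (tx_if _ _ _ _ _ _ _ (3 * g + 8 + k1 * rate r (B + k1 + 1)))
             |apply (find_correct r s1 (B + k1) HB1)|apply le_n]|lia].
        replace (tape_of r s (Z.of_nat (S (S g)))) with (Some b).
        -- destruct b; (eapply tx_seq; [apply erase_correct; auto|exact S1|lia]).
        -- rewrite (tape_of_right r _ _ (S g + 0)) by (change (gap s) with g; lia).
           rewrite (right_after s). reflexivity.
Qed.

Lemma ccode_correct r c s s' k B :
  0 < r -> cexec c s s' k -> regs_below r c -> bounded B s ->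
  bounded (B + k) s' /\
  tx (ccode r c) (tape_of r s) 0 (tape_of r s') 0 (k * rate r (B + k + 1)).
Proof.
  intros Hr He Hreg HB. destruct (spec_correct r c s s' k Hr He Hreg B HB) as [HB' Hs].
  split; auto. apply spec_full with (B := B); auto.
Qed.

(** * Preparing the tape *)

Fixpoint base_prog (m : nat) : tprog :=
  match m with
  | 0 => mleft 0
  | S m => Seq (write (Some false)) (Seq (mleft 1) (base_prog m))
  end.

Lemma base_correct m T z :
  tx (base_prog m) T z
     (fun y => if ((z - Z.of_nat m <? y) && (y <=? z))%Z then Some false else T y)
     (z - Z.of_nat m) (3 * m + 1).
Proof.
  revert T z; induction m; intros T z.
  - match goal with |- tx _ _ _ ?F _ _ => replace F with T end;
      [apply tx_mleft; reflexivity|].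
    apply functional_extensionality; intros y.
    destruct (Z.ltb_spec (z - Z.of_nat 0) y), (Z.leb_spec y z); simpl; auto; lia.
  - eapply tx_seq; [apply tx_write; reflexivity|
      eapply tx_seq; [apply tx_mleft; reflexivity| |apply le_n]|].
    + match goal with |- tx _ _ _ ?F _ _ => replace F with
        (fun y => if ((z - Z.of_nat 1 - Z.of_nat m <? y) && (y <=? z - Z.of_nat 1))%Z
                  then Some false else upd T z (Some false) y) end.
      * pose proof (IHm (upd T z (Some false)) (z - Z.of_nat 1)%Z) as H.
        replace (z - Z.of_nat (S m))%Z with (z - Z.of_nat 1 - Z.of_nat m)%Z by lia.
        exact H.
      * apply functional_extensionality; intros y. unfold upd.
        destruct (Z.ltb_spec (z - Z.of_nat 1 - Z.of_nat m) y),
          (Z.leb_spec y (z - Z.of_nat 1)), (Z.ltb_spec (z - Z.of_nat (S m)) y),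
          (Z.leb_spec y z), (Z.eqb_spec y z); simpl; auto; lia.
    + lia.
Qed.

(** Only the end marker and the foot cells of the [r] tracks have to be written; the gap cell, the
    separator and the empty output are blank already. *)
Definition setup (r : nat) : tprog :=
  Seq (Whl is_some (mright 1)) (Seq (write (Some true)) (Seq (Whl is_some (mleft 1))
    (Seq (mleft 1) (Seq (base_prog r) (mright r))))).

Definition start_store (w : list bool) : store := mkStore (fun _ => 0) 0 w [].

Lemma setup_correct r w :
  0 < r ->
  tx (setup r) (input_tape w) 2 (tape_of r (start_store w)) 0
     (20 * ((r + 1) * (length w + 1))).
Proof.
  intros Hr. unfold setup. set (n := length w).
  assert (Hin : forall i, input_tape w (2 + Z.of_nat i)%Z = nth i (map Some w) None).
  { intros i. unfold input_tape. destruct (Z.leb_spec (2 + Z.of_nat i) 1); [lia|].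
    f_equal; lia. }
  eapply tx_seq; [apply (tx_scan_right _ _ n _ _ (2 + Z.of_nat n)) |
    eapply tx_seq; [apply tx_write; reflexivity|
    eapply tx_seq; [apply (tx_scan_left _ _ (S n) _ _ 1)|
    eapply tx_seq; [apply (tx_mleft _ _ _ 0); lia|
    eapply tx_seq; [apply base_correct|
    | apply le_n]| apply le_n]| apply le_n]| apply le_n]|].
  - lia.
  - intros i Hi. replace (2 + Z.of_nat 1 * Z.of_nat i)%Z with (2 + Z.of_nat i)%Z by lia.
    rewrite Hin, is_some_map. apply Nat.ltb_lt; auto.
  - rewrite Hin, nth_overflow by (rewrite length_map; auto). reflexivity.
  - lia.
  - intros i Hi. unfold upd. destruct (Z.eqb_spec (2 + Z.of_nat n - Z.of_nat 1 * Z.of_nat i)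
      (2 + Z.of_nat n)); auto.
    replace (2 + Z.of_nat n - Z.of_nat 1 * Z.of_nat i)%Z with (2 + Z.of_nat (n - i))%Z by lia.
    rewrite Hin, is_some_map. apply Nat.ltb_lt; fold n; lia.
  - unfold upd. destruct (Z.eqb_spec 1 (2 + Z.of_nat n)); [lia|reflexivity].
  - match goal with |- tx _ ?F _ _ _ _ => replace F with (tape_of r (start_store w)) end.
    + apply tx_mright. lia.
    + apply functional_extensionality; intros y. unfold tape_of, upd.
      destruct (Z.leb_spec y 0) as [Hy|Hy].
      * unfold left_cell; cbn [ctr start_store].
        destruct (Nat.ltb_spec (Z.to_nat (- y)) r).
        -- destruct (Z.ltb_spec (0 - Z.of_nat r) y); [reflexivity|lia].
        -- destruct (Z.ltb_spec (0 - Z.of_nat r) y); [lia|]. cbn [andb].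
           assert (Z.to_nat (- y) / r <> 0).
           { intros E. apply Nat.div_small_iff in E; lia. }
           destruct (Z.to_nat (- y) / r); [lia|]. cbn [Nat.leb].
           destruct (Z.eqb_spec y (2 + Z.of_nat n)); [lia|].
           unfold input_tape. destruct (Z.leb_spec y 1); [reflexivity|lia].
      * destruct (Z.leb_spec y 0); [lia|]. rewrite andb_false_r.
        destruct (Z.eq_dec y 1) as [->|Hy1].
        -- destruct (Z.eqb_spec 1 (2 + Z.of_nat n)); [lia|reflexivity].
        -- replace (Z.to_nat (y - 1)) with (S (gap (start_store w)) + Z.to_nat (y - 2))
             by (change (gap (start_store w)) with 0; lia).
           rewrite right_after. simpl inp; simpl out.
           destruct (Z.eqb_spec y (2 + Z.of_nat n)).
           ++ rewrite app_nth2 by (rewrite length_map; fold n; lia). rewrite length_map.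
              fold n. replace (Z.to_nat (y - 2) - n) with 0 by lia. reflexivity.
           ++ unfold input_tape. destruct (Z.leb_spec y 1); [lia|].
              destruct (Nat.lt_ge_cases (Z.to_nat (y - 2)) n).
              ** rewrite app_nth1 by (rewrite length_map; auto). reflexivity.
              ** rewrite nth_overflow with (l := map Some w) by (rewrite length_map; auto).
                 rewrite app_nth2 by (rewrite length_map; auto). rewrite length_map. fold n.
                 destruct (Z.to_nat (y - 2) - n) as [|[|[|]]] eqn:E; auto; exfalso; lia.
  - nia.
Qed.

Theorem cmd_machine r c w s' k :
  0 < r -> regs_below r c -> cexec c (start_store w) s' k ->
  let M := machine (Seq (setup r) (Seq (ccode r c) goto_out)) in
  exists n, n <= (k + 1) * rate r (length w + k + 1) /\
    halting M (cstate (run M n w)) = true /\ output (run M n w) = out s'.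
Proof.
  intros Hr Hreg He M.
  assert (HB : bounded (length w) (start_store w)) by (split; simpl; lia).
  destruct (ccode_correct r c _ s' k _ Hr He Hreg HB) as [HB' Hx].
  destruct (tx_seq _ _ _ _ _ _ _ _ _ _ _ (setup_correct r w Hr)
              (tx_seq _ _ _ _ _ _ _ _ _ _ _ Hx (goto_out_correct r s' _ HB') (le_n _))
              (le_n _)) as (n & Hn & E).
  exists n. split.
  - eapply Nat.le_trans; [exact Hn|]. unfold rate; nia.
  - apply (machine_computes _ _ _ _ _ _ E). intros i.
    rewrite (tape_of_right r s' _ (S (gap s') + (length (inp s') + 2) + i)) by lia.
    apply right_out.
Qed.

(** * Loop programs that print bit strings *)

(* Variables are numbered by nesting depth, so that the loop body or the scope of a [GLet] at
   depth [d] reads the new value as variable [d]. [GLet g1 g2] binds the number of bits that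
   [g1] prints. *)
Inductive gen : Type :=
| GPrint : list bool -> gen
| GSeq : gen -> gen -> gen
| GFor : nat -> gen -> gen
| GLet : gen -> gen -> gen.

(** The variable that a [GLet] binds has value 0 while [g1] runs: its register is reserved, but
    filled only when the count is complete. *)
Fixpoint gout (g : gen) (env : list nat) : list bool :=
  match g with
  | GPrint l => l
  | GSeq g1 g2 => gout g1 env ++ gout g2 env
  | GFor x g => flat_map (fun i => gout g (env ++ [i])) (seq 0 (nth x env 0))
  | GLet g1 g2 => gout g2 (env ++ [length (gout g1 (env ++ [0]))])
  end.

Fixpoint ops (g : gen) (env : list nat) : nat :=
  match g with
  | GPrint l => length l + 1
  | GSeq g1 g2 => ops g1 env + ops g2 env
  | GFor x g => 20 * (nth x env 0 + 1)
                + list_sum (map (fun i => ops g (env ++ [i])) (seq 0 (nth x env 0)))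
  | GLet g1 g2 => ops g1 (env ++ [0]) + 20 * (length (gout g1 (env ++ [0])) + 1)
                  + ops g2 (env ++ [length (gout g1 (env ++ [0]))])
  end.

(** With a target register the same program counts its bits instead of printing them. This is how
    [GLet] does arithmetic. *)
Definition emit (tgt : option nat) (b : bool) : cmd :=
  match tgt with None => CEmit b | Some x => CInc x end.

Fixpoint emits (tgt : option nat) (l : list bool) : cmd :=
  match l with
  | [] => CSkip
  | b :: l => CSeq (emit tgt b) (emits tgt l)
  end.

Definition transfer (x y : nat) : cmd := CWhile x (CSeq (CDec x) (CInc y)).
Definition clear (x : nat) : cmd := CWhile x (CDec x).
(** Counters can only be read destructively: [x] is drained into [y] and into the scratch register
    0, and restored from there. *)
Definition copy (x y : nat) : cmd :=
  CSeq (CWhile x (CSeq (CDec x) (CSeq (CInc y) (CInc 0)))) (transfer 0 x).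

(* Variable [x] lives in register [2x+1]; register [2d+2] holds the remaining number of
   iterations of the loop at depth [d], or the bits counted by the [GLet] at depth [d]. *)
Definition var (x : nat) : nat := 2 * x + 1.
Definition rem (d : nat) : nat := 2 * d + 2.

Fixpoint comp (tgt : option nat) (d : nat) (g : gen) : cmd :=
  match g with
  | GPrint l => emits tgt l
  | GSeq g1 g2 => CSeq (comp tgt d g1) (comp tgt d g2)
  | GFor x g =>
      CSeq (copy (var x) (rem d))
        (CSeq (CWhile (rem d) (CSeq (CDec (rem d)) (CSeq (comp tgt (S d) g) (CInc (var d)))))
              (clear (var d)))
  | GLet g1 g2 =>
      CSeq (comp (Some (rem d)) (S d) g1)
        (CSeq (transfer (rem d) (var d)) (CSeq (comp tgt (S d) g2) (clear (var d))))
  end.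

Definition setc (s : store) (j v : nat) : store :=
  mkStore (set_ctr (ctr s) j v) (gap s) (inp s) (out s).

Definition effect (tgt : option nat) (l : list bool) (s : store) : store :=
  match tgt with
  | None => mkStore (ctr s) (gap s) (inp s) (out s ++ l)
  | Some x => setc s x (ctr s x + length l)
  end.

Lemma store_ext s s' :
  (forall j, ctr s j = ctr s' j) -> gap s = gap s' -> inp s = inp s' -> out s = out s' ->
  s = s'.
Proof.
  destruct s, s'; simpl; intros H -> -> ->. f_equal.
  apply functional_extensionality; auto.
Qed.

Ltac regs :=
  unfold effect, setc, set_ctr, var, rem in *; cbn [ctr gap inp out] in *;
  repeat match goal with
         | |- context [?a =? ?b] => destruct (Nat.eqb_spec a b); try (exfalso; lia)
         end.

Ltac store_eq :=
  apply store_ext; [intros ?; regs; subst; try lia | reflexivity | reflexivity | ].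

Lemma cexec_to c s s1 s2 k : cexec c s s1 k -> s1 = s2 -> cexec c s s2 k.
Proof. intros H <-. exact H. Qed.

Lemma exec_inc j s : cexec (CInc j) s (setc s j (S (ctr s j))) 1.
Proof. destruct s; constructor. Qed.

Lemma exec_dec j s : 0 < ctr s j -> cexec (CDec j) s (setc s j (ctr s j - 1)) 1.
Proof. destruct s; simpl. intros. constructor; auto. Qed.

Lemma exec_transfer x y n s :
  x <> y -> ctr s x = n ->
  cexec (transfer x y) s (setc (setc s y (ctr s y + n)) x 0) (3 * n + 1).
Proof.
  intros Hxy. revert s; induction n; intros s Hs.
  - replace (setc _ x 0) with s by (store_eq; reflexivity). apply E_while_stop; auto.
  - replace (3 * S n + 1) with (1 + (1 + 1) + (3 * n + 1)) by lia.
    eapply E_while_loop; [lia|eapply E_seq; [apply exec_dec; lia|apply exec_inc]|].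
    match goal with |- cexec _ ?s1 ?s2 _ =>
      replace s2 with (setc (setc s1 y (ctr s1 y + n)) x 0) end.
    + apply IHn. regs; lia.
    + store_eq. reflexivity.
Qed.

Lemma exec_clear x n s : ctr s x = n -> cexec (clear x) s (setc s x 0) (2 * n + 1).
Proof.
  revert s; induction n; intros s Hs.
  - replace (setc _ x 0) with s by (store_eq; reflexivity). apply E_while_stop; auto.
  - replace (2 * S n + 1) with (1 + 1 + (2 * n + 1)) by lia.
    eapply E_while_loop; [lia|apply exec_dec; lia|].
    match goal with |- cexec _ ?s1 ?s2 _ => replace s2 with (setc s1 x 0) end.
    + apply IHn. regs; lia.
    + store_eq. reflexivity.
Qed.

Lemma exec_copy x y n s :
  x <> y -> x <> 0 -> y <> 0 -> ctr s 0 = 0 -> ctr s x = n ->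
  cexec (copy x y) s (setc s y (ctr s y + n)) (7 * n + 2).
Proof.
  intros Hxy Hx Hy H0 Hn.
  assert (H : forall m s, ctr s x = m ->
            cexec (CWhile x (CSeq (CDec x) (CSeq (CInc y) (CInc 0)))) s
              (setc (setc (setc s y (ctr s y + m)) 0 (ctr s 0 + m)) x 0) (4 * m + 1)).
  { clear s H0 Hn. induction m; intros s Hs.
    - match goal with |- cexec _ _ ?s2 _ => replace s2 with s end.
      + apply E_while_stop; auto.
      + store_eq. reflexivity.
    - replace (4 * S m + 1) with (1 + (1 + (1 + 1)) + (4 * m + 1)) by lia.
      eapply E_while_loop; [lia|
        eapply E_seq; [apply exec_dec; lia|eapply E_seq; apply exec_inc]|].
      match goal with |- cexec _ ?s1 ?s2 _ =>
        replace s2 with (setc (setc (setc s1 y (ctr s1 y + m)) 0 (ctr s1 0 + m)) x 0) end.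
      + apply IHm. regs; lia.
      + store_eq. reflexivity. }
  replace (7 * n + 2) with (4 * n + 1 + (3 * n + 1)) by lia.
  eapply E_seq; [apply (H n); auto|].
  eapply cexec_to.
  - apply (exec_transfer 0 x n); [auto|]. regs; lia.
  - store_eq. reflexivity.
Qed.

(** A counting target belongs to an enclosing [GLet], so it is none of the registers used at depth
    [d] or deeper. *)
Definition tgt_ok (tgt : option nat) (d : nat) : Prop :=
  match tgt with None => True | Some x => exists e, e < d /\ x = rem e end.

Lemma exec_emits tgt l s : cexec (emits tgt l) s (effect tgt l s) (length l + 1).
Proof.
  revert s; induction l as [|b l IH]; intros s; simpl.
  - replace (effect tgt [] s) with s; [constructor|].
    destruct tgt; [store_eq; simpl; try lia|destruct s; simpl; rewrite app_nil_r]; reflexivity.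
  - replace (S (length l + 1)) with (1 + (length l + 1)) by lia.
    replace (effect tgt (b :: l) s) with (effect tgt l (effect tgt [b] s)).
    + eapply E_seq; [|apply IH]. destruct tgt; simpl.
      * replace (ctr s n + 1) with (S (ctr s n)) by lia. apply exec_inc.
      * destruct s; constructor.
    + destruct tgt; [store_eq; simpl; try lia; reflexivity|].
      destruct s; simpl. rewrite <- app_assoc. reflexivity.
Qed.

(** The registers of depth [d] and beyond are zero on entry and again on exit, so each construct
    finds its counters cleared. The values of [rem e] for smaller depths are left open, since
    enclosing constructs are using them. *)
Definition env_inv (d : nat) (env : list nat) (s : store) : Prop :=
  length env = d /\ ctr s 0 = 0 /\ (forall x, x < d -> ctr s (var x) = nth x env 0) /\
  (forall y, 2 * d + 1 <= y -> ctr s y = 0).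

Lemma effect_app tgt l l' s : effect tgt l' (effect tgt l s) = effect tgt (l ++ l') s.
Proof.
  destruct tgt; [store_eq; [rewrite length_app; lia|reflexivity]|].
  simpl. rewrite app_assoc. reflexivity.
Qed.

Lemma effect_inv d env tgt l s :
  tgt_ok tgt d -> env_inv d env s -> env_inv d env (effect tgt l s).
Proof.
  intros Ht (Hd & H0 & Hv & Hz). split; [auto|].
  destruct tgt as [x|]; [|auto]. destruct Ht as (e & He & ->).
  repeat split; [|intros y Hy|intros y Hy].
  - regs; auto.
  - specialize (Hv y Hy). regs; auto.
  - specialize (Hz y Hy). regs; auto.
Qed.

Lemma env_inv_snoc d env s v r :
  env_inv d env s -> env_inv (S d) (env ++ [v]) (setc (setc s (var d) v) (rem d) r).
Proof.
  intros (Hd & H0 & Hv & Hz). repeat split; [| |intros x Hx|intros y Hy].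
  - rewrite length_app; simpl; lia.
  - regs; auto.
  - destruct (Nat.eq_dec x d) as [->|Hn].
    + rewrite app_nth2 by lia. rewrite Hd, Nat.sub_diag. regs; auto.
    + rewrite app_nth1 by lia. specialize (Hv x ltac:(lia)). regs; auto.
  - specialize (Hz y ltac:(lia)). regs; auto.
Qed.

Lemma effect_setc d tgt l s j v :
  tgt_ok tgt d -> 2 * d + 1 <= j ->
  effect tgt l (setc s j v) = setc (effect tgt l s) j v.
Proof.
  intros Ht Hj. destruct tgt as [x|]; [|reflexivity]. destruct Ht as (e & He & ->).
  store_eq. reflexivity.
Qed.

Lemma exec_comp g : forall d env tgt s,
  env_inv d env s -> tgt_ok tgt d ->
  exists k, k <= ops g env /\ cexec (comp tgt d g) s (effect tgt (gout g env) s) k.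
Proof.
  induction g as [l | g1 IH1 g2 IH2 | x g IH | g1 IH1 g2 IH2]; intros d env tgt s Hs Ht.
  - exists (length l + 1). split; [auto|]. apply exec_emits.
  - destruct (IH1 d env tgt s Hs Ht) as (k1 & Hk1 & E1).
    destruct (IH2 d env tgt _ (effect_inv _ _ _ (gout g1 env) _ Ht Hs) Ht) as (k2 & Hk2 & E2).
    exists (k1 + k2). split; [simpl; lia|]. simpl. rewrite <- effect_app.
    econstructor; eauto.
  - simpl. set (v := nth x env 0).
    (* At the loop test the loop variable is [i] and [n] rounds remain; [s] stands for the rest of
       the store, with the output so far. *)
    assert (Hloop : forall n i s, env_inv d env s -> exists k,
      k <= 1 + 3 * n + list_sum (map (fun i => ops g (env ++ [i])) (seq i n)) /\
      cexec (CWhile (rem d) (CSeq (CDec (rem d)) (CSeq (comp tgt (S d) g) (CInc (var d)))))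
        (setc (setc s (var d) i) (rem d) n)
        (setc (setc (effect tgt (flat_map (fun i => gout g (env ++ [i])) (seq i n)) s)
                (var d) (i + n)) (rem d) 0) k).
    { clear s Hs. induction n; intros i s Hs.
      - exists 1. split; [lia|]. simpl flat_map. replace (effect tgt [] s) with s.
        + rewrite Nat.add_0_r. apply E_while_stop. regs; auto.
        + destruct tgt; [store_eq; simpl; try lia; reflexivity|].
          destruct s; simpl. rewrite app_nil_r. reflexivity.
      - assert (Ht' : tgt_ok tgt (S d)).
        { destruct tgt; auto. destruct Ht as (e & He & ->). exists e; split; auto. }
        destruct (IH (S d) (env ++ [i]) tgt _ (env_inv_snoc d env s i n Hs) Ht')
          as (k1 & Hk1 & E1).
        destruct (IHn (S i) (effect tgt (gout g (env ++ [i])) s)) as (k2 & Hk2 & E2).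
        { apply effect_inv; auto. }
        exists (1 + (1 + (k1 + 1)) + k2). split.
        { simpl. lia. }
        eapply E_while_loop; [regs; lia| |].
        + eapply E_seq; [apply exec_dec; regs; lia|].
          match goal with |- cexec _ ?s1 _ _ =>
            replace s1 with (setc (setc s (var d) i) (rem d) n) by (store_eq; reflexivity) end.
          eapply E_seq; [exact E1|apply exec_inc].
        + simpl flat_map. rewrite <- effect_app.
          replace (i + S n) with (S i + n) by lia.
          match goal with |- cexec _ ?s1 _ _ => replace s1 with
            (setc (setc (effect tgt (gout g (env ++ [i])) s) (var d) (S i)) (rem d) n) end.
          * exact E2.
          * rewrite (effect_setc d), (effect_setc d) by (auto; unfold var, rem; lia).
            store_eq. reflexivity. }
    pose proof Hs as (Hd & H0 & Hv & Hz).
    assert (Hx : ctr s (var x) = v).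
    { unfold v. destruct (Nat.lt_ge_cases x d); [auto|].
      rewrite nth_overflow by lia. apply Hz. unfold var; lia. }
    destruct (Hloop v 0 s Hs) as (k & Hk & E).
    exists (7 * v + 2 + (k + (2 * v + 1))). split; [unfold v in *; lia|].
    eapply E_seq; [apply (exec_copy _ _ v); unfold var, rem; auto; lia|].
    assert (Hr0 : ctr s (rem d) = 0) by (apply Hz; unfold rem; lia).
    assert (Hv0 : ctr s (var d) = 0) by (apply Hz; unfold var; lia).
    rewrite Hr0.
    match goal with |- cexec _ ?s1 _ _ =>
      replace s1 with (setc (setc s (var d) 0) (rem d) v) end.
    2:{ store_eq; auto. }
    eapply E_seq; [exact E|].
    eapply cexec_to.
    + apply (exec_clear _ v). regs; auto.
    + destruct (effect_inv d env tgt (flat_map (fun i => gout g (env ++ [i])) (seq 0 v)) s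
                 Ht Hs) as (_ & _ & _ & Hz').
      match goal with |- context [effect tgt ?l s] => set (s' := effect tgt l s) in * end.
      apply store_ext; [intros j|reflexivity..].
      specialize (Hz' j). clearbody s'. regs; subst; auto; try (symmetry; auto); apply Hz'; lia.
  - simpl. set (n := length (gout g1 (env ++ [0]))).
    pose proof Hs as (Hd & H0 & Hv & Hz).
    assert (Hr0 : ctr s (rem d) = 0) by (apply Hz; unfold rem; lia).
    assert (Hv0 : ctr s (var d) = 0) by (apply Hz; unfold var; lia).
    assert (Hs0 : setc (setc s (var d) 0) (rem d) 0 = s) by (store_eq; auto).
    pose proof (env_inv_snoc d env s 0 0 Hs) as Hs1. rewrite Hs0 in Hs1.
    destruct (IH1 (S d) (env ++ [0]) (Some (rem d)) s Hs1) as (k1 & Hk1 & E1).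
    { exists d. auto. }
    assert (Ht' : tgt_ok tgt (S d)).
    { destruct tgt; auto. destruct Ht as (e & He & ->). exists e; split; auto. }
    destruct (IH2 (S d) (env ++ [n]) tgt _ (env_inv_snoc d env s n 0 Hs) Ht')
      as (k2 & Hk2 & E2).
    exists (k1 + (3 * n + 1 + (k2 + (2 * n + 1)))). split; [lia|].
    eapply E_seq; [exact E1|]. simpl effect. fold n. rewrite Hr0.
    eapply E_seq; [apply (exec_transfer _ _ n); regs; lia|].
    match goal with |- cexec _ ?s1 _ _ =>
      replace s1 with (setc (setc s (var d) n) (rem d) 0) end.
    2:{ store_eq; auto. }
    eapply E_seq; [exact E2|].
    rewrite (effect_setc d), (effect_setc d) by (auto; unfold var, rem; lia).
    eapply cexec_to.
    + apply (exec_clear _ n). regs; auto.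
    + destruct (effect_inv d env tgt (gout g2 (env ++ [n])) s Ht Hs) as (_ & _ & _ & Hz').
      match goal with |- context [effect tgt ?l s] => set (s' := effect tgt l s) in * end.
      apply store_ext; [intros j|reflexivity..].
      specialize (Hz' j). clearbody s'. regs; subst; auto; try (symmetry; auto); apply Hz'; lia.
Qed.

(** * Printing while the input is read *)

Fixpoint input_out (g0 g1 : gen) (i : nat) (w : list bool) : list bool :=
  match w with
  | [] => []
  | b :: w => gout (if b then g1 else g0) [i] ++ input_out g0 g1 (S i) w
  end.

Fixpoint input_ops (g0 g1 : gen) (i : nat) (w : list bool) : nat :=
  match w with
  | [] => 1
  | b :: w => 2 + ops (if b then g1 else g0) [i] + input_ops g0 g1 (S i) w
  end.

(** Variable 0 is the index of the current bit while the input is read, and therefore the input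
    length afterwards. *)
Definition print_prog (g0 g1 g : gen) : cmd :=
  CSeq (CRead (CSeq (comp None 1 g0) (CInc (var 0))) (CSeq (comp None 1 g1) (CInc (var 0))))
       (comp None 1 g).

Lemma exec_read g0 g1 w : forall i s,
  inp s = w -> env_inv 1 [i] s ->
  exists k s', k <= input_ops g0 g1 i w /\
    cexec (CRead (CSeq (comp None 1 g0) (CInc (var 0))) (CSeq (comp None 1 g1) (CInc (var 0))))
      s s' k /\
    env_inv 1 [i + length w] s' /\ out s' = out s ++ input_out g0 g1 i w.
Proof.
  induction w as [|b w IH]; intros i s Hw Hs.
  - exists 1, s. rewrite Nat.add_0_r. simpl input_out. rewrite app_nil_r.
    split; [auto|]. split; [|auto]. destruct s; simpl in *; subst. constructor.
  - destruct s as [f g i' o]; simpl in Hw; subst i'.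
    assert (Hs1 : env_inv 1 [i] (mkStore f (S g) w o)) by exact Hs.
    destruct (exec_comp (if b then g1 else g0) 1 [i] None _ Hs1 I) as (k1 & Hk1 & E1).
    set (s1 := effect None (gout (if b then g1 else g0) [i]) (mkStore f (S g) w o)) in *.
    set (s2 := setc s1 (var 0) (S (ctr s1 (var 0)))).
    assert (Hs2 : env_inv 1 [S i] s2).
    { destruct Hs as (_ & H0 & Hv & Hz). specialize (Hv 0 ltac:(lia)). simpl in Hv.
      repeat split; [|intros [|x] Hx|intros y Hy].
      - unfold s2, s1. regs; auto.
      - unfold s2, s1. regs; simpl in *. f_equal. exact Hv.
      - lia.
      - specialize (Hz y Hy). unfold s2, s1. regs; auto. }
    destruct (IH (S i) s2 eq_refl Hs2) as (k2 & s' & Hk2 & E2 & Hinv & Hout).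
    exists (1 + (k1 + 1) + k2), s'. split; [simpl; lia|]. split; [|split].
    + eapply E_read_loop; [|exact E2].
      destruct b; (eapply E_seq; [exact E1|apply exec_inc]).
    + replace (i + length (b :: w)) with (S i + length w) by (simpl; lia). exact Hinv.
    + rewrite Hout. simpl. rewrite <- app_assoc. reflexivity.
Qed.

Lemma exec_print g0 g1 g w :
  exists k s', k <= input_ops g0 g1 0 w + ops g [length w] /\
    cexec (print_prog g0 g1 g) (start_store w) s' k /\
    out s' = input_out g0 g1 0 w ++ gout g [length w].
Proof.
  assert (Hs : env_inv 1 [0] (start_store w)).
  { repeat split. intros [|x] Hx; [reflexivity|lia]. }
  destruct (exec_read g0 g1 w 0 (start_store w) eq_refl Hs) as (k1 & s1 & Hk1 & E1 & Hs1 & Ho1).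
  destruct (exec_comp g 1 _ None s1 Hs1 I) as (k2 & Hk2 & E2).
  exists (k1 + k2), (effect None (gout g [length w]) s1). split; [|split].
  - simpl in Hk2. lia.
  - eapply E_seq; eauto.
  - simpl. rewrite Ho1. reflexivity.
Qed.

Lemma regs_below_mono c r r' : regs_below r c -> r <= r' -> regs_below r' c.
Proof.
  induction c; simpl; intros; auto; try lia; intuition auto; lia.
Qed.

Lemma regs_below_exists c : exists r, 0 < r /\ regs_below r c.
Proof.
  induction c as [ | j | j | b | c1 (r1 & H1 & R1) c2 (r2 & H2 & R2) | j c (r & H & R)
                 | c1 (r1 & H1 & R1) c2 (r2 & H2 & R2)].
  - exists 1; simpl; auto.
  - exists (S j); simpl; lia.
  - exists (S j); simpl; lia.
  - exists 1; simpl; auto.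
  - exists (r1 + r2). repeat split; [lia| |]; eapply regs_below_mono; eauto; lia.
  - exists (r + S j). repeat split; [lia|lia|]. eapply regs_below_mono; eauto; lia.
  - exists (r1 + r2). repeat split; [lia| |]; eapply regs_below_mono; eauto; lia.
Qed.

(** * Polynomial bounds *)

Lemma pow_le_mono m e e' : e <= e' -> (m + 2) ^ e <= (m + 2) ^ e'.
Proof. intros. apply Nat.pow_le_mono_r; lia. Qed.

Lemma pow_pos m e : 1 <= (m + 2) ^ e.
Proof. pose proof (Nat.pow_nonzero (m + 2) e). lia. Qed.

Lemma pow_bound_const m c : c <= (m + 2) ^ c.
Proof. pose proof (Nat.pow_gt_lin_r (m + 2) c). lia. Qed.

(** Bounds are kept as pure powers of [m + 2]: a base of at least 2 absorbs constants and sums into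
    the exponent, so no coefficients have to be carried. *)
Lemma pow_bound_add m a b e1 e2 :
  a <= (m + 2) ^ e1 -> b <= (m + 2) ^ e2 -> a + b <= (m + 2) ^ (e1 + e2 + 1).
Proof.
  intros Ha Hb. pose proof (pow_le_mono m e1 (e1 + e2) ltac:(lia)).
  pose proof (pow_le_mono m e2 (e1 + e2) ltac:(lia)).
  rewrite Nat.pow_add_r, Nat.pow_1_r. nia.
Qed.

Lemma pow_bound_mul m a b e1 e2 :
  a <= (m + 2) ^ e1 -> b <= (m + 2) ^ e2 -> a * b <= (m + 2) ^ (e1 + e2).
Proof. intros. rewrite Nat.pow_add_r. apply Nat.mul_le_mono; auto. Qed.

Lemma pow_bound_comp m e1 e2 :
  ((m + 2) ^ (e1 + 1) + 2) ^ e2 <= (m + 2) ^ ((e1 + 2) * e2).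
Proof.
  rewrite Nat.pow_mul_r. apply Nat.pow_le_mono_l.
  rewrite !Nat.pow_add_r, Nat.pow_1_r. simpl (_ ^ 2). pose proof (pow_pos m e1). nia.
Qed.

Lemma list_sum_bound (f : nat -> nat) K n a :
  (forall i, a <= i < a + n -> f i <= K) -> list_sum (map f (seq a n)) <= n * K.
Proof.
  revert a; induction n; intros a H; simpl; [lia|].
  specialize (IHn (S a)). pose proof (H a ltac:(lia)).
  assert (list_sum (map f (seq (S a) n)) <= n * K) by (apply IHn; intros; apply H; lia). lia.
Qed.

Lemma length_flat_map_sum {A} (f : nat -> list A) l :
  length (flat_map f l) = list_sum (map (fun i => length (f i)) l).
Proof. induction l; simpl; rewrite ?length_app; auto. Qed.

Lemma nth_snoc_bound env v m :
  (forall x, nth x env 0 <= m) -> v <= m -> forall x, nth x (env ++ [v]) 0 <= m.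
Proof.
  intros H Hv x. rewrite nth_snoc. destruct (x =? length env); auto.
Qed.

(** The output length is bounded together with the time because a [GLet] turns it into the value of
    a variable; the bound for [g2] is then composed with that for [g1]. *)
Lemma gen_bound g : exists e, forall env m, (forall x, nth x env 0 <= m) ->
  ops g env + length (gout g env) <= (m + 2) ^ e.
Proof.
  induction g as [l | g1 (e1 & H1) g2 (e2 & H2) | x g (e & H) | g1 (e1 & H1) g2 (e2 & H2)].
  - exists (2 * length l + 1). intros env m _. simpl.
    replace (length l + 1 + length l) with (2 * length l + 1) by lia. apply pow_bound_const.
  - exists (e1 + e2 + 1). intros env m Hm. simpl. rewrite length_app.
    pose proof (pow_bound_add m _ _ _ _ (H1 env m Hm) (H2 env m Hm)). lia.
  - exists ((20 + 1) + (1 + e + 1) + 1). intros env m Hm. simpl ops; simpl gout.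
    set (v := nth x env 0). assert (Hv : v <= m) by apply Hm.
    rewrite length_flat_map_sum.
    assert (Hb : forall i, i < v ->
      ops g (env ++ [i]) + length (gout g (env ++ [i])) <= (m + 2) ^ e).
    { intros i Hi. apply H, nth_snoc_bound; auto; lia. }
    assert (list_sum (map (fun i => ops g (env ++ [i])) (seq 0 v)) <= v * (m + 2) ^ e).
    { apply list_sum_bound. intros i Hi. specialize (Hb i). lia. }
    assert (list_sum (map (fun i => length (gout g (env ++ [i]))) (seq 0 v))
            <= v * (m + 2) ^ e).
    { apply list_sum_bound. intros i Hi. specialize (Hb i). lia. }
    assert (A1 : 20 * (v + 1) <= (m + 2) ^ (20 + 1)).
    { apply pow_bound_mul; [apply pow_bound_const|]. rewrite Nat.pow_1_r. lia. }
    assert (A2 : 2 * v * (m + 2) ^ e <= (m + 2) ^ (1 + e + 1)).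
    { replace (1 + e + 1) with (1 + 1 + e) by lia.
      apply pow_bound_mul; auto. apply (pow_bound_mul m 2 v 1 1); rewrite Nat.pow_1_r; lia. }
    pose proof (pow_bound_add m _ _ _ _ A1 A2). lia.
  - exists ((20 + (e1 + 0 + 1)) + (e1 + 2) * e2 + 1). intros env m Hm. simpl ops; simpl gout.
    assert (Hm0 : forall x, nth x (env ++ [0]) 0 <= m) by (apply nth_snoc_bound; auto; lia).
    specialize (H1 _ m Hm0). set (n := length (gout g1 (env ++ [0]))) in *.
    assert (Hm1 : forall x, nth x (env ++ [n]) 0 <= (m + 2) ^ (e1 + 1)).
    { apply nth_snoc_bound.
      - intros x. specialize (Hm x). rewrite Nat.pow_add_r, Nat.pow_1_r.
        pose proof (pow_pos m e1). nia.
      - pose proof (pow_le_mono m e1 (e1 + 1) ltac:(lia)). lia. }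
    pose proof (H2 _ _ Hm1) as A2. pose proof (pow_bound_comp m e1 e2).
    assert (A1 : 20 * (ops g1 (env ++ [0]) + n + 1) <= (m + 2) ^ (20 + (e1 + 0 + 1))).
    { apply pow_bound_mul; [apply pow_bound_const|].
      apply pow_bound_add; [lia|]. simpl; lia. }
    assert (A3 := pow_bound_add m _ _ _ _ A1 (Nat.le_trans _ _ _ A2 H)). lia.
Qed.

Lemma input_ops_bound g0 g1 : exists e, forall w i m,
  i + length w <= m -> input_ops g0 g1 i w <= (length w + 1) * (m + 2) ^ e.
Proof.
  destruct (gen_bound g0) as (e0 & H0), (gen_bound g1) as (e1 & H1).
  exists (e0 + e1 + 1 + 2 + 1). induction w as [|b w IH]; intros i m Hm.
  - simpl. pose proof (pow_pos m (e0 + e1 + 1 + 2 + 1)). lia.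
  - simpl input_ops. simpl in Hm.
    assert (Hi : forall x, nth x [i] 0 <= m) by (intros [|[|x]]; simpl; lia).
    specialize (H0 _ _ Hi). specialize (H1 _ _ Hi). specialize (IH (S i) m ltac:(lia)).
    pose proof (pow_bound_add m _ _ _ _ (pow_bound_add m _ _ _ _ H0 H1) (pow_bound_const m 2)).
    simpl length. replace (S (length w) + 1) with (1 + (length w + 1)) by lia.
    rewrite Nat.mul_add_distr_r, Nat.mul_1_l. destruct b; lia.
Qed.

(** For positive [m] one has [m + 2 <= 3 * m]; the additive constant of [poly] covers [m = 0]. *)
Lemma pow_bound_poly m e : (m + 2) ^ e <= poly (3 ^ e) e m.
Proof.
  unfold poly. destruct m as [|m].
  - pose proof (Nat.pow_le_mono_l 2 3 e). simpl ((0 + 2) ^ e). lia.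
  - rewrite <- Nat.pow_mul_l. pose proof (Nat.pow_le_mono_l (S m + 2) (3 * S m) e). lia.
Qed.

Theorem gen_poly_time g0 g1 g :
  poly_time_computable (fun w => input_out g0 g1 0 w ++ gout g [length w]).
Proof.
  destruct (regs_below_exists (print_prog g0 g1 g)) as (r & Hr & Hreg).
  destruct (input_ops_bound g0 g1) as (e1 & H1), (gen_bound g) as (e2 & H2).
  (* Exponents: [ek] for the number [k] of counter steps, [ek1] for [k + 1], and [e] for
     [(k + 1) * rate r (m + k + 1)]. *)
  set (ek := 1 + e1 + e2 + 1). set (ek1 := ek + 1 + 1).
  set (e := ek1 + (100 * (r + 1) + (ek1 + 1 + 1))).
  exists (machine (Seq (setup r) (Seq (ccode r (print_prog g0 g1 g)) goto_out))), (3 ^ e), e.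
  split; [apply machine_wf|]. intros w. set (m := length w).
  destruct (exec_print g0 g1 g w) as (k & s' & Hk & E & Ho).
  destruct (cmd_machine r _ w s' k Hr Hreg E) as (n & Hn & Hh & Hout).
  exists n. fold m in Ho. split; [|rewrite <- Ho; auto].
  eapply Nat.le_trans; [exact Hn|]. eapply Nat.le_trans; [|apply pow_bound_poly]. fold m.
  specialize (H1 w 0 m ltac:(fold m; lia)). fold m in H1.
  assert (Hm : forall x, nth x [m] 0 <= m) by (intros [|[|x]]; simpl; lia).
  specialize (H2 _ _ Hm).
  assert (A1 : (m + 1) * (m + 2) ^ e1 <= (m + 2) ^ (1 + e1)).
  { apply pow_bound_mul; auto. rewrite Nat.pow_1_r; lia. }
  pose proof (pow_bound_add m _ _ _ _ A1 H2) as A2. fold ek in A2.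
  fold m in Hk.
  assert (A3 : k <= (m + 2) ^ ek) by lia.
  pose proof (pow_bound_add m _ _ _ _ A3 (pow_bound_const m 1)) as A4. fold ek1 in A4.
  unfold e, rate. apply pow_bound_mul; auto. rewrite Nat.mul_assoc.
  apply pow_bound_mul; [apply pow_bound_const|].
  replace (m + k + 1) with (k + 1 + m) by lia. apply pow_bound_add; auto.
  rewrite Nat.pow_1_r; lia.
Qed.

(** * Derivations in IL *)

Definition imps (l : list form) (A : form) : form := fold_right Imp A l.

(** Necessitation is confined to theorems of IL, which is what makes the deduction theorem hold. *)
Inductive Dv (G : form -> Prop) : form -> Prop :=
| Dv_hyp A : G A -> Dv G A
| Dv_thm A : ILthm A -> Dv G A
| Dv_mp A B : Dv G (Imp A B) -> Dv G A -> Dv G B.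

Lemma IL_weaken A B : ILthm (Imp A (Imp B A)).
Proof.
  apply IL_taut. intros v; simpl. destruct (peval v A), (peval v B); reflexivity.
Qed.

Lemma IL_dist A B C : ILthm (Imp (Imp A (Imp B C)) (Imp (Imp A B) (Imp A C))).
Proof.
  apply IL_taut. intros v; simpl.
  destruct (peval v A), (peval v B), (peval v C); reflexivity.
Qed.

Lemma Dv_deduction (G : form -> Prop) A B :
  Dv (fun X => X = A \/ G X) B -> Dv G (Imp A B).
Proof.
  induction 1 as [X [->|H] | X H | X Y _ IH1 _ IH2].
  - apply Dv_thm, IL_taut. intros v; simpl. destruct (peval v A); reflexivity.
  - eapply Dv_mp; [apply Dv_thm, IL_weaken | apply Dv_hyp; auto].
  - eapply Dv_mp; apply Dv_thm; [apply IL_weaken | auto].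
  - eapply Dv_mp; [eapply Dv_mp; [apply Dv_thm, IL_dist | exact IH1] | exact IH2].
Qed.

Lemma Dv_cut (G D : form -> Prop) A :
  (forall X, G X -> Dv D X) -> Dv G A -> Dv D A.
Proof.
  intros H. induction 1; [auto | apply Dv_thm; auto | eapply Dv_mp; eauto].
Qed.

Lemma Dv_imps (G : form -> Prop) l A :
  Dv (fun X => In X l \/ G X) A -> Dv G (imps l A).
Proof.
  revert G; induction l as [|B l IH]; intros G H; simpl.
  - eapply Dv_cut; [|exact H]. intros X [[]|HX]. apply Dv_hyp; auto.
  - apply Dv_deduction, IH. eapply Dv_cut; [|exact H]. intros X HX. apply Dv_hyp.
    simpl in HX. intuition auto.
Qed.

Lemma Dv_imps_mp (G : form -> Prop) l A :
  Dv G (imps l A) -> (forall X, In X l -> Dv G X) -> Dv G A.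
Proof.
  induction l as [|B l IH]; simpl; intros H Hl; auto.
  apply IH; [eapply Dv_mp; eauto | auto].
Qed.

Lemma Dv_theorem A : Dv (fun _ => False) A -> ILthm A.
Proof. induction 1; [contradiction | auto | eapply IL_MP; eauto]. Qed.

Lemma IL_imps l A : Dv (fun X => In X l) A -> ILthm (imps l A).
Proof.
  intros H. apply Dv_theorem, Dv_imps. eapply Dv_cut; [|exact H].
  intros X HX. apply Dv_hyp; auto.
Qed.

(** Transports a derivation to the successors described by [l]: if every hypothesis is known to hold
    there, so does every consequence, by K. *)
Lemma Dv_box (G D : form -> Prop) l A :
  (forall X, G X -> Dv D (Box (imps l X))) -> Dv G A -> Dv D (Box (imps l A)).
Proof.
  intros H. induction 1 as [X HX | X HX | X Y _ IH1 _ IH2]; auto.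
  - apply Dv_thm, IL_Nec, IL_imps, Dv_thm, HX.
  - assert (HK : ILthm (Box (Imp (imps l (Imp X Y)) (Imp (imps l X) (imps l Y))))).
    { apply IL_Nec, Dv_theorem, Dv_deduction, Dv_deduction, Dv_imps.
      apply (Dv_mp _ X); apply (Dv_imps_mp _ l); solve [apply Dv_hyp; auto
        | intros Z HZ; apply Dv_hyp; auto]. }
    eapply Dv_mp; [eapply Dv_mp; [apply Dv_thm, IL_K|]|exact IH2].
    eapply Dv_mp; [eapply Dv_mp; [apply Dv_thm, IL_K|]|exact IH1].
    apply Dv_thm, HK.
Qed.

(* Löb's axiom applied to A /\ Box A. *)
Lemma IL_4 A : ILthm (Imp (Box A) (Box (Box A))).
Proof.
  set (B := And A (Box A)).
  assert (HA : ILthm (Box (Imp B A))).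
  { apply IL_Nec, IL_taut. intros v; simpl.
    destruct (peval v A), (v (Box A)); reflexivity. }
  assert (HB : ILthm (Box (Imp B (Box A)))).
  { apply IL_Nec, IL_taut. intros v; simpl.
    destruct (peval v A), (v (Box A)); reflexivity. }
  assert (H1 : ILthm (Imp (Box B) (Box A))) by (eapply IL_MP; [apply IL_K|exact HA]).
  assert (H2 : ILthm (Imp (Box B) (Box (Box A)))) by (eapply IL_MP; [apply IL_K|exact HB]).
  assert (H3 : ILthm (Box (Imp A (Imp (Box B) B)))).
  { apply IL_Nec. eapply IL_MP; [|exact H1]. apply IL_taut. intros v; simpl.
    destruct (peval v A), (v (Box A)), (v (Box B)); reflexivity. }
  assert (H4 : ILthm (Imp (Box A) (Box (Imp (Box B) B))))
    by (eapply IL_MP; [apply IL_K|exact H3]).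
  apply Dv_theorem, Dv_deduction.
  eapply Dv_mp; [apply Dv_thm, H2|]. eapply Dv_mp; [apply Dv_thm, IL_L|].
  eapply Dv_mp; [apply Dv_thm, H4|]. apply Dv_hyp; auto.
Qed.

(** * Veltman semantics *)

(** Variables get one fixed valuation, false everywhere: the formulas to be refuted are closed. *)
Fixpoint forces {W : Type} (R : W -> W -> Prop) (S : W -> W -> W -> Prop)
  (w : W) (A : form) : Prop :=
  match A with
  | Var _ => False
  | Bot => False
  | Imp B C => forces R S w B -> forces R S w C
  | Box B => forall u, R w u -> forces R S u B
  | Rhd B C => forall u, R w u -> forces R S u B -> exists v, S w u v /\ forces R S v C
  end.

Record veltman {W : Type} (R : W -> W -> Prop) (S : W -> W -> W -> Prop) : Prop := {
  R_trans : forall w u v, R w u -> R u v -> R w v;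
  R_wf : well_founded (fun u v => R v u);
  S_dom : forall w u v, S w u v -> R w v;
  S_refl : forall w u, R w u -> S w u u;
  S_trans : forall w u v x, S w u v -> S w v x -> S w u x;
  S_R : forall w u v, R w u -> R u v -> S w u v
}.

Lemma forces_imps {W} (R : W -> W -> Prop) S w l A :
  forces R S w (imps l A) <-> ((forall X, In X l -> forces R S w X) -> forces R S w A).
Proof.
  induction l as [|B l IH]; simpl.
  - split; [auto|]. intros H. apply H. intros X [].
  - rewrite IH. split.
    + intros H Hl. apply H; auto.
    + intros H HB Hl. apply H. intros X [->|HX]; auto.
Qed.

(** J1, J2, J4 and J5 rest on [S_refl], [S_trans], [S_dom] and [S_R] respectively, and Löb's axiom
    on induction along the converse of [R]. For tautologies, forcing at [w] is made a boolean
    valuation by classical choice. *)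
Theorem soundness {W} (R : W -> W -> Prop) S A :
  veltman R S -> ILthm A -> forall w, forces R S w A.
Proof.
  intros HV. induction 1 as [A H | A B | A | A B | A B C | A B C | A B | A | A B _ IH1 _ IH2
                            | A _ IH]; intros w; simpl.
  - set (v := fun X => if excluded_middle_informative (forces R S w X) then true else false).
    assert (Hv : forall X, peval v X = true <-> forces R S w X).
    { assert (H0 : forall X, v X = true <-> forces R S w X).
      { intros X. unfold v. destruct (excluded_middle_informative (forces R S w X));
          split; auto; discriminate. }
      induction X as [n| |X IHX Y IHY|X IHX|X IHX Y IHY]; try apply H0.
      - simpl. split; [discriminate|contradiction].
      - simpl. rewrite <- IHX, <- IHY. destruct (peval v X), (peval v Y); simpl;
          intuition auto. }
    apply Hv, H.
  - intros HI HA u Hu. apply HI; auto.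
  - intros H u Hu. revert Hu. induction u as [u IH] using (well_founded_ind (R_wf _ _ HV)).
    intros Hu. apply H; auto. intros x Hx. apply IH; auto. eapply R_trans; eauto.
  - intros H u Hu HA. exists u. split; [apply (S_refl _ _ HV); auto|apply H; auto].
  - intros H u Hu HA. apply NNPP. intros Hn. apply H. intros H1 H2. apply Hn.
    destruct (H1 u Hu HA) as (x & Hx & HB).
    destruct (H2 x (S_dom _ _ HV _ _ _ Hx) HB) as (y & Hy & HC).
    exists y. split; auto. eapply S_trans; eauto.
  - intros H u Hu HA. apply NNPP. intros Hn. apply H. intros H1 H2. apply Hn.
    destruct (classic (forces R S u A)) as [Ha|Ha]; [apply H1; auto|].
    apply H2; auto.
  - intros H HA HB. apply HA. intros u Hu Ha. destruct (H u Hu Ha) as (x & Hx & Hb).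
    eapply HB; [eapply S_dom; eauto|auto].
  - intros u Hu H. apply NNPP. intros Hn. apply H. intros x Hx Ha. apply Hn.
    exists x. split; auto. apply (S_R _ _ HV); auto.
  - apply IH1, IH2.
  - intros u Hu. apply IH.
Qed.

(** * Closed formulas playing the role of variables *)

Definition boxes (r : nat) : form := Nat.iter r Box Bot.

(** True exactly where the longest chain of successors has length [r], that is, at rank [r]. *)
Definition level (r : nat) : list form := [boxes (S r); Neg (boxes r)].

Definition pvar (l : nat) : form := Rhd (Neg (boxes l)) (Neg (boxes (S l))).

(** * One machine step as Horn clauses *)

(* The tape is stored relative to the head, as the two stacks of a configuration: the facts
   about position [i] say which symbols are the [i]-th ones of the two stacks (the right one
   starting with the scanned cell); the state is a fact about position 0. *)
Inductive fact : Type :=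
| FQ : nat -> fact
| FL : option bool -> fact
| FR : option bool -> fact.

Definition holds (a : config) (i : nat) (b : fact) : Prop :=
  match b with
  | FQ q => i = 0 /\ cstate a = q
  | FL s => nth i (cleft a) None = s
  | FR s => nth i (chead a :: cright a) None = s
  end.

Definition symbols : list (option bool) := [None; Some false; Some true].

Definition facts (M : TM) : list fact :=
  map FQ (seq 0 (nstates M)) ++ map FL symbols ++ map FR symbols.

Lemma in_symbols s : In s symbols.
Proof. destruct s as [[]|]; simpl; auto. Qed.

Lemma in_facts_Q M q : q < nstates M -> In (FQ q) (facts M).
Proof. intros H. apply in_or_app; left. apply in_map, in_seq. lia. Qed.

Lemma in_facts_L M s : In (FL s) (facts M).
Proof. apply in_or_app; right. apply in_or_app; left. apply in_map, in_symbols. Qed.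

Lemma in_facts_R M s : In (FR s) (facts M).
Proof. apply in_or_app; right. apply in_or_app; right. apply in_map, in_symbols. Qed.

Lemma holds_in_facts M a i b : cstate a < nstates M -> holds a i b -> In b (facts M).
Proof.
  destruct b; simpl; intros Ha H.
  - destruct H as [_ <-]. apply in_facts_Q; auto.
  - apply in_facts_L.
  - apply in_facts_R.
Qed.

(* [AtZero], [AtLoop], [AtEnd] are relative to position 0, to the running position of the
   clause schema and to the bound on the length of the two stacks. The boolean selects the
   configuration after the step. *)
Inductive anchor := AtZero | AtLoop | AtEnd.

Definition atom : Type := anchor * nat * bool * fact.
Definition clause : Type := list atom * atom.

Definition position (P i : nat) (x : anchor) (d : nat) : nat :=
  match x with AtZero => d | AtLoop => i + d | AtEnd => P + d end.

Definition halt_or_delta (M : TM) (q : nat) (s : option bool) : nat * option bool * move :=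
  if halting M q then (q, s, MStay) else delta M q s.

(** A move pushes onto one stack and pops from the other. Premises [FR] at offset 1 from [AtLoop]
    skip the scanned cell, whose new content [s'] is given by a clause of its own. *)
Definition state_clauses (M : TM) (q : nat) (s : option bool) : list clause :=
  let '(q', s', m) := halt_or_delta M q s in
  let g := [(AtZero, 0, false, FQ q); (AtZero, 0, false, FR s)] in
  (g, (AtZero, 0, true, FQ q')) ::
  match m with
  | MStay =>
      (g, (AtZero, 0, true, FR s')) ::
      flat_map (fun x =>
        [((AtLoop, 1, false, FR x) :: g, (AtLoop, 1, true, FR x));
         ((AtLoop, 0, false, FL x) :: g, (AtLoop, 0, true, FL x))]) symbols
  | MRight =>
      (g, (AtZero, 0, true, FL s')) ::
      flat_map (fun x =>
        [((AtLoop, 1, false, FR x) :: g, (AtLoop, 0, true, FR x));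
         ((AtLoop, 0, false, FL x) :: g, (AtLoop, 1, true, FL x))]) symbols
  | MLeft =>
      (g, (AtZero, 1, true, FR s')) ::
      flat_map (fun x =>
        [((AtZero, 0, false, FL x) :: g, (AtZero, 0, true, FR x));
         ((AtLoop, 1, false, FR x) :: g, (AtLoop, 2, true, FR x));
         ((AtLoop, 1, false, FL x) :: g, (AtLoop, 0, true, FL x))]) symbols
  end.

(** A pop moves the symbol at position [P] to [P - 1], while configurations are described only below
    [P]. The two clauses without premises supply the blank that stands there, as both stacks have
    length at most [P]. *)
Definition clauses (M : TM) : list clause :=
  ([], (AtEnd, 0, false, FL None)) :: ([], (AtEnd, 0, false, FR None)) ::
  flat_map (fun q => flat_map (state_clauses M q) symbols) (seq 0 (nstates M)).

Definition atom_true (D : bool -> nat -> fact -> Prop) (P i : nat) (a : atom) : Prop :=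
  let '(x, d, r, b) := a in D r (position P i x d) b.

Definition clause_true (D : bool -> nat -> fact -> Prop) (P i : nat) (c : clause) : Prop :=
  (forall a, In a (fst c) -> atom_true D P i a) -> atom_true D P i (snd c).

Lemma step_halt_or_delta M a q s m :
  halt_or_delta M (cstate a) (chead a) = (q, s, m) ->
  let l := cleft a in let r := cright a in
  step M a = match m with
             | MStay => mkConfig q l s r
             | MLeft => mkConfig q (tl l) (nth 0 l None) (s :: r)
             | MRight => mkConfig q (s :: l) (nth 0 r None) (tl r)
             end.
Proof.
  unfold halt_or_delta, step. destruct a as [q0 l h r]; simpl.
  destruct (halting M q0).
  - intros [= <- <- <-]. reflexivity.
  - destruct (delta M q0 h) as [[q' s'] m']. intros [= <- <- <-].
    destruct m'; [destruct l|destruct r|]; reflexivity.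
Qed.

Lemma nth_tl {A} (l : list A) i d : nth i (tl l) d = nth (S i) l d.
Proof. destruct l; [destruct i|]; reflexivity. Qed.

Lemma clauses_sound M a P i c :
  length (cleft a) <= P -> length (cright a) < P -> In c (clauses M) ->
  clause_true (fun r => holds (if r then step M a else a)) P i c.
Proof.
  intros HL HR [<-|[<-|Hc]].
  - intros _. simpl. apply nth_overflow; lia.
  - intros _. cbn [atom_true snd position holds]. apply nth_overflow; simpl; lia.
  - apply in_flat_map in Hc as (q & _ & Hc). apply in_flat_map in Hc as (s & _ & Hc).
    unfold state_clauses in Hc. destruct (halt_or_delta M q s) as [[q' s'] m] eqn:E.
    assert (Hg : forall X : Prop, (cstate a = q -> chead a = s -> X) ->
      (forall b, In b [(AtZero, 0, false, FQ q); (AtZero, 0, false, FR s)] ->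
        atom_true (fun r => holds (if r then step M a else a)) P i b) -> X).
    { intros X HX Hb. apply HX; [apply (Hb (AtZero, 0, false, FQ q))|
                                 apply (Hb (AtZero, 0, false, FR s))]; simpl; auto. }
    assert (Hstep := step_halt_or_delta M a). cbv zeta in Hstep.
    destruct Hc as [<-|Hc].
    { intros Hp. revert Hp. apply Hg. intros <- <-. simpl. rewrite (Hstep _ _ _ E).
      destruct m; auto. }
    destruct m; (destruct Hc as [<-|Hc];
      [intros Hp; revert Hp; apply Hg; intros <- <-; simpl; rewrite (Hstep _ _ _ E);
       reflexivity|]);
    apply in_flat_map in Hc as (x & _ & Hc); simpl in Hc;
    repeat (destruct Hc as [<-|Hc]; [|]); try contradiction;
    intros Hp; (assert (Hx := Hp _ (or_introl eq_refl)));
    (assert (Hp' := fun b Hb => Hp b (or_intror Hb))); revert Hp'; apply Hg; intros <- <-;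
    cbn [snd atom_true position holds] in *; rewrite (Hstep _ _ _ E);
    cbn [cleft cright chead]; rewrite ?Nat.add_1_r, ?Nat.add_0_r in *.
    + simpl in Hx |- *. exact Hx.
    + simpl in Hx. replace (i + 2) with (S (S i)) by lia. exact Hx.
    + rewrite nth_tl. exact Hx.
    + destruct i; simpl in *; [exact Hx|]. rewrite nth_tl. exact Hx.
    + exact Hx.
    + exact Hx.
    + exact Hx.
Qed.

(** The predicate [D] is arbitrary because it will be derivability at a node of rank [V + 1], not
    truth. *)
Lemma clauses_complete M a P (D : bool -> nat -> fact -> Prop) :
  cstate a < nstates M -> length (cleft a) <= P -> length (cright a) < P ->
  (forall i c, i < P -> In c (clauses M) -> clause_true D P i c) ->
  (forall i b, i < P -> holds a i b -> D false i b) ->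
  forall i b, i < P -> holds (step M a) i b -> D true i b.
Proof.
  intros Hq HlL HlR Hc Ha i b Hi Hb.
  destruct (halt_or_delta M (cstate a) (chead a)) as [[q' s'] m] eqn:E.
  assert (Hstep := step_halt_or_delta M a _ _ _ E). cbv zeta in Hstep.
  rewrite Hstep in Hb.
  assert (HP : 0 < P) by lia.
  assert (HL : forall j, j <= P -> D false j (FL (nth j (cleft a) None))).
  { intros j Hj. destruct (Nat.eq_dec j P) as [->|Hn]; [|apply Ha; [lia|reflexivity]].
    rewrite nth_overflow by lia.
    pose proof (Hc 0 _ HP (or_introl eq_refl)) as H. unfold clause_true in H.
    simpl in H. rewrite Nat.add_0_r in H. apply H. intros ? []. }
  assert (HR : forall j, j <= P -> D false j (FR (nth j (chead a :: cright a) None))).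
  { intros j Hj. destruct (Nat.eq_dec j P) as [->|Hn]; [|apply Ha; [lia|reflexivity]].
    rewrite nth_overflow by (simpl; lia).
    pose proof (Hc 0 _ HP (or_intror (or_introl eq_refl))) as H. unfold clause_true in H.
    simpl in H. rewrite Nat.add_0_r in H. apply H. intros ? []. }
  assert (Hin : forall j c, j < P -> In c (state_clauses M (cstate a) (chead a)) ->
                 clause_true D P j c).
  { intros j c Hj Hcl. apply Hc; auto. right; right. apply in_flat_map.
    exists (cstate a). split; [apply in_seq; lia|]. apply in_flat_map.
    exists (chead a). split; auto. apply in_symbols. }
  unfold state_clauses in Hin. rewrite E in Hin.
  set (g := [(AtZero, 0, false, FQ (cstate a)); (AtZero, 0, false, FR (chead a))]) in *.
  assert (Hg : forall j x, In x g -> atom_true D P j x).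
  { intros j x [<-|[<-|[]]]; simpl; [apply Ha; simpl; auto|apply (HR 0); lia]. }
  assert (Hg1 : forall j y x, atom_true D P j y -> In x (y :: g) -> atom_true D P j x).
  { intros j y x Hy [<-|Hx]; auto. }
  assert (Hone : forall j x, j < P -> (forall c, c = (g, x) ->
            In c (state_clauses M (cstate a) (chead a))) -> atom_true D P j x).
  { intros j x Hj Hx. specialize (Hx _ eq_refl). unfold state_clauses in Hx.
    rewrite E in Hx. apply (Hin j _ Hj Hx). apply Hg. }
  assert (Htwo : forall j y x, j < P -> atom_true D P j y -> (forall c, c = (y :: g, x) ->
            In c (state_clauses M (cstate a) (chead a))) -> atom_true D P j x).
  { intros j y x Hj Hy Hx. specialize (Hx _ eq_refl). unfold state_clauses in Hx.
    rewrite E in Hx. apply (Hin j _ Hj Hx). intros z. apply Hg1, Hy. }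
  unfold state_clauses in Hone, Htwo. rewrite E in Hone, Htwo. fold g in Hone, Htwo.
  clear Hin Hg Hg1.
  destruct b as [q|s|s].
  - destruct Hb as [-> Hb]. assert (q = q') as -> by (destruct m; simpl in Hb; auto).
    apply (Hone 0 (AtZero, 0, true, FQ q') HP). intros c ->; left; auto.
  - simpl in Hb. destruct m; simpl in Hb; subst s.
    + rewrite nth_tl. set (x := nth (S i) (cleft a) None).
      rewrite <- (Nat.add_0_r i).
      apply (Htwo i (AtLoop, 1, false, FL x) (AtLoop, 0, true, FL x) Hi).
      * simpl. rewrite Nat.add_1_r. apply HL; lia.
      * intros c ->. right; right. apply in_flat_map. exists x.
        split; [apply in_symbols|simpl; auto].
    + destruct i as [|i].
      * apply (Hone 0 (AtZero, 0, true, FL s') HP). intros c ->; right; left; auto.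
      * set (x := nth i (cleft a) None). rewrite <- Nat.add_1_r.
        apply (Htwo i (AtLoop, 0, false, FL x) (AtLoop, 1, true, FL x)); [lia| |].
        -- simpl. rewrite Nat.add_0_r. apply HL; lia.
        -- intros c ->. right; right. apply in_flat_map. exists x.
           split; [apply in_symbols|simpl; auto].
    + set (x := nth i (cleft a) None). rewrite <- (Nat.add_0_r i).
      apply (Htwo i (AtLoop, 0, false, FL x) (AtLoop, 0, true, FL x)); [lia| |].
      * simpl. rewrite Nat.add_0_r. apply HL; lia.
      * intros c ->. right; right. apply in_flat_map. exists x.
        split; [apply in_symbols|simpl; auto].
  - unfold holds in Hb. destruct m; cbn [chead cright] in Hb.
    + destruct i as [|[|i]]; simpl in Hb.
      * subst s. set (x := nth 0 (cleft a) None).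
        apply (Htwo 0 (AtZero, 0, false, FL x) (AtZero, 0, true, FR x)); [lia| |].
        -- apply (HL 0); lia.
        -- intros c ->. right; right. apply in_flat_map. exists x.
           split; [apply in_symbols|simpl; auto].
      * subst s. apply (Hone 0 (AtZero, 1, true, FR s') HP). intros c ->; right; left; auto.
      * subst s. set (x := nth i (cright a) None). replace (S (S i)) with (i + 2) by lia.
        apply (Htwo i (AtLoop, 1, false, FR x) (AtLoop, 2, true, FR x)); [lia| |].
        -- simpl. rewrite Nat.add_1_r. apply (HR (S i)); lia.
        -- intros c ->. right; right. apply in_flat_map. exists x.
           split; [apply in_symbols|simpl; auto].
    + assert (Hs : nth (S i) (chead a :: cright a) None = s).
      { rewrite <- Hb. destruct i; simpl; [|rewrite nth_tl]; reflexivity. }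
      set (x := s) in *. rewrite <- (Nat.add_0_r i).
      apply (Htwo i (AtLoop, 1, false, FR x) (AtLoop, 0, true, FR x)); [lia| |].
      * rewrite <- Hs. cbn [atom_true position]. rewrite Nat.add_1_r. apply HR; lia.
      * intros c ->. right; right. apply in_flat_map. exists x.
        split; [apply in_symbols|simpl; auto].
    + destruct i as [|i]; simpl in Hb.
      * subst s. apply (Hone 0 (AtZero, 0, true, FR s') HP). intros c ->; right; left; auto.
      * subst s. set (x := nth i (cright a) None). rewrite <- Nat.add_1_r.
        apply (Htwo i (AtLoop, 1, false, FR x) (AtLoop, 1, true, FR x)); [lia| |].
        -- simpl. rewrite Nat.add_1_r. apply (HR (S i)); lia.
        -- intros c ->. right; right. apply in_flat_map. exists x.
           split; [apply in_symbols|simpl; auto].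
Qed.

(** * The rules of the Savitch tree *)

Definition symbol_index (s : option bool) : nat :=
  match s with None => 0 | Some false => 1 | Some true => 2 end.

Definition fact_index (M : TM) (b : fact) : nat :=
  match b with
  | FQ q => q
  | FL s => nstates M + symbol_index s
  | FR s => nstates M + 3 + symbol_index s
  end.

Definition width (M : TM) : nat := nstates M + 6.

(* Variable 0 tells which half of its parent a node describes. *)
Definition var_index (M : TM) (i : nat) (r : bool) (b : fact) : nat :=
  1 + 2 * width M * i + width M * Nat.b2n r + fact_index M b.

(** [P + 2] positions: a clause for [i < P] reaches up to [i + 2], and the end clauses reach [P]. *)
Definition nvars (M : TM) (P : nat) : nat := 1 + 2 * width M * (P + 2).

Lemma fact_index_bound M b : In b (facts M) -> fact_index M b < width M.
Proof.
  unfold facts, width. rewrite !in_app_iff, !in_map_iff.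
  intros [(q & <- & Hq)|[(s & <- & _)|(s & <- & _)]]; simpl.
  - apply in_seq in Hq. lia.
  - destruct s as [[]|]; simpl; lia.
  - destruct s as [[]|]; simpl; lia.
Qed.

Lemma fact_index_inj M b b' :
  In b (facts M) -> In b' (facts M) -> fact_index M b = fact_index M b' -> b = b'.
Proof.
  unfold facts. rewrite !in_app_iff, !in_map_iff.
  intros [(q & <- & Hq)|[(s & <- & _)|(s & <- & _)]]
         [(q' & <- & Hq')|[(s' & <- & _)|(s' & <- & _)]]; simpl; intros H;
    try apply in_seq in Hq; try apply in_seq in Hq';
    try (destruct s as [[]|]); try (destruct s' as [[]|]); simpl in H;
    try lia; auto.
Qed.

Lemma var_index_inj M i r b i' r' b' :
  In b (facts M) -> In b' (facts M) -> var_index M i r b = var_index M i' r' b' ->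
  i = i' /\ r = r' /\ b = b'.
Proof.
  intros Hb Hb' H. pose proof (fact_index_bound M b Hb) as B1.
  pose proof (fact_index_bound M b' Hb') as B2. unfold var_index in H.
  set (W := width M) in *. set (x := fact_index M b) in *. set (x' := fact_index M b') in *.
  assert (E : W * (2 * i + Nat.b2n r) + x = W * (2 * i' + Nat.b2n r') + x') by nia.
  assert (E1 : 2 * i + Nat.b2n r = 2 * i' + Nat.b2n r').
  { apply (Nat.div_mod_unique W _ _ x x'); auto. }
  assert (E2 : x = x') by nia.
  assert (i = i' /\ r = r') as [-> ->] by (destruct r, r'; simpl in E1; split; auto; lia).
  repeat split. apply (fact_index_inj M); auto.
Qed.

Lemma var_index_bound M P i r b :
  In b (facts M) -> i < P + 2 -> 0 < var_index M i r b < nvars M P.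
Proof.
  intros Hb Hi. pose proof (fact_index_bound M b Hb). unfold var_index, nvars.
  assert (Nat.b2n r <= 1) by (destruct r; auto). nia.
Qed.

Definition cvar (M : TM) (i : nat) (r : bool) (b : fact) : form := pvar (var_index M i r b).

Definition parent (V t : nat) : list form := level (V + 2 + t).
Definition child (V t : nat) (first : bool) : list form :=
  level (V + 1 + t) ++ [if first then pvar 0 else Neg (pvar 0)].

(* A node of rank [V+1+t] stands for a pair of configurations at distance [2^t]. Its two kinds
   of children halve the distance: the first copies the left configuration, the right one of
   the first is the left one of the second, and the right one of the second is copied back. *)
Definition rule_left (M : TM) (V t i : nat) (b : fact) : form :=
  imps (parent V t)
    (Imp (cvar M i false b) (Box (imps (child V t true) (cvar M i false b)))).

Definition rule_middle (M : TM) (V t i : nat) (b : fact) : form :=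
  imps (parent V t)
    (Imp (Box (imps (child V t true) (cvar M i true b)))
         (Box (imps (child V t false) (cvar M i false b)))).

Definition rule_right (M : TM) (V t i : nat) (b : fact) : form :=
  imps (parent V t)
    (Imp (Box (imps (child V t false) (cvar M i true b))) (cvar M i true b)).

Definition atom_form (M : TM) (P i : nat) (a : atom) : form :=
  let '(x, d, r, b) := a in cvar M (position P i x d) r b.

(** At rank [V + 1] the two configurations are [2 ^ 0] steps apart, so the clauses relate them
    directly. *)
Definition rule_clause (M : TM) (P V i : nat) (c : clause) : form :=
  imps (level (V + 1) ++ map (atom_form M P i) (fst c)) (atom_form M P i (snd c)).

Definition is_rule (M : TM) (P V : nat) (X : form) : Prop :=
  (exists i t b, i < P /\ t < V /\ In b (facts M) /\
     (X = rule_left M V t i b \/ X = rule_middle M V t i b \/ X = rule_right M V t i b)) \/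
  (exists i c, i < P /\ In c (clauses M) /\ X = rule_clause M P V i c).

Record bounded_run (M : TM) (P : nat) (a : nat -> config) : Prop := {
  run_step : forall j, a (S j) = step M (a j);
  run_state : forall j, cstate (a j) < nstates M;
  run_left : forall j, length (cleft (a j)) <= P;
  run_right : forall j, length (cright (a j)) < P
}.

(** The assumptions at a node. A box does not reach its own world, so the rules are assumed both as
    they stand and boxed; transitivity hands the boxed copies on to the children. *)
Definition node_ctx (M : TM) (P V : nat) (a : nat -> config) (t j : nat) (X : form) : Prop :=
  is_rule M P V X \/ (exists Y, is_rule M P V Y /\ X = Box Y) \/
  In X (level (V + 1 + t)) \/
  exists i b, i < P /\ holds (a j) i b /\ X = cvar M i false b.

Lemma Dv_box_weaken (G : form -> Prop) l A : Dv G (Box A) -> Dv G (Box (imps l A)).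
Proof.
  intros H. eapply Dv_mp; [|exact H]. eapply Dv_mp; [apply Dv_thm, IL_K|].
  apply Dv_thm, IL_Nec, Dv_theorem, Dv_deduction, Dv_imps, Dv_hyp. auto.
Qed.

(** All assumptions except the description of the left configuration pass to a child by themselves,
    so only that part is left for [Dv_box]. *)
Lemma node_ctx_child M P V a t j j' l :
  (forall X, In X (level (V + 1 + t)) -> In X l) ->
  (forall i b, i < P -> holds (a j') i b ->
     Dv (node_ctx M P V a (S t) j) (Box (imps l (cvar M i false b)))) ->
  forall X, node_ctx M P V a t j' X -> Dv (node_ctx M P V a (S t) j) (Box (imps l X)).
Proof.
  intros Hl Hc X [HX|[(Y & HY & ->)|[HX|(i & b & Hi & Hb & ->)]]]; auto.
  - apply Dv_box_weaken, Dv_hyp. right; left. eauto.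
  - apply Dv_box_weaken. eapply Dv_mp; [apply Dv_thm, IL_4|]. apply Dv_hyp.
    right; left. eauto.
  - apply Dv_thm, IL_Nec, IL_imps, Dv_hyp, Hl, HX.
Qed.

Lemma node_derives M P V a :
  bounded_run M P a -> forall t, t <= V -> forall j i b,
  i < P -> holds (a (j + 2 ^ t)) i b -> Dv (node_ctx M P V a t j) (cvar M i true b).
Proof.
  intros Hrun. induction t as [|t IH]; intros Ht j i b Hi Hb.
  - simpl in Hb. rewrite Nat.add_1_r, (run_step _ _ _ Hrun) in Hb.
    revert i b Hi Hb. apply (clauses_complete M (a j) P
      (fun r i b => Dv (node_ctx M P V a 0 j) (cvar M i r b))); try apply Hrun.
    + intros i c Hi Hc Hp.
      assert (Hr : Dv (node_ctx M P V a 0 j) (rule_clause M P V i c)).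
      { apply Dv_hyp. left. right. eauto. }
      assert (Hform : forall x,
        atom_true (fun r i b => Dv (node_ctx M P V a 0 j) (cvar M i r b)) P i x
        = Dv (node_ctx M P V a 0 j) (atom_form M P i x))
        by (intros [[[x d] r] b]; reflexivity).
      rewrite Hform. apply (Dv_imps_mp _ _ _ Hr). intros X HX. apply in_app_or in HX as [HX|HX].
      * apply Dv_hyp. right; right; left. rewrite Nat.add_0_r. exact HX.
      * apply in_map_iff in HX as (x' & <- & Hx'). specialize (Hp x' Hx').
        rewrite Hform in Hp. exact Hp.
    + intros i b Hi Hb. apply Dv_hyp. right; right; right. eauto.
  - assert (Hlev : forall X, In X (parent V t) -> Dv (node_ctx M P V a (S t) j) X).
    { intros X HX. apply Dv_hyp. right; right; left.
      unfold parent in HX. replace (V + 1 + S t) with (V + 2 + t) by lia. exact HX. }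
    assert (Hch : forall f X, In X (level (V + 1 + t)) -> In X (child V t f)).
    { intros f X HX. apply in_or_app; auto. }
    assert (Hfacts : forall j i b, holds (a j) i b -> In b (facts M)).
    { intros j' i' b' H. eapply holds_in_facts; [apply Hrun|exact H]. }
    (* The first child also starts at time [j]; [rule_left] provides its initial facts. *)
    assert (Hmid : forall i b, i < P -> holds (a (j + 2 ^ t)) i b ->
      Dv (node_ctx M P V a (S t) j) (Box (imps (child V t true) (cvar M i true b)))).
    { intros i' b' Hi' Hb'.
      refine (Dv_box _ _ _ _ (node_ctx_child M P V a t j j _ (Hch true) _)
               (IH ltac:(lia) j i' b' Hi' Hb')).
      intros i0 b0 Hi0 Hb0. apply (Dv_mp _ (cvar M i0 false b0)).
      - apply (Dv_imps_mp _ (parent V t)); auto. apply Dv_hyp. left; left.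
        exists i0, t, b0. repeat split; eauto.
      - apply Dv_hyp. right; right; right. eauto. }
    (* The second child starts at time [j + 2 ^ t]; [rule_middle] turns [Hmid] into its initial
       facts. *)
    assert (Hend : Dv (node_ctx M P V a (S t) j)
                      (Box (imps (child V t false) (cvar M i true b)))).
    { assert (Hb' : holds (a (j + 2 ^ t + 2 ^ t)) i b).
      { replace (j + 2 ^ t + 2 ^ t) with (j + 2 ^ S t) by (simpl; lia). exact Hb. }
      refine (Dv_box _ _ _ _ (node_ctx_child M P V a t j (j + 2 ^ t) _ (Hch false) _)
               (IH ltac:(lia) (j + 2 ^ t) i b Hi Hb')).
      intros i0 b0 Hi0 Hb0.
      apply (Dv_mp _ (Box (imps (child V t true) (cvar M i0 true b0)))); auto.
      apply (Dv_imps_mp _ (parent V t)); auto. apply Dv_hyp. left; left.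
      exists i0, t, b0. repeat split; eauto. }
    apply (Dv_mp _ (Box (imps (child V t false) (cvar M i true b)))); auto.
    apply (Dv_imps_mp _ (parent V t)); auto. apply Dv_hyp. left; left.
    exists i, t, b. repeat split; eauto.
Qed.

(** * The countermodel *)

(* The world [(k, f, j)] has rank [k]. Worlds of rank at most [V] serve to give truth values
   to the [pvar l]; the world [(V+1+t, f, j)] is the node of the Savitch tree for the
   configurations at times [j] and [j + 2^t]. *)
Definition world : Type := nat * bool * nat.

Definition rank (w : world) : nat := fst (fst w).

(** Only a step to the next lower rank has to respect the tree: the flag of the successor decides
    whether it inherits the time [j] or gets the middle time. All lower ranks are accessible without
    restriction, which makes the relation transitive. *)
Definition mR (V : nat) (w u : world) : Prop :=
  let '(k, _, j) := w in let '(k', f', j') := u in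
  k' < k /\ (k = S k' -> V < k' -> j' = if f' then j else j + 2 ^ (k' - V - 1)).

Definition bit (M : TM) (V : nat) (a : nat -> config) (w : world) (l : nat) : Prop :=
  let '(k, f, j) := w in
  (l = 0 /\ f = true) \/
  exists i r b, In b (facts M) /\ l = var_index M i r b /\
    holds (a (if r then j + 2 ^ (k - V - 1) else j)) i b.

(** Bit [l] of [w] permits climbing from rank [l] to [l + 1]; asking for all bits between the two
    ranks is the transitive closure of such steps. *)
Definition mS (M : TM) (V : nat) (a : nat -> config) (w u v : world) : Prop :=
  mR V w u /\ mR V w v /\
  (u = v \/ mR V u v \/
   (rank u <= V /\ rank v <= V /\ forall l, rank u <= l < rank v -> bit M V a w l)).

Ltac rank_lia := unfold rank in *; simpl in *; lia.

Lemma mR_rank V w u : mR V w u -> rank u < rank w.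
Proof. destruct w as [[k f] j], u as [[k' f'] j']. simpl. intuition auto. Qed.

Lemma mR_trans V w u v : mR V w u -> mR V u v -> mR V w v.
Proof.
  destruct w as [[k f] j], u as [[k' f'] j'], v as [[k'' f''] j'']. simpl.
  intros [H1 _] [H2 _]. split; [lia|]. intros ->. lia.
Qed.

Lemma mR_low V w u : rank u < rank w -> rank u <= V -> mR V w u.
Proof.
  destruct w as [[k f] j], u as [[k' f'] j']. unfold rank; simpl. intros H1 H2.
  split; [auto|]. intros _ H3. lia.
Qed.

Lemma model_veltman M V a : veltman (mR V) (mS M V a).
Proof.
  split.
  - apply mR_trans.
  - apply (well_founded_lt_compat _ rank). intros u v H. apply (mR_rank V), H.
  - intros w u v H. apply H.
  - intros w u H. repeat split; auto.
  - intros w u v x (Hu & Hv & H1) (_ & Hx & H2). split; [auto|split; [auto|]].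
    destruct H1 as [->|[H1|(L1 & L2 & H1)]]; auto.
    + destruct H2 as [->|[H2|(L2 & L3 & H2)]]; auto.
      * right; left. eapply mR_trans; eauto.
      (* Down from [u] to [v], then on to [x] among the low ranks: either [x] is below [u], or the
         climb from [u] to [x] is part of that from [v]. *)
      * pose proof (mR_rank _ _ _ H1).
        destruct (Nat.lt_ge_cases (rank x) (rank u)) as [Hl|Hl].
        -- right; left. apply mR_low; auto.
        -- right; right. assert (rank u <= V) by lia. repeat split; auto.
           intros l Hlr. apply H2. lia.
    + destruct H2 as [->|[H2|(L3 & L4 & H2)]]; auto.
      * pose proof (mR_rank _ _ _ H2). right; right. repeat split; auto; [lia|].
        intros l Hl. apply H1. lia.
      * right; right. repeat split; auto. intros l Hl.
        destruct (Nat.lt_ge_cases l (rank v)); [apply H1|apply H2]; lia.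
  - intros w u v Hu Hv. split; [auto|]. split; [eapply mR_trans; eauto|auto].
Qed.

Lemma model_boxes M V a w r : forces (mR V) (mS M V a) w (boxes r) <-> rank w < r.
Proof.
  revert w; induction r as [|r IH]; intros w.
  - simpl. lia.
  - change (forces (mR V) (mS M V a) w (boxes (S r))) with
      (forall u, mR V w u -> forces (mR V) (mS M V a) u (boxes r)).
    split.
    + intros H. destruct w as [[k f] j]. unfold rank; simpl. destruct k as [|k]; [lia|].
      specialize (H (k, true, j)). rewrite IH in H. unfold rank in H; simpl in H.
      apply -> Nat.succ_lt_mono. apply H. split; auto.
    + intros H u Hu. apply IH. apply mR_rank in Hu. lia.
Qed.

Lemma model_level M V a w r :
  (forall X, In X (level r) -> forces (mR V) (mS M V a) w X) <-> rank w = r.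
Proof.
  split.
  - intros H. pose proof (H _ (or_introl eq_refl)) as H1. apply model_boxes in H1.
    pose proof (H _ (or_intror (or_introl eq_refl))) as H2. simpl in H2.
    rewrite model_boxes in H2. lia.
  - intros H X [<-|[<-|[]]].
    + apply model_boxes. lia.
    + simpl. rewrite model_boxes. lia.
Qed.

(** To read off bit [l], start from a world of rank exactly [l]: a higher rank is reached from it
    only by climbing through [l]. Conversely, worlds of rank above [l] are their own witnesses, and
    those of rank [l] climb one step, to a rank that is still at most [V]. *)
Lemma model_pvar M V a w l :
  l < V -> V < rank w -> (forces (mR V) (mS M V a) w (pvar l) <-> bit M V a w l).
Proof.
  intros Hl Hw. change (forces (mR V) (mS M V a) w (pvar l)) with
    (forall u, mR V w u -> ~ forces (mR V) (mS M V a) u (boxes l) ->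
       exists v, mS M V a w u v /\ ~ forces (mR V) (mS M V a) v (boxes (S l))).
  split.
  - intros H. destruct (H (l, true, 0)) as (v & (_ & Hv & Hs) & Hb).
    + apply mR_low; rank_lia.
    + rewrite model_boxes. rank_lia.
    + rewrite model_boxes in Hb. destruct Hs as [<-|[Hs|(L1 & L2 & Hs)]].
      * rank_lia.
      * apply mR_rank in Hs. rank_lia.
      * apply Hs. rank_lia.
  - intros H u Hu Hb. rewrite model_boxes in Hb.
    destruct (Nat.eq_dec (rank u) l) as [E|E].
    + exists (S l, true, 0). rewrite model_boxes. split; [|rank_lia].
      split; [auto|]. split; [apply mR_low; rank_lia|].
      right; right. repeat split; try rank_lia. intros l' Hl'.
      assert (l' = l) as -> by rank_lia. exact H.
    + exists u. rewrite model_boxes. split; [|lia]. repeat split; auto.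
Qed.

Lemma model_flag M V a k f j :
  0 < V -> V < k -> (forces (mR V) (mS M V a) (k, f, j) (pvar 0) <-> f = true).
Proof.
  intros HV Hk. rewrite model_pvar by auto. simpl. split; [|auto].
  intros [[_ H]|(i & r & b & Hb & H & _)]; [auto|discriminate].
Qed.

Lemma model_cvar M P a k f j i r b :
  let V := nvars M P in
  V < k -> i < P + 2 -> In b (facts M) ->
  (forces (mR V) (mS M V a) (k, f, j) (cvar M i r b) <->
   holds (a (if r then j + 2 ^ (k - V - 1) else j)) i b).
Proof.
  intros V Hk Hi Hb. pose proof (var_index_bound M P i r b Hb Hi) as HB.
  unfold cvar. rewrite model_pvar by (auto; apply HB). simpl. split.
  - intros [[H _]|(i' & r' & b' & Hb' & E & H)]; [discriminate|].
    apply var_index_inj in E as (-> & -> & ->); auto.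
  - intros H. right. eauto 10.
Qed.

(** Rank and flag are visible to formulas, the time is not; but among the successors of a given
    parent, rank and flag of a child determine its time. *)
Lemma model_child M P a t first w :
  let V := nvars M P in
  (forall X, In X (child V t first) -> forces (mR V) (mS M V a) w X) <->
  exists j, w = (V + 1 + t, first, j).
Proof.
  intros V. assert (HV : 0 < V) by (unfold V, nvars; lia). destruct w as [[k f] j]. split.
  - intros H.
    assert (Hk : k = V + 1 + t).
    { apply (model_level M V a (k, f, j)). intros X HX. apply H, in_or_app; auto. }
    subst k. specialize (H (if first then pvar 0 else Neg (pvar 0))).
    exists j. f_equal. f_equal.
    assert (Hf := model_flag M V a (V + 1 + t) f j HV ltac:(lia)).
    assert (Hin : forall X, In X (child V t first) <->
             In X (level (V + 1 + t)) \/ X = if first then pvar 0 else Neg (pvar 0)).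
    { intros X. unfold child. rewrite in_app_iff. simpl. intuition auto. }
    rewrite Hin in H. specialize (H (or_intror eq_refl)). destruct first.
    + apply Hf, H.
    + cbn [Neg forces] in H. rewrite Hf in H. destruct f; [exfalso; auto|auto].
  - intros (j' & E) X HX. apply pair_equal_spec in E as [E ->].
    apply pair_equal_spec in E as [-> ->]. apply in_app_or in HX as [HX|[<-|[]]].
    + revert X HX. apply model_level. reflexivity.
    + destruct first; [|cbn [Neg forces]]; rewrite model_flag by lia; auto.
      discriminate.
Qed.

Lemma clause_positions M P i c :
  i < P -> In c (clauses M) -> forall x d r b, In (x, d, r, b) (snd c :: fst c) ->
  position P i x d < P + 2.
Proof.
  intros Hi [<-|[<-|Hc]] x d r b Hx.
  - destruct Hx as [[= <- <- <- <-]|[]]. simpl; lia.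
  - destruct Hx as [[= <- <- <- <-]|[]]. simpl; lia.
  - apply in_flat_map in Hc as (q & _ & Hc). apply in_flat_map in Hc as (s & _ & Hc).
    unfold state_clauses in Hc. destruct (halt_or_delta M q s) as [[q' s'] m].
    destruct Hc as [<-|Hc].
    { simpl in Hx. decompose [or] Hx; try contradiction;
        match goal with H : _ = _ |- _ => injection H as <- <- <- <- end; simpl; lia. }
    destruct m; (destruct Hc as [<-|Hc];
      [simpl in Hx; decompose [or] Hx; try contradiction;
       match goal with H : _ = _ |- _ => injection H as <- <- <- <- end; simpl; lia|]);
    apply in_flat_map in Hc as (y & _ & Hc); simpl in Hc;
    decompose [or] Hc; try contradiction; subst c; simpl in Hx;
    decompose [or] Hx; try contradiction;
    match goal with H : (_, _, _, _) = _ |- _ => injection H as <- <- <- <- end; simpl; lia.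
Qed.

Lemma clause_facts M c :
  TM_wf M -> In c (clauses M) -> forall x d r b, In (x, d, r, b) (snd c :: fst c) ->
  In b (facts M).
Proof.
  intros Hwf Hc x d r b Hx. destruct b as [p|s|s];
    [|apply in_facts_L|apply in_facts_R]. apply in_facts_Q.
  destruct Hc as [<-|[<-|Hc]].
  - destruct Hx as [[=]|[]].
  - destruct Hx as [[=]|[]].
  - apply in_flat_map in Hc as (q & Hq & Hc). apply in_flat_map in Hc as (s & _ & Hc).
    apply in_seq in Hq.
    unfold state_clauses in Hc. destruct (halt_or_delta M q s) as [[q' s'] m] eqn:E.
    assert (Hq' : q' < nstates M).
    { unfold halt_or_delta in E. destruct (halting M q); [injection E; intros; lia|].
      destruct Hwf as (_ & _ & _ & Hwf). specialize (Hwf q s ltac:(lia)).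
      rewrite E in Hwf. exact Hwf. }
    destruct Hc as [<-|Hc].
    { simpl in Hx. decompose [or] Hx; try contradiction; try congruence;
        match goal with H : _ = _ |- _ => injection H; intros; subst; lia end. }
    destruct m; (destruct Hc as [<-|Hc];
      [simpl in Hx; decompose [or] Hx; try contradiction; try congruence;
        match goal with H : _ = _ |- _ => injection H; intros; subst; lia end|]);
    apply in_flat_map in Hc as (y & _ & Hc); simpl in Hc;
    decompose [or] Hc; try contradiction; subst c; simpl in Hx;
    decompose [or] Hx; try contradiction; try congruence;
    match goal with H : (_, _, _, _) = _ |- _ => injection H; intros; subst; lia end.
Qed.

(** Each rule is guarded by a level, so only worlds of one rank have to be checked. Since [w] is
    arbitrary, the boxed copies are true as well. *)
Lemma model_rule M P a X w :
  let V := nvars M P in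
  TM_wf M -> bounded_run M P a -> is_rule M P V X -> forces (mR V) (mS M V a) w X.
Proof.
  intros V Hwf Hrun.
  assert (Hcvar := model_cvar M P a). cbv zeta in Hcvar. fold V in Hcvar.
  intros [(i & t & b & Hi & Ht & Hb & HX)|(i & c & Hi & Hc & ->)].
  - assert (Hbox : forall first A,
      forces (mR V) (mS M V a) w (Box (imps (child V t first) A)) <->
      forall j, mR V w (V + 1 + t, first, j) ->
        forces (mR V) (mS M V a) (V + 1 + t, first, j) A).
    { intros first A. split.
      - intros H j Hj. specialize (H _ Hj). rewrite forces_imps in H. apply H.
        apply (model_child M P a t first). eauto.
      - intros H u Hu. rewrite forces_imps. intros Hch.
        apply (model_child M P a t first) in Hch as (j & ->). auto. }
    assert (Ek : V + 1 + t - V - 1 = t) by lia.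
    (* For each flag a parent sees children at a single time, so a box over that kind of children is
       a statement about one configuration pair. *)
    assert (HR : forall j first j', rank w = V + 2 + t -> snd w = j ->
      (mR V w (V + 1 + t, first, j') <-> j' = if first then j else j + 2 ^ t)).
    { intros j first j' Hw Hj. destruct w as [[k f] j0].
      change (k = V + 2 + t) in Hw. simpl in Hj. subst k j0.
      unfold mR. rewrite Ek. split.
      - intros [_ H]. apply H; lia.
      - intros ->. split; [lia|auto]. }
    destruct HX as [-> | [-> | ->]]; unfold rule_left, rule_middle, rule_right;
      rewrite forces_imps; intros Hp; apply model_level in Hp;
      destruct w as [[k f] j]; change (k = V + 2 + t) in Hp; subst k;
      match goal with |- forces ?R ?S ?w (Imp ?A ?B) =>
        change (forces R S w A -> forces R S w B) end.
    + rewrite Hbox. intros H j' Hj'. apply (HR j) in Hj' as ->; auto.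
      rewrite Hcvar in H |- * by (auto; lia). exact H.
    + rewrite !Hbox. intros H j' Hj'. apply (HR j) in Hj' as ->; auto.
      specialize (H j (proj2 (HR j true j eq_refl eq_refl) eq_refl)).
      rewrite Hcvar in H |- * by (auto; lia). rewrite Ek in H. exact H.
    + rewrite Hbox. intros H.
      specialize (H (j + 2 ^ t) (proj2 (HR j false (j + 2 ^ t) eq_refl eq_refl) eq_refl)).
      rewrite Hcvar in H |- * by (auto; lia). rewrite Ek in H.
      replace (V + 2 + t - V - 1) with (S t) by lia.
      replace (j + 2 ^ S t) with (j + 2 ^ t + 2 ^ t) by (simpl; lia). exact H.
  - unfold rule_clause. rewrite forces_imps. intros Hp.
    assert (Hk : rank w = V + 1).
    { apply (model_level M V a). intros X HX. apply Hp, in_or_app; auto. }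
    destruct w as [[k f] j]. change (k = V + 1) in Hk. subst k.
    assert (Hatom : forall x, In x (snd c :: fst c) ->
      (forces (mR V) (mS M V a) (V + 1, f, j) (atom_form M P i x) <->
       atom_true (fun r => holds (if r then step M (a j) else a j)) P i x)).
    { intros [[[x d] r] b] Hx. unfold atom_form. rewrite Hcvar.
      - unfold atom_true. replace (V + 1 - V - 1) with 0 by lia.
        rewrite <- (run_step _ _ _ Hrun). rewrite Nat.pow_0_r, Nat.add_1_r.
        destruct r; reflexivity.
      - lia.
      - eapply clause_positions; eauto.
      - eapply clause_facts; eauto. }
    apply Hatom; [left; auto|].
    apply clauses_sound; try apply Hrun; auto.
    intros x Hx. apply Hatom; [right; auto|]. apply Hp, in_or_app. right.
    apply in_map; auto.
Qed.

(** * Printing the formulas *)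

(** Formula templates whose only parameters are numbers of boxes. This is enough because all indices
    of levels and variables are affine in the loop variables. *)
Inductive tform : Type :=
| TBot : tform
| TImp : tform -> tform -> tform
| TBox : tform -> tform
| TRhd : tform -> tform -> tform
| TBoxes : nat -> nat -> tform -> tform.

Fixpoint tden (env : list nat) (A : tform) : form :=
  match A with
  | TBot => Bot
  | TImp A B => Imp (tden env A) (tden env B)
  | TBox A => Box (tden env A)
  | TRhd A B => Rhd (tden env A) (tden env B)
  | TBoxes x a A => Nat.iter (a * nth x env 0) Box (tden env A)
  end.

Fixpoint tgen (A : tform) : gen :=
  match A with
  | TBot => GPrint [false; false; false]
  | TImp A B => GSeq (GPrint [false; false; true]) (GSeq (tgen A) (tgen B))
  | TBox A => GSeq (GPrint [false; true; false]) (tgen A)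
  | TRhd A B => GSeq (GPrint [false; true; true]) (GSeq (tgen A) (tgen B))
  | TBoxes x a A =>
      GSeq (GFor x (GPrint (concat (repeat [false; true; false] a)))) (tgen A)
  end.

Lemma enc_iter_Box n A :
  enc (Nat.iter n Box A) = concat (repeat [false; true; false] n) ++ enc A.
Proof. induction n; simpl; [|rewrite IHn]; reflexivity. Qed.

Lemma concat_repeat_mul {A} (l : list A) a v s :
  flat_map (fun _ : nat => concat (repeat l a)) (seq s v) = concat (repeat l (a * v)).
Proof.
  revert s; induction v; intros s; simpl.
  - rewrite Nat.mul_0_r. reflexivity.
  - rewrite IHv, Nat.mul_succ_r, Nat.add_comm, repeat_app, concat_app. reflexivity.
Qed.

Lemma gout_tgen A env : gout (tgen A) env = enc (tden env A).
Proof.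
  induction A; simpl; try congruence.
  rewrite enc_iter_Box, concat_repeat_mul, IHA. reflexivity.
Qed.

Lemma tden_closed A env : closed (tden env A) = true.
Proof.
  induction A; simpl; auto; try (apply andb_true_intro; auto).
  induction (n0 * nth n env 0); simpl; auto.
Qed.

Definition affine : Type := list (nat * nat) * nat.

Definition aval (env : list nat) (e : affine) : nat :=
  fold_right (fun xa s => snd xa * nth (fst xa) env 0 + s) (snd e) (fst e).

Definition asucc (e : affine) : affine := (fst e, S (snd e)).

Lemma aval_succ env e : aval env (asucc e) = S (aval env e).
Proof.
  destruct e as [l c]. unfold aval, asucc; simpl. induction l; simpl; [auto|].
  rewrite IHl. lia.
Qed.

Definition tboxes (e : affine) : tform :=
  fold_right (fun xa => TBoxes (fst xa) (snd xa)) (Nat.iter (snd e) TBox TBot) (fst e).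

Lemma tden_boxes env e : tden env (tboxes e) = boxes (aval env e).
Proof.
  destruct e as [l c]. unfold tboxes, aval, boxes; simpl. induction l as [|xa l IH]; simpl.
  - induction c; simpl; congruence.
  - rewrite IH, Nat.iter_add. reflexivity.
Qed.

Definition tlevel (e : affine) : list tform := [tboxes (asucc e); TImp (tboxes e) TBot].

Lemma tden_level env e : map (tden env) (tlevel e) = level (aval env e).
Proof. unfold level. simpl. rewrite !tden_boxes, aval_succ. reflexivity. Qed.

Definition tpvar (e : affine) : tform :=
  TRhd (TImp (tboxes e) TBot) (TImp (tboxes (asucc e)) TBot).

Lemma tden_pvar env e : tden env (tpvar e) = pvar (aval env e).
Proof. unfold pvar. simpl. rewrite !tden_boxes, aval_succ. reflexivity. Qed.

Definition timps (l : list tform) (A : tform) : tform := fold_right TImp A l.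

Lemma tden_imps env l A : tden env (timps l A) = imps (map (tden env) l) (tden env A).
Proof. induction l; simpl; congruence. Qed.

(* The position is the sum of the variables in [xs] and of [d]. *)
Definition tcvar (M : TM) (xs : list nat) (d : nat) (r : bool) (b : fact) : tform :=
  tpvar (map (fun x => (x, 2 * width M)) xs, var_index M d r b).

Lemma tden_cvar env M xs d r b :
  tden env (tcvar M xs d r b) = cvar M (list_sum (map (fun x => nth x env 0) xs) + d) r b.
Proof.
  unfold tcvar. rewrite tden_pvar. unfold cvar. f_equal.
  unfold aval; simpl fst; simpl snd. induction xs as [|x xs IH]; [reflexivity|].
  cbn [map fold_right fst snd]. rewrite IH. unfold var_index, list_sum.
  cbn [fold_right]. ring.
Qed.

(** * The reduction *)

(* In [blocks] variables 0, 1, 2, 3 are the length of the input, the space bound, the bound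
   [P] on positions and the number [V] of propositional variables; variables 4 and 5 are the
   loop variables [i] and [t]. *)
Definition tatom (M : TM) (a : atom) : tform :=
  let '(x, d, r, b) := a in
  tcvar M (match x with AtZero => [] | AtLoop => [4] | AtEnd => [2] end) d r b.

Definition tclause (M : TM) (c : clause) : tform :=
  timps (tlevel ([(3, 1)], 1) ++ map (tatom M) (fst c)) (tatom M (snd c)).

Definition tparent : list tform := tlevel ([(3, 1); (5, 1)], 2).
Definition tchild (first : bool) : list tform :=
  tlevel ([(3, 1); (5, 1)], 1) ++
  [if first then tpvar ([], 0) else TImp (tpvar ([], 0)) TBot].

Definition tree_rules (M : TM) (b : fact) : list tform :=
  [timps tparent (TImp (tcvar M [4] 0 false b)
     (TBox (timps (tchild true) (tcvar M [4] 0 false b))));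
   timps tparent (TImp (TBox (timps (tchild true) (tcvar M [4] 0 true b)))
     (TBox (timps (tchild false) (tcvar M [4] 0 false b))));
   timps tparent (TImp (TBox (timps (tchild false) (tcvar M [4] 0 true b)))
     (tcvar M [4] 0 true b))].

Definition with_boxes (l : list tform) : list tform := l ++ map TBox l.

(** The first block gives the root its rank [2 * V + 1], that is [t = V], and the start state. The
    next two fill with blanks the right stack from the input length up to [P] and the left stack
    from 0 up to [P]. *)
Definition blocks (M : TM) : list (list nat * list tform) :=
  [([], tlevel ([(3, 2)], 1) ++ [tcvar M [] 0 false (FQ (start M))]);
   ([1], [tcvar M [0; 4] 0 false (FR None)]);
   ([2], [tcvar M [4] 0 false (FL None)]);
   ([2; 3], with_boxes (flat_map (tree_rules M) (facts M)));
   ([2], with_boxes (map (tclause M) (clauses M)))].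

Fixpoint envs (xs : list nat) (env : list nat) : list (list nat) :=
  match xs with
  | [] => [env]
  | x :: xs => flat_map (fun i => envs xs (env ++ [i])) (seq 0 (nth x env 0))
  end.

Definition block_forms (env : list nat) (B : list nat * list tform) : list form :=
  flat_map (fun e => map (tden e) (snd B)) (envs (fst B) env).

Fixpoint input_forms (M : TM) (i : nat) (w : list bool) : list form :=
  match w with
  | [] => []
  | b :: w => tden [i] (tcvar M [0] 0 false (FR (Some b))) :: input_forms M (S i) w
  end.

Definition tgoal (M : TM) : tform := tcvar M [] 0 true (FQ (qacc M)).

(** With [P = n + poly c k n] the padding after the input is indexed by [n + i] for
    [i < poly c k n], so the templates need no subtraction. *)
Definition env0 (M : TM) (c k n : nat) : list nat :=
  [n; poly c k n; n + poly c k n; nvars M (n + poly c k n)].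

(** The hypotheses about the input come first because they are printed while the input is being
    consumed. *)
Definition hypotheses (M : TM) (c k : nat) (w : list bool) : list form :=
  input_forms M 0 w ++ flat_map (block_forms (env0 M c k (length w))) (blocks M).

Definition reduction (M : TM) (c k : nat) (w : list bool) : form :=
  imps (hypotheses M c k w) (tden (env0 M c k (length w)) (tgoal M)).

Fixpoint loop_gen (xs : list nat) (g : gen) : gen :=
  match xs with
  | [] => g
  | x :: xs => GFor x (loop_gen xs g)
  end.

Definition hyp_gen (A : tform) : gen := GSeq (GPrint [false; false; true]) (tgen A).

Definition block_gen (B : list nat * list tform) : gen :=
  loop_gen (fst B) (fold_right GSeq (GPrint []) (map hyp_gen (snd B))).

(** The three [GLet] compute by counting bits: [k] nested loops of length [n] give [c * n ^ k + c],
    then follow [P] and [V = nvars M P]. *)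
Definition reduction_gen (M : TM) (c k : nat) : gen :=
  GLet (GSeq (loop_gen (repeat 0 k) (GPrint (repeat true c))) (GPrint (repeat true c)))
    (GLet (GSeq (GFor 0 (GPrint [true])) (GFor 1 (GPrint [true])))
      (GLet (GSeq (GFor 2 (GPrint (repeat true (2 * width M))))
                  (GPrint (repeat true (1 + 4 * width M))))
        (fold_right GSeq (tgen (tgoal M)) (map block_gen (blocks M))))).

Definition enc_hyps (l : list form) : list bool :=
  flat_map (fun X => [false; false; true] ++ enc X) l.

(** In Polish notation a chain of implications is a plain concatenation, so hypotheses can be
    printed one by one. *)
Lemma enc_imps l A : enc (imps l A) = enc_hyps l ++ enc A.
Proof. induction l; simpl; [|rewrite IHl, <- app_assoc]; reflexivity. Qed.

Lemma gout_loop_gen xs g env : gout (loop_gen xs g) env = flat_map (gout g) (envs xs env).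
Proof.
  revert env; induction xs as [|x xs IH]; intros env; simpl.
  - rewrite app_nil_r. reflexivity.
  - induction (seq 0 (nth x env 0)); simpl; [reflexivity|].
    rewrite flat_map_app, IH, IHl. reflexivity.
Qed.

Lemma enc_hyps_app l l' : enc_hyps (l ++ l') = enc_hyps l ++ enc_hyps l'.
Proof. apply flat_map_app. Qed.

Lemma gout_block_gen B env : gout (block_gen B) env = enc_hyps (block_forms env B).
Proof.
  destruct B as [xs ts]. unfold block_gen, block_forms; simpl. rewrite gout_loop_gen.
  induction (envs xs env) as [|e es IH]; simpl; [reflexivity|].
  rewrite enc_hyps_app, IH. f_equal. clear.
  induction ts as [|A ts IH]; simpl; [reflexivity|]. rewrite gout_tgen, IH. reflexivity.
Qed.

Lemma length_flat_map_const {A B} (f : A -> list B) n l :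
  (forall x, In x l -> length (f x) = n) -> length (flat_map f l) = length l * n.
Proof.
  induction l; simpl; intros H; [reflexivity|]. rewrite length_app, H, IHl; auto.
Qed.

Lemma length_envs k env n :
  env <> [] -> nth 0 env 0 = n -> length (envs (repeat 0 k) env) = n ^ k.
Proof.
  revert env; induction k; intros env He Hn; [reflexivity|]. simpl.
  rewrite Hn. rewrite (length_flat_map_const _ (n ^ k)); [rewrite length_seq; reflexivity|].
  intros i _. apply IHk.
  - destruct env; simpl; congruence.
  - rewrite app_nth1; [auto|]. destruct env; [congruence|simpl; lia].
Qed.

Lemma gout_reduction_gen M c k n :
  gout (reduction_gen M c k) [n] =
  enc_hyps (flat_map (block_forms (env0 M c k n)) (blocks M))
  ++ enc (tden (env0 M c k n) (tgoal M)).
Proof.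
  unfold reduction_gen. cbn [gout app].
  assert (E1 : length (gout (loop_gen (repeat 0 k) (GPrint (repeat true c))) [n; 0]
                       ++ repeat true c) = poly c k n).
  { rewrite length_app, gout_loop_gen, (length_flat_map_const _ c)
      by (intros; apply repeat_length).
    rewrite (length_envs k _ n) by (simpl; congruence). rewrite repeat_length.
    unfold poly. lia. }
  rewrite E1. cbn [nth].
  assert (E2 : forall m l, length (flat_map (fun _ : nat => repeat true l) (seq 0 m)) = m * l).
  { intros m l. rewrite (length_flat_map_const _ l), length_seq; auto.
    intros. apply repeat_length. }
  rewrite !length_app, (E2 _ 1), (E2 _ 1), E2, repeat_length, !Nat.mul_1_r.
  replace ((n + poly c k n) * (2 * width M) + (1 + 4 * width M))
    with (nvars M (n + poly c k n)) by (unfold nvars; ring).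
  fold (env0 M c k n).
  induction (blocks M) as [|B Bs IH]; cbn [map fold_right gout flat_map app].
  - apply gout_tgen.
  - rewrite IH, gout_block_gen, enc_hyps_app, app_assoc. reflexivity.
Qed.

Lemma gout_input M i w :
  input_out (hyp_gen (tcvar M [0] 0 false (FR (Some false))))
            (hyp_gen (tcvar M [0] 0 false (FR (Some true)))) i w
  = enc_hyps (input_forms M i w).
Proof.
  revert i; induction w as [|b w IH]; intros i; [reflexivity|].
  cbn [input_out input_forms]. rewrite IH. unfold enc_hyps at 2. cbn [flat_map].
  fold (enc_hyps (input_forms M (S i) w)). f_equal.
  destruct b; cbn [hyp_gen gout]; rewrite gout_tgen; reflexivity.
Qed.

Lemma reduction_poly_time M c k : poly_time_computable (fun w => enc (reduction M c k w)).
Proof.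
  destruct (gen_poly_time (hyp_gen (tcvar M [0] 0 false (FR (Some false))))
              (hyp_gen (tcvar M [0] 0 false (FR (Some true)))) (reduction_gen M c k))
    as (M' & c' & k' & Hwf & H).
  exists M', c', k'. split; auto. intros w. destruct (H w) as (n & H1 & H2 & H3).
  exists n. repeat split; auto. rewrite H3. unfold reduction, hypotheses.
  rewrite enc_imps, enc_hyps_app, gout_input, gout_reduction_gen, app_assoc. reflexivity.
Qed.

Lemma closed_imps l A : forallb closed l = true -> closed A = true -> closed (imps l A) = true.
Proof.
  induction l; simpl; auto. rewrite andb_true_iff. intros [-> H] HA. simpl; auto.
Qed.

Lemma reduction_closed M c k w : closed (reduction M c k w) = true.
Proof.
  apply closed_imps; [|apply tden_closed]. apply forallb_forall. intros X HX.
  apply in_app_or in HX as [HX|HX].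
  - revert HX. generalize 0. induction w as [|b w IH]; simpl; intros i; [contradiction|].
    intros [<-|HX]; [apply (tden_closed (tcvar M [0] 0 false (FR (Some b))))|eapply IH; eauto].
  - apply in_flat_map in HX as (B & _ & HX). apply in_flat_map in HX as (e & _ & HX).
    apply in_map_iff in HX as (T & <- & _). apply tden_closed.
Qed.

Lemma in_input_forms M w X : forall i,
  In X (input_forms M i w) <->
  exists j b, nth_error w j = Some b /\ X = cvar M (i + j) false (FR (Some b)).
Proof.
  induction w as [|b w IH]; intros i.
  - simpl. split; [contradiction|]. intros ([|j] & b & H & _); discriminate.
  - cbn [input_forms In]. rewrite IH, tden_cvar. cbn [map list_sum fold_right nth].
    split.
    + intros [<-|(j & b' & Hj & ->)].
      * exists 0, b. split; [reflexivity|]. f_equal; lia.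
      * exists (S j), b'. split; [exact Hj|]. f_equal; lia.
    + intros ([|j] & b' & Hj & ->).
      * left. injection Hj as ->. f_equal; lia.
      * right. exists j, b'. split; [exact Hj|]. f_equal; lia.
Qed.

Lemma in_block1 x ts env X :
  In X (block_forms env ([x], ts)) <->
  exists i T, i < nth x env 0 /\ In T ts /\ X = tden (env ++ [i]) T.
Proof.
  unfold block_forms. cbn [fst snd envs]. rewrite in_flat_map. split.
  - intros (e & He & HX). apply in_flat_map in He as (i & Hi & [<-|[]]).
    apply in_map_iff in HX as (T & <- & HT). apply in_seq in Hi. exists i, T.
    repeat split; auto; lia.
  - intros (i & T & Hi & HT & ->). exists (env ++ [i]). split.
    + apply in_flat_map. exists i. split; [apply in_seq; lia|left; auto].
    + apply in_map; auto.
Qed.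

Lemma in_block2 x y ts env X :
  y < length env ->
  In X (block_forms env ([x; y], ts)) <->
  exists i t T, i < nth x env 0 /\ t < nth y env 0 /\ In T ts /\
    X = tden (env ++ [i; t]) T.
Proof.
  intros Hy. unfold block_forms. cbn [fst snd envs]. rewrite in_flat_map. split.
  - intros (e & He & HX). apply in_flat_map in He as (i & Hi & He).
    apply in_flat_map in He as (t & Ht & [<-|[]]).
    apply in_map_iff in HX as (T & <- & HT). apply in_seq in Hi. apply in_seq in Ht.
    rewrite app_nth1 in Ht by auto. rewrite <- app_assoc. exists i, t, T.
    repeat split; auto; lia.
  - intros (i & t & T & Hi & Ht & HT & ->). exists (env ++ [i; t]). split.
    + apply in_flat_map. exists i. split; [apply in_seq; lia|].
      apply in_flat_map. exists t. rewrite app_nth1 by auto.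
      split; [apply in_seq; lia|left]. rewrite <- app_assoc. reflexivity.
    + apply in_map; auto.
Qed.

Lemma in_with_boxes l T : In T (with_boxes l) <-> In T l \/ exists A, In A l /\ T = TBox A.
Proof.
  unfold with_boxes. rewrite in_app_iff, in_map_iff. split; intros [H|(A & H1 & H2)]; auto.
  - right. exists A. auto.
  - right. exists A. auto.
Qed.

Lemma tden_clause M n N P V i c :
  tden [n; N; P; V; i] (tclause M c) = rule_clause M P V i c.
Proof.
  assert (Ha : forall x, tden [n; N; P; V; i] (tatom M x) = atom_form M P i x).
  { intros [[[x d] r] b]. unfold tatom, atom_form. rewrite tden_cvar. f_equal.
    destruct x; simpl; lia. }
  unfold tclause, rule_clause. rewrite tden_imps, map_app, map_map, tden_level, Ha.
  f_equal. f_equal.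
  - f_equal. unfold aval; simpl. lia.
  - apply map_ext, Ha.
Qed.

Lemma tden_parent n N P V i t : map (tden [n; N; P; V; i; t]) tparent = parent V t.
Proof.
  unfold tparent, parent. rewrite tden_level. f_equal. unfold aval; simpl. lia.
Qed.

Lemma tden_child n N P V i t f : map (tden [n; N; P; V; i; t]) (tchild f) = child V t f.
Proof.
  unfold tchild, child. rewrite map_app, tden_level. f_equal.
  - f_equal. unfold aval; simpl. lia.
  - simpl. destruct f; [|cbn [tden]]; rewrite tden_pvar; reflexivity.
Qed.

Lemma tden_tree_rules M n N P V i t b :
  map (tden [n; N; P; V; i; t]) (tree_rules M b)
  = [rule_left M V t i b; rule_middle M V t i b; rule_right M V t i b].
Proof.
  unfold tree_rules, rule_left, rule_middle, rule_right. cbn [map].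
  rewrite !tden_imps. cbn [tden]. rewrite !tden_imps, !tden_cvar, tden_parent, !tden_child.
  cbn [map list_sum fold_right nth]. rewrite !Nat.add_0_r. reflexivity.
Qed.

Lemma in_hypotheses M c k w X :
  let n := length w in let P := n + poly c k n in let V := nvars M P in
  In X (hypotheses M c k w) <->
  (exists j b, nth_error w j = Some b /\ X = cvar M j false (FR (Some b))) \/
  In X (level (V + 1 + V)) \/ X = cvar M 0 false (FQ (start M)) \/
  (exists i, i < poly c k n /\ X = cvar M (n + i) false (FR None)) \/
  (exists i, i < P /\ X = cvar M i false (FL None)) \/
  is_rule M P V X \/ (exists Y, is_rule M P V Y /\ X = Box Y).
Proof.
  intros n P V. unfold hypotheses. rewrite in_app_iff, in_input_forms.
  fold n. set (e := env0 M c k n).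
  assert (He : e = [n; poly c k n; P; V]) by reflexivity.
  assert (Hb1 : In X (block_forms e ([], tlevel ([(3, 2)], 1)
                                        ++ [tcvar M [] 0 false (FQ (start M))])) <->
                In X (level (V + 1 + V)) \/ X = cvar M 0 false (FQ (start M))).
  { unfold block_forms. cbn [fst snd envs flat_map]. rewrite app_nil_r, map_app, in_app_iff.
    rewrite tden_level. cbn [map In]. rewrite tden_cvar. cbn [map list_sum fold_right].
    replace (aval e ([(3, 2)], 1)) with (V + 1 + V)
      by (rewrite He; unfold aval; cbn [fst snd fold_right nth]; lia).
    rewrite Nat.add_0_r. split; intros [H|H]; auto. destruct H as [H|[]]; auto. }
  assert (Hb4 : In X (block_forms e ([2; 3], with_boxes (flat_map (tree_rules M) (facts M))))
    <-> exists Y, (X = Y \/ X = Box Y) /\ exists i t b, i < P /\ t < V /\ In b (facts M) /\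
     (Y = rule_left M V t i b \/ Y = rule_middle M V t i b \/ Y = rule_right M V t i b)).
  { assert (Hr : forall i t b Y, (exists A, In A (tree_rules M b) /\ Y = tden (e ++ [i; t]) A)
      <-> (Y = rule_left M V t i b \/ Y = rule_middle M V t i b \/ Y = rule_right M V t i b)).
    { intros i t b Y. pose proof (tden_tree_rules M n (poly c k n) P V i t b) as HT.
      rewrite He. cbn [app]. transitivity (In Y (map (tden [n; poly c k n; P; V; i; t])
        (tree_rules M b))).
      - rewrite in_map_iff. split; intros (A & H1 & H2); exists A; auto.
      - rewrite HT. simpl. intuition auto. }
    rewrite in_block2 by (rewrite He; simpl; lia). split.
    - intros (i & t & T & Hi & Ht & HT & ->). rewrite He in Hi, Ht. simpl in Hi, Ht.
      apply in_with_boxes in HT as [HT|(A & HT & ->)]; apply in_flat_map in HT as (b & Hb & HT).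
      + exists (tden (e ++ [i; t]) T). split; [auto|]. exists i, t, b.
        repeat split; auto. apply Hr. eauto.
      + exists (tden (e ++ [i; t]) A). split; [auto|]. exists i, t, b.
        repeat split; auto. apply Hr. eauto.
    - intros (Y & HX & i & t & b & Hi & Ht & Hb & HY).
      apply Hr in HY as (A & HA & ->).
      assert (HA' : In A (flat_map (tree_rules M) (facts M))) by (apply in_flat_map; eauto).
      destruct HX as [->| ->].
      + exists i, t, A. rewrite He; simpl nth. repeat split; auto. apply in_with_boxes; auto.
      + exists i, t, (TBox A). rewrite He; simpl nth. repeat split; auto.
        apply in_with_boxes; eauto. }
  assert (Hb5 : In X (block_forms e ([2], with_boxes (map (tclause M) (clauses M))))
    <-> exists Y, (X = Y \/ X = Box Y) /\
          exists i cl, i < P /\ In cl (clauses M) /\ Y = rule_clause M P V i cl).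
  { rewrite in_block1. split.
    - intros (i & T & Hi & HT & ->). rewrite He in Hi. simpl in Hi.
      apply in_with_boxes in HT as [HT|(A & HT & ->)]; apply in_map_iff in HT as (cl & <- & Hc).
      + eexists. split; [left; reflexivity|]. exists i, cl. repeat split; auto.
        rewrite He. apply tden_clause.
      + eexists. split; [right; reflexivity|]. exists i, cl. repeat split; auto.
        rewrite He. apply tden_clause.
    - intros (Y & HX & i & cl & Hi & Hc & ->).
      assert (HA : In (tclause M cl) (map (tclause M) (clauses M))) by (apply in_map; auto).
      rewrite <- (tden_clause M n (poly c k n) P V i cl) in HX.
      destruct HX as [->| ->].
      + exists i, (tclause M cl). rewrite He; simpl nth. repeat split; auto.
        apply in_with_boxes; auto.
      + exists i, (TBox (tclause M cl)). rewrite He; simpl nth. repeat split; auto.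
        apply in_with_boxes; eauto. }
  assert (Hb2 : In X (block_forms e ([1], [tcvar M [0; 4] 0 false (FR None)])) <->
    exists i, i < poly c k n /\ X = cvar M (n + i) false (FR None)).
  { rewrite in_block1. split.
    - intros (i & T & Hi & [<-|[]] & ->). rewrite He in Hi. exists i. split; [exact Hi|].
      rewrite tden_cvar, He. simpl. f_equal; lia.
    - intros (i & Hi & ->). exists i. eexists. rewrite He. split; [exact Hi|].
      split; [left; reflexivity|]. rewrite tden_cvar. simpl. f_equal; lia. }
  assert (Hb3 : In X (block_forms e ([2], [tcvar M [4] 0 false (FL None)])) <->
    exists i, i < P /\ X = cvar M i false (FL None)).
  { rewrite in_block1. split.
    - intros (i & T & Hi & [<-|[]] & ->). rewrite He in Hi. exists i. split; [exact Hi|].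
      rewrite tden_cvar, He. simpl. f_equal; lia.
    - intros (i & Hi & ->). exists i. eexists. rewrite He. split; [exact Hi|].
      split; [left; reflexivity|]. rewrite tden_cvar. simpl. f_equal; lia. }
  unfold blocks. cbn [flat_map]. rewrite !in_app_iff, Hb1, Hb2, Hb3, Hb4, Hb5.
  clear Hb1 Hb2 Hb3 Hb4 Hb5. unfold is_rule. cbn [In Nat.add]. split.
  - intros [H|[[H|H]|[H|[H|[(Y & [->| ->] & H)|[(Y & [->| ->] & H)|[]]]]]]]; eauto 10.
  - intros [H|[H|[H|[H|[H|[[H|H]|(Y & [H|H] & ->)]]]]]]; eauto 12.
Qed.

(** * Halting within exponential time *)

Fixpoint bool_lists (m : nat) : list (list bool) :=
  match m with
  | 0 => [[]]
  | S m => map (cons true) (bool_lists m) ++ map (cons false) (bool_lists m)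
  end.

Lemma length_bool_lists m : length (bool_lists m) = 2 ^ m.
Proof. induction m; simpl; rewrite ?length_app, ?length_map; lia. Qed.

Lemma in_bool_lists l : In l (bool_lists (length l)).
Proof.
  induction l as [|[] l IH]; simpl; auto; apply in_or_app; [left|right];
    apply in_map; auto.
Qed.

Lemma NoDup_map_seq {A} (f : nat -> A) n a :
  (forall i j, a <= i < j -> j < a + n -> f i <> f j) -> NoDup (map f (seq a n)).
Proof.
  revert a; induction n; intros a H; simpl; constructor.
  - intros Hin. apply in_map_iff in Hin as (j & E & Hj). apply in_seq in Hj.
    apply (H a j); auto; lia.
  - apply IHn. intros i j Hi Hj. apply H; lia.
Qed.

(** Unlike [holds], this uses [nth_error]: the tests have to determine the lists themselves, so the
    end of a list must be told from a blank cell. *)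
Definition cell_test (l : config -> list (option bool)) (i : nat) (s : option bool)
  (a : config) : bool :=
  match nth_error (l a) i, s with
  | Some (Some true), Some true => true
  | Some (Some false), Some false => true
  | Some None, None => true
  | _, _ => false
  end.

Definition right_part (a : config) : list (option bool) := chead a :: cright a.

Definition tests (M : TM) (P : nat) : list (config -> bool) :=
  map (fun q a => cstate a =? q) (seq 0 (nstates M)) ++
  flat_map (fun i => map (cell_test cleft i) symbols ++ map (cell_test right_part i) symbols)
    (seq 0 P).

Lemma length_tests M P : length (tests M P) = nstates M + P * 6.
Proof.
  unfold tests. rewrite length_app, length_map, length_seq. f_equal.
  rewrite (length_flat_map_const _ 6); [rewrite length_seq; auto|auto].
Qed.

Lemma list_eq_cell_tests (l : config -> list (option bool)) a a' P :
  length (l a) <= P -> length (l a') <= P ->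
  (forall i s, i < P -> cell_test l i s a = cell_test l i s a') -> l a = l a'.
Proof.
  intros Ha Ha' H. apply nth_error_ext. intros i.
  destruct (Nat.lt_ge_cases i P) as [Hi|Hi].
  - pose proof (H i None Hi) as H0. pose proof (H i (Some true) Hi) as H1.
    pose proof (H i (Some false) Hi) as H2. unfold cell_test in *.
    destruct (nth_error (l a) i) as [[[]|]|], (nth_error (l a') i) as [[[]|]|];
      auto; discriminate.
  - rewrite (proj2 (nth_error_None _ _)), (proj2 (nth_error_None _ _)) by lia. reflexivity.
Qed.

Lemma tests_injective M P a a' :
  cstate a < nstates M -> length (cleft a) <= P -> length (cright a) < P ->
  length (cleft a') <= P -> length (cright a') < P ->
  map (fun t => t a) (tests M P) = map (fun t => t a') (tests M P) -> a = a'.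
Proof.
  intros Hq Hl Hr Hl' Hr' H.
  assert (Ht : forall t, In t (tests M P) -> t a = t a').
  { revert H. generalize (tests M P). intros ts; induction ts as [|t ts IH]; simpl;
      intros E t0; [contradiction|]. injection E as E1 E2. intros [<-|Hin]; auto. }
  assert (Hs : cstate a = cstate a').
  { assert (E : (cstate a =? cstate a) = (cstate a' =? cstate a)).
    { apply (Ht (fun x => cstate x =? cstate a)). apply in_or_app; left.
      apply (in_map (fun q x => cstate x =? q)), in_seq. lia. }
    rewrite Nat.eqb_refl in E. symmetry in E. apply Nat.eqb_eq in E. auto. }
  assert (HL : cleft a = cleft a').
  { apply (list_eq_cell_tests cleft a a' P); auto. intros i s Hi. apply Ht.
    apply in_or_app; right. apply in_flat_map. exists i. split; [apply in_seq; lia|].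
    apply in_or_app; left. apply in_map, in_symbols. }
  assert (HR : right_part a = right_part a').
  { apply (list_eq_cell_tests right_part a a' P); unfold right_part; simpl; auto.
    intros i s Hi. apply Ht.
    apply in_or_app; right. apply in_flat_map. exists i. split; [apply in_seq; lia|].
    apply in_or_app; right. apply in_map, in_symbols. }
  destruct a, a'; unfold right_part in HR; simpl in *. congruence.
Qed.

Lemma least_nat (Q : nat -> Prop) n : Q n -> exists h, h <= n /\ Q h /\ forall j, j < h -> ~ Q j.
Proof.
  induction n as [n IH] using lt_wf_ind. intros Hn.
  destruct (classic (exists j, j < n /\ Q j)) as [(j & Hj & HQ)|Hno].
  - destruct (IH j Hj HQ) as (h & Hh & Hq & Hmin). exists h. repeat split; auto. lia.
  - exists n. repeat split; auto. intros j Hj HQ. apply Hno. eauto.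
Qed.

Lemma run_halted M w n j :
  halting M (cstate (run M n w)) = true -> n <= j -> run M j w = run M n w.
Proof.
  intros Hh Hj. induction Hj as [|j Hj IH]; [reflexivity|].
  change (run M (S j) w) with (step M (run M j w)). rewrite IH. unfold step.
  rewrite Hh. reflexivity.
Qed.

Lemma run_plus M w n m : run M (n + m) w = Nat.iter m (step M) (run M n w).
Proof. unfold run. apply iter_plus. Qed.

(** Pigeonhole: all configurations before the first halting time [h] are distinct, and they are told
    apart by fewer than [nvars M P] boolean tests. *)
Lemma halting_time M P w n :
  bounded_run M P (fun j => run M j w) -> halting M (cstate (run M n w)) = true ->
  halting M (cstate (run M (2 ^ nvars M P) w)) = true.
Proof.
  intros Hrun Hn.
  destruct (least_nat (fun j => halting M (cstate (run M j w)) = true) n Hn)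
    as (h & _ & Hh & Hmin).
  set (code := fun j => map (fun t => t (run M j w)) (tests M P)).
  assert (Hnd : NoDup (map code (seq 0 h))).
  { apply NoDup_map_seq. intros i j Hij Hj E.
    apply tests_injective in E;
      [|apply (run_state _ _ _ Hrun)|apply (run_left _ _ _ Hrun)|apply (run_right _ _ _ Hrun)
       |apply (run_left _ _ _ Hrun)|apply (run_right _ _ _ Hrun)].
    (* [E] equates the configurations at times [i] and [j], so the machine would halt already at
       [i + (h - j) < h]. *)
    apply (Hmin (i + (h - j))); [lia|]. rewrite run_plus, E, <- run_plus.
    replace (j + (h - j)) with h by lia. exact Hh. }
  assert (Hle : h <= 2 ^ nvars M P).
  { apply (NoDup_incl_length (l' := bool_lists (nstates M + P * 6))) in Hnd.
    - rewrite length_map, length_seq, length_bool_lists in Hnd.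
      eapply Nat.le_trans; [exact Hnd|]. apply Nat.pow_le_mono_r; [lia|].
      unfold nvars, width. nia.
    - intros l Hl. apply in_map_iff in Hl as (j & <- & _).
      rewrite <- (length_tests M P). unfold code.
      rewrite <- (length_map (fun t => t (run M j w)) (tests M P)). apply in_bool_lists. }
  rewrite (run_halted M w h) by auto. exact Hh.
Qed.

Lemma machine_state_bound M w j : TM_wf M -> cstate (run M j w) < nstates M.
Proof.
  intros (Hs & _ & _ & Hd). induction j as [|j IH].
  - destruct w; exact Hs.
  - change (run M (S j) w) with (step M (run M j w)). unfold step.
    destruct (halting M (cstate (run M j w))); [auto|].
    specialize (Hd _ (chead (run M j w)) IH).
    destruct (delta M (cstate (run M j w)) (chead (run M j w))) as [[q s] m]. simpl in Hd.
    destruct m; [destruct (cleft (run M j w))|destruct (cright (run M j w))|]; exact Hd.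
Qed.

(** * Correctness of the reduction *)

(** The remainders [x] and [y] express that the code is prefix-free, which the induction needs at
    binary connectives. *)
Lemma enc_injective A : forall B x y, enc A ++ x = enc B ++ y -> A = B /\ x = y.
Proof.
  induction A as [n| |A1 IH1 A2 IH2|A IH|A1 IH1 A2 IH2];
    intros [m| |B1 B2|B|B1 B2] x y E; simpl in E; try discriminate.
  - injection E as E. assert (n = m /\ x = y) as [-> ->]; [|auto].
    revert m E. induction n; intros [|m] E; simpl in E; try discriminate.
    + injection E as E. auto.
    + injection E as E. apply IHn in E as [-> ->]. auto.
  - injection E as E. auto.
  - injection E as E. rewrite <- !app_assoc in E. apply IH1 in E as [-> E].
    apply IH2 in E as [-> ->]. auto.
  - injection E as E. apply IH in E as [-> ->]. auto.
  - injection E as E. rewrite <- !app_assoc in E. apply IH1 in E as [-> E].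
    apply IH2 in E as [-> ->]. auto.
Qed.

Lemma init_right M w i : nth i (chead (init M w) :: cright (init M w)) None
  = nth i (map Some w) None.
Proof. destruct w; [destruct i as [|[|]]|]; reflexivity. Qed.

Lemma init_left M w : cleft (init M w) = [].
Proof. destruct w; reflexivity. Qed.

Lemma init_state M w : cstate (init M w) = start M.
Proof. destruct w; reflexivity. Qed.

Lemma goal_form M c k (w : list bool) :
  tden (env0 M c k (length w)) (tgoal M) = cvar M 0 true (FQ (qacc M)).
Proof. unfold tgoal. rewrite tden_cvar. reflexivity. Qed.

Lemma accepting_derivable M c k w :
  let P := length w + poly c k (length w) in
  bounded_run M P (fun j => run M j w) ->
  cstate (run M (2 ^ nvars M P) w) = qacc M -> ILthm (reduction M c k w).
Proof.
  intros P Hrun Hacc. apply IL_imps. rewrite goal_form.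
  (* The root is the node with [t = V] and [j = 0]; it remains to find its assumptions among the
     hypotheses. *)
  pose proof (node_derives M P (nvars M P) _ Hrun _ (le_n _) 0 0 (FQ (qacc M))) as H.
  assert (HP : 0 < P) by exact (Nat.le_lt_trans _ _ _ (Nat.le_0_l _) (run_right _ _ _ Hrun 0)).
  specialize (H HP (conj eq_refl Hacc)).
  eapply Dv_cut; [|exact H]. intros X HX. apply Dv_hyp. apply in_hypotheses. fold P.
  destruct HX as [HX|[HX|[HX|(i & b & Hi & Hb & ->)]]]; auto 10.
  change (run M 0 w) with (init M w) in Hb.
  destruct b as [q|s|s]; simpl in Hb.
  - destruct Hb as [-> <-]. rewrite init_state. auto.
  - rewrite init_left in Hb. assert (s = None) as -> by (destruct i; auto).
    do 4 right; left. eauto.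
  - pose proof (init_right M w i) as Hr. simpl in Hr. rewrite Hr in Hb.
    destruct (Nat.lt_ge_cases i (length w)) as [Hl|Hl].
    + left. destruct (nth_error w i) as [b|] eqn:E; [|apply nth_error_None in E; lia].
      exists i, b. split; [auto|]. f_equal. f_equal. rewrite <- Hb.
      apply nth_error_nth. rewrite nth_error_map, E. reflexivity.
    + do 3 right; left. exists (i - length w). split; [unfold P in Hi; lia|].
      replace (length w + (i - length w)) with i by lia. f_equal. f_equal.
      rewrite <- Hb. apply nth_overflow. rewrite length_map. auto.
Qed.

Lemma derivable_accepting M c k w :
  let P := length w + poly c k (length w) in
  TM_wf M -> bounded_run M P (fun j => run M j w) ->
  ILthm (reduction M c k w) -> cstate (run M (2 ^ nvars M P) w) = qacc M.
Proof.
  intros P Hwf Hrun Hth. set (V := nvars M P). set (a := fun j => run M j w) in *.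
  assert (HP : 0 < P) by exact (Nat.le_lt_trans _ _ _ (Nat.le_0_l _) (run_right _ _ _ Hrun 0)).
  assert (Hq : qacc M < nstates M) by apply Hwf.
  assert (Hs : start M < nstates M) by apply Hwf.
  (* The root world at time 0; its flag is arbitrary. *)
  pose proof (soundness _ _ _ (model_veltman M V a) Hth (V + 1 + V, true, 0)) as H.
  unfold reduction in H. rewrite forces_imps, goal_form in H.
  assert (Hcvar := model_cvar M P a (V + 1 + V) true 0). cbv zeta in Hcvar. fold V in Hcvar.
  rewrite (Hcvar 0 true (FQ (qacc M))) in H by (try apply in_facts_Q; auto; lia).
  replace (V + 1 + V - V - 1) with V in H by lia. rewrite Nat.add_0_l in H.
  apply H. clear H. intros X HX. apply in_hypotheses in HX. fold P V in HX.
  destruct HX as [(i & b & Hi & ->)|[HX|[->|[(i & Hi & ->)|[(i & Hi & ->)|[HX|(Y & HY & ->)]]]]]].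
  - assert (Hl : i < length w) by (apply nth_error_Some; congruence).
    rewrite Hcvar by (try apply in_facts_R; unfold P; lia).
    change (nth i (chead (init M w) :: cright (init M w)) None = Some b).
    rewrite init_right. apply nth_error_nth. rewrite nth_error_map, Hi. reflexivity.
  - revert X HX. apply model_level. reflexivity.
  - rewrite Hcvar by (try apply in_facts_Q; auto; lia). split; [auto|]. apply init_state.
  - rewrite Hcvar by (try apply in_facts_R; unfold P; lia).
    change (nth (length w + i) (chead (init M w) :: cright (init M w)) None = None).
    rewrite init_right. apply nth_overflow. rewrite length_map. lia.
  - rewrite Hcvar by (try apply in_facts_L; lia).
    change (nth i (cleft (init M w)) None = None). rewrite init_left. destruct i; auto.
  - apply model_rule; auto.
  - intros u _. apply model_rule; auto.
Qed.

Theorem mainTheorem3 : PSPACE_hard IL0.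
Proof.
  intros L (M & c & k & Hwf & HM).
  exists (fun w => enc (reduction M c k w)). split; [apply reduction_poly_time|].
  intros w. destruct (HM w) as (n & Hn & Hacc & Hspace).
  set (P := length w + poly c k (length w)).
  assert (Hrun : bounded_run M P (fun j => run M j w)).
  (* The space bound is given up to the halting time [n]; later configurations equal the one at
     [n]. *)
  { assert (Hc : forall j, cells (run M j w) <= poly c k (length w)).
    { intros j. destruct (Nat.le_gt_cases j n) as [Hj|Hj]; [auto|].
      rewrite (run_halted M w n) by (auto; lia). auto. }
    unfold cells in Hc. split.
    - reflexivity.
    - intros j. apply machine_state_bound, Hwf.
    - intros j. specialize (Hc j). unfold P. lia.
    - intros j. specialize (Hc j). unfold P. lia. }
  (* The machine has halted both at [n] and at [2 ^ nvars M P], so the states there agree, whichever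
     time is larger. *)
  assert (HL : L w <-> cstate (run M (2 ^ nvars M P) w) = qacc M).
  { rewrite <- Hacc. pose proof (halting_time M P w n Hrun Hn) as Hh.
    destruct (Nat.le_ge_cases n (2 ^ nvars M P)) as [Hle|Hle].
    - rewrite (run_halted M w n (2 ^ nvars M P)) by auto. reflexivity.
    - rewrite (run_halted M w (2 ^ nvars M P) n) by auto. reflexivity. }
  rewrite HL. split.
  - intros H. exists (reduction M c k w). split; [apply reduction_closed|].
    split; [reflexivity|]. apply accepting_derivable; auto.
  - intros (A & _ & E & HA).
    destruct (enc_injective A (reduction M c k w) [] []) as [-> _].
    + rewrite !app_nil_r. exact E.
    + apply derivable_accepting in HA; auto.
Qed.
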